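(* Let $\{a,b,c,d\}$ be a $D(4)$-quadruple with $a<b<c<d$. If one of the following conditions holds: \begin{enumerate} \item[i)] $b<2a$ and $c\geq 890b^4$, \item[ii)] $2a\leq b\leq 12a$ and $c\geq 1613b^4$, \item[iii)] $b>12a$ and $c\geq 39247b^4$, \end{enumerate} then $d=d_+(a,b,c)$.
   Context: A $D(4)$-$m$-tuple (triple, quadruple for $m=3,4$) is a set of $m$ distinct positive integers such that the product of any two distinct elements increased by $4$ is a perfect square. For a $D(4)$-triple $\{a,b,c\}$, $d_{+}(a,b,c)=a+b+c+\frac12\left(abc+\sqrt{(ab+4)(ac+4)(bc+4)}\right)$. *)

(* Defs.v *)
From Stdlib Require Import Reals ZArith List.

Open Scope Z_scope.

Definition perfect_square (n : Z) : Prop := exists k : Z, n = k ^ 2.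

(* A finite set of integers is given by a duplicate-free list of its elements;
   the order of the list is irrelevant. *)
Definition D4_tuple (m : nat) (S : list Z) : Prop :=
  length S = m /\
  NoDup S /\
  (forall x, In x S -> 0 < x) /\
  (forall x y, In x S -> In y S -> x <> y -> perfect_square (x * y + 4)).

Definition D4_quadruple : list Z -> Prop := D4_tuple 4.

(* Real-valued, so that neither the square root nor the halving is truncated;
   meaningful when {a, b, c} is a D(4)-triple. *)
Definition d_plus (a b c : Z) : R :=
  (IZR a + IZR b + IZR c +
   1 / 2 * (IZR a * IZR b * IZR c +
            sqrt ((IZR a * IZR b + 4) * (IZR a * IZR c + 4)
                  * (IZR b * IZR c + 4))))%R.

(* Main.v *)
(* Suppose that d is not one of the two regular extensions of {a, b, c}, and let
   c d + 4 = z^2. Eliminating d gives two Pell-type equations, so z lies on two chains of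
   solutions; comparing both chains modulo 2 c^2 and by size shows that the step numbers m >= n
   at which they meet cannot be small: if b t (m + 1)^2 < 2 c with t^2 = b c + 4, the congruence
   becomes an equality between small integers, which contradicts the growth rates in every
   case. The hardest case is a chain starting at a D(4)-extension e of {a, b, c} with e < c;
   if e is neither regular nor small, a gap principle 4 c >= b^2 e^3 applies. Hence
   z >= c (a c + 1)^M for a suitable M.
   In the other direction, the numbers z, t y / b and s x / a are close to each other, so that
   sqrt(1 + 4 X / (a b c)) at the nodes X = 0, a, b is approximated well by rationals of
   denominator z. A Hermite-Padé type functional (a sum of three residues) applied to these
   jets is a nonzero rational number of bounded denominator, and it is small by Rolle's
   theorem and by size estimates. This gives a lower bound for |z| X^k + Q^k / z for all k,
   which excludes c (a c + 1)^M <= z. *)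

(* No upper bound for [z] is available, and for a fixed [k] the Padé inequality excludes only an
   interval of values of [z]. But the intervals for [k] and [k + 1] overlap once [c] is large
   compared with the parameter [W], so that everything above the lower end of the first interval is
   excluded, and only that end must be reached by [c (a c + 1)^M <= z]. The congruence caps [M]
   through [b t (M + 1)^2 < 2 c], while the overlap asks for a large first exponent [K' + 2]; the
   hypotheses on [c] leave room for both. The free radius [rho] is taken as large as [2 rho <= a]
   and [2 rho <= b - a] allow, which separates [b < 2 a] from the rest. [W] has order [b^3] while
   [b / a] is bounded, and order [b^4], like [c], otherwise; in that last case [M] has to grow like
   [log b]. The exponent [k + 1/2], rather than [1/2], has this reason: up to order [k] the jets
   contain only nonnegative powers of [t^2 / (b c)] and [s^2 / (a c)], so that the common
   denominator contains [c] only to the power [k]. *)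
Require Import Defs.
From Stdlib Require Import Reals ZArith List.
From Stdlib Require Import Lia Lra Psatz Bool FunctionalExtensionality.
From mathcomp Require all_boot all_order all_algebra Rstruct ring lra zify.
Open Scope Z_scope.

(** * Rolle's theorem with multiplicities *)

Section Rolle.
Local Open Scope R_scope.

(* A repeated node [z i = ... = z (i + j)] stands for a zero of multiplicity [j + 1]. *)
Lemma rolle_multiple (n : nat) : forall (F : nat -> R -> R) (z : nat -> R),
  (forall i, (i < n)%nat -> z i <= z (S i)) ->
  (forall i x, (i < n)%nat -> z O <= x <= z n -> derivable_pt_lim (F i) x (F (S i) x)) ->
  (forall i j, (i + j <= n)%nat -> z i = z (i + j)%nat -> F j (z i) = 0) ->
  exists xi, z O <= xi <= z n /\ F n xi = 0.
Proof.
  induction n as [|n IH]; intros F z Hz HF H0.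
  - exists (z O). split; [lra|]. apply (H0 O O); [lia|reflexivity].
  - assert (mono : forall i j, (i + j <= S n)%nat -> z i <= z (i + j)%nat).
    { intros i j; induction j as [|j IHj]; intros Hij.
      - rewrite Nat.add_0_r; lra.
      - rewrite Nat.add_succ_r. apply Rle_trans with (z (i + j)%nat); [apply IHj; lia|].
        apply Hz; lia. }
    (* A zero of the derivative may sit at an end of its interval only if the interval is
       degenerate. This lets coincidences among the new zeros be traced back to the nodes. *)
    assert (W : forall i, (i <= n)%nat -> exists w, z i <= w <= z (S i) /\ F 1%nat w = 0 /\
                 (w = z i -> z i = z (S i)) /\ (w = z (S i) -> z i = z (S i))).
    { intros i Hi. destruct (Req_dec (z i) (z (S i))) as [E|E].
      - exists (z i). repeat split; try lra; auto.
        apply (H0 i 1%nat); [lia|]. now rewrite Nat.add_1_r.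
      - assert (L : z i < z (S i)) by (specialize (Hz i ltac:(lia)); lra).
        assert (zi : z O <= z i) by (apply (mono O i); lia).
        assert (zs : z (S i) <= z (S n)).
        { replace (S n) with (S i + (n - i))%nat by lia. apply mono; lia. }
        destruct (MVT_cor2 (F O) (F 1%nat) (z i) (z (S i)) L) as [w [Hw1 Hw2]].
        { intros c Hc. apply HF; [lia|lra]. }
        rewrite (H0 (S i) O), (H0 i O) in Hw1 by (try lia; now rewrite Nat.add_0_r).
        exists w. split; [lra|]. split; [|split; lra].
        assert (P : F 1%nat w * (z (S i) - z i) = 0) by lra.
        apply Rmult_integral in P. destruct P; lra. }
    assert (G : exists w : nat -> R, forall i, (i <= n)%nat ->
       z i <= w i <= z (S i) /\ F 1%nat (w i) = 0 /\
                 (w i = z i -> z i = z (S i)) /\ (w i = z (S i) -> z i = z (S i))).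
    (* Finite choice, by induction on the number of intervals. *)
    { clear - W. assert (V : forall m, (m <= S n)%nat -> exists w : nat -> R, forall i, (i < m)%nat ->
         z i <= w i <= z (S i) /\ F 1%nat (w i) = 0 /\
                 (w i = z i -> z i = z (S i)) /\ (w i = z (S i) -> z i = z (S i))).
      { induction m as [|m IHm]; intros Hm.
        - exists z. intros; lia.
        - destruct IHm as [w Hw]; [lia|]. destruct (W m) as [v Hv]; [lia|].
          exists (fun i => if Nat.eq_dec i m then v else w i). intros i Hi.
          destruct (Nat.eq_dec i m) as [->|Hne]; [exact Hv|]. apply Hw; lia. }
      destruct (V (S n) (le_n _)) as [w Hw]. exists w. intros i Hi. apply Hw; lia. }
    destruct G as [w Hw].
    assert (z0w : z O <= w O) by (destruct (Hw O ltac:(lia)); lra).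
    assert (wnz : w n <= z (S n)) by (destruct (Hw n ltac:(lia)); lra).
    destruct (IH (fun i => F (S i)) w) as [xi [Hxi HFxi]].
    + intros i Hi. destruct (Hw i ltac:(lia)) as [A _]. destruct (Hw (S i) ltac:(lia)) as [B _]. lra.
    + intros i x Hi Hx. apply HF; [lia|lra].
    + intros i j Hij E. destruct j as [|j].
      * apply Hw; lia.
      * destruct (Hw i ltac:(lia)) as [A [_ [A1 A2]]].
        destruct (Hw (i + S j)%nat ltac:(lia)) as [B [_ [B1 B2]]].
        (* Equal values of [w] squeeze the nodes between them to the same value and then reach the
           outer ends: a run of coinciding new zeros comes from a run of nodes longer by one. *)
        assert (M : z (S i) <= z (i + S j)%nat).
        { replace (i + S j)%nat with (S i + j)%nat by lia. apply mono; lia. }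
        assert (E1 : w i = z (S i)) by lra.
        assert (E2 : w (i + S j)%nat = z (i + S j)%nat) by lra.
        specialize (A2 E1). specialize (B1 E2).
        assert (E3 : w i = z i) by lra. rewrite E3.
        apply (H0 i (S (S j))); [lia|].
        replace (i + S (S j))%nat with (S (i + S j)) by lia. lra.
    + exists xi. split; [lra|exact HFxi].
Qed.
End Rolle.

(** * The Padé-type bound *)

Module Pade.
Import all_boot all_order all_algebra Rstruct ring lra zify.
Import Order.TTheory GRing.Theory Num.Theory.
Set Implicit Arguments. Unset Strict Implicit. Unset Printing Implicit Defensive.
Local Open Scope ring_scope.

(** Congruence modulo ['X^n]: truncated power series are polynomials whose higher coefficients are
    ignored. *)
Definition eqlow (F : nzRingType) n (u v : {poly F}) := forall h, (h < n)%N -> u`_h = v`_h.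

Lemma eqlowM (F : nzRingType) n (u v f g : {poly F}) :
  eqlow n u v -> eqlow n f g -> eqlow n (u * f) (v * g).
Proof.
move=> uv fg h hn; rewrite !coefM; apply: eq_bigr => -[i /=]; rewrite ltnS => ih _.
by rewrite uv ?fg //; [exact: leq_ltn_trans (leq_subr _ _) hn | exact: leq_ltn_trans ih hn].
Qed.

(** * Hermite interpolation and divided differences as sums of residues *)

Section HermiteFunctional.
Variables (F : fieldType) (I : finType) (nd : I -> F) (M : nat).
Hypothesis nd_inj : injective nd.
Implicit Types (kap : I -> nat) (f g : I -> {poly F}) (P Q : {poly F}).

(** The power series of [1 / ('X + al)], cut at order [M]. *)
Definition tinv (al : F) : {poly F} := \poly_(h < M) (- (- al^-1) ^+ h.+1).

Lemma tinvP al : al != 0 -> eqlow M (('X + al%:P) * tinv al) 1.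
Proof.
move=> al0 h hM; rewrite mulrDl coefD coefXM coefCM coef1 !coef_poly hM.
case: h hM => [|h] hM /=; first by rewrite add0r mulrN expr1 mulrN opprK divff.
rewrite (ltnW hM) !exprS; set y := _ ^+ h.
by clearbody y; rewrite !mulNr !mulrN !opprK !mulrA divff // mul1r addrN.
Qed.

(** The expansion at node [j], in the local variable ['X = z - nd j], of the inverse of the nodal
    polynomial without its factor at [j]. *)
Definition loc kap j : {poly F} := \prod_(l | l != j) tinv (nd j - nd l) ^+ kap l.

(** The residue at node [j] of a function with jet [u] divided by the nodal polynomial; a node of
    multiplicity zero contributes nothing. *)
Definition res kap j (u : {poly F}) : F :=
  if kap j is n.+1 then (u * loc kap j)`_n else 0.

(** As a sum of all residues, this is the divided difference at the nodes repeated according to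
    [kap]. *)
Definition hfun kap f : F := \sum_j res kap j (f j).

Definition decr kap l : I -> nat := fun j => if j == l then (kap j).-1 else kap j.
Definition incr kap l : I -> nat := fun j => if j == l then (kap j).+1 else kap j.
Definition total kap := (\sum_j kap j)%N.

Definition jets P : I -> {poly F} := fun j => P \Po ('X + (nd j)%:P).

Lemma eq_loc kap kap' j : (forall l, l != j -> kap l = kap' l) -> loc kap j = loc kap' j.
Proof. by move=> e; apply: eq_bigr => l lj; rewrite e. Qed.

Lemma eq_hfun kap kap' f : kap =1 kap' -> hfun kap f = hfun kap' f.
Proof.
move=> e; apply: eq_bigr => j _; rewrite /res e; case: (kap' j) => // n.
by rewrite (@eq_loc kap kap').
Qed.

Lemma res_eqlow kap j (u v : {poly F}) : eqlow (kap j) u v -> res kap j u = res kap j v.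
Proof.
rewrite /res; case: (kap j) => // n e.
by apply: (@eqlowM _ n.+1) => // h.
Qed.

Lemma hfun_eqlow kap f g : (forall j, eqlow (kap j) (f j) (g j)) -> hfun kap f = hfun kap g.
Proof. by move=> e; apply: eq_bigr => j _; apply: res_eqlow. Qed.

Lemma resD kap j u v : res kap j (u + v) = res kap j u + res kap j v.
Proof. by rewrite /res; case: (kap j) => [|n]; rewrite ?addr0 // mulrDl coefD. Qed.

Lemma resZ kap j c u : res kap j (c *: u) = c * res kap j u.
Proof. by rewrite /res; case: (kap j) => [|n]; rewrite ?mulr0 // -scalerAl coefZ. Qed.

Lemma hfunD kap f g : hfun kap (fun j => f j + g j) = hfun kap f + hfun kap g.
Proof. by rewrite /hfun -big_split; apply: eq_bigr => j _; rewrite resD. Qed.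

Lemma hfunZ kap c f : hfun kap (fun j => c *: f j) = c * hfun kap f.
Proof. by rewrite /hfun mulr_sumr; apply: eq_bigr => j _; rewrite resZ. Qed.

Lemma loc_incr kap l j : j != l ->
  loc (incr kap l) j = loc kap j * tinv (nd j - nd l).
Proof.
move=> jl; rewrite /loc (bigD1 l) 1?eq_sym //= [in RHS](bigD1 l) 1?eq_sym //=.
rewrite {1}/incr eqxx exprS.
rewrite (eq_bigr (fun i => tinv (nd j - nd i) ^+ kap i)); first by ring.
by move=> i /andP [_ il]; rewrite /incr (negPf il).
Qed.

(** A factor [z - nd l] of the numerator cancels one copy of the node [l], so both sides are
    residues of the same quotient. At the node [l] the factor shifts coefficients, elsewhere [tinv]
    inverts it. *)
Lemma hfun_mulX kap l f : (forall j, kap j <= M)%N ->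
  hfun (incr kap l) (fun j => ('X + (nd j - nd l)%:P) * f j) = hfun kap f.
Proof.
move=> kM; apply: eq_bigr => j _.
have [<-|jl] := eqVneq j l.
  rewrite subrr addr0 /res /incr eqxx -mulrA coefXM.
  rewrite (@eq_loc _ kap); last by move=> i ij; rewrite (negPf ij).
  by case: (kap j).
rewrite /res /incr (negPf jl) -/(incr kap l) loc_incr //.
case E: (kap j) => [//|n].
rewrite (_ : _ * _ * _ = (f j * loc kap j) * (('X + (nd j - nd l)%:P) * tinv (nd j - nd l))); last by ring.
transitivity ((f j * loc kap j * 1)`_n); last by rewrite mulr1.
apply: (@eqlowM _ M) => //; last by rewrite -E; exact: kM.
by apply: tinvP; rewrite subr_eq0 (inj_eq nd_inj).
Qed.

Lemma decrK kap l : (0 < kap l)%N -> incr (decr kap l) l =1 kap.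
Proof. by move=> k0 j; rewrite /incr /decr; case: eqVneq => [->|//]; rewrite prednK. Qed.

Lemma total_incr kap l : total (incr kap l) = (total kap).+1.
Proof.
rewrite /total (bigD1 l) // [in RHS](bigD1 l) //= {1}/incr eqxx addSn.
by congr (_ + _).+1; apply: eq_bigr => j /negPf jl; rewrite /incr jl.
Qed.

Lemma total_decr kap l : (0 < kap l)%N -> total kap = (total (decr kap l)).+1.
Proof. by move=> k0; rewrite -(total_incr _ l); apply: eq_bigr => j _; rewrite decrK. Qed.

Lemma decr_leq kap l j : (decr kap l j <= kap j)%N.
Proof. by rewrite /decr; case: ifP => // _; exact: leq_pred. Qed.

Lemma total_gt0 kap : (0 < total kap)%N -> exists l, (0 < kap l)%N.
Proof.
case: (pickP (fun l => 0 < kap l)%N) => [l ? _|k0]; first by exists l.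
by rewrite /total big1 // => j _; apply/eqP; rewrite -leqn0 leqNgt k0.
Qed.

Lemma jets_mulX l Q j : jets (('X - (nd l)%:P) * Q) j = ('X + (nd j - nd l)%:P) * jets Q j.
Proof. by rewrite /jets comp_polyM comp_polyB comp_polyX comp_polyC polyCB addrA. Qed.

Lemma jetsD P Q j : jets (P + Q) j = jets P j + jets Q j.
Proof. exact: comp_polyD. Qed.

Lemma jetsZ c P j : jets (c *: P) j = c *: jets P j.
Proof. exact: comp_polyZ. Qed.

Lemma jets1 j : jets 1 j = 1.
Proof. exact: comp_polyC. Qed.

(** The residues of the inverse of a polynomial of degree at least two add up to zero. With two
    distinct nodes, their difference is a difference of two linear factors; each factor cancels one
    node, and the two shorter sums agree. With a single node the coefficient is explicit. *)
Lemma hfun1 n kap : (forall j, kap j <= M)%N -> total kap = n.+1 ->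
  hfun kap (fun=> 1) = (n == 0%N)%:R.
Proof.
elim: n kap => [|n IH] kap kM tk.
  have [l l0] : exists l, (0 < kap l)%N by apply: total_gt0; rewrite tk.
  have := total_decr l0; rewrite tk => -[td].
  have k0 j : decr kap l j = 0%N.
    by apply/eqP; rewrite -leqn0 td /total (bigD1 j) //= leq_addr.
  rewrite /hfun (bigD1 l) //= big1 ?addr0 => [|j jl].
    rewrite /res; have := k0 l; rewrite /decr eqxx; case: (kap l) l0 => // -[|//] _ _.
    rewrite mul1r /loc big1 ?coef1 // => j jl.
    by have := k0 j; rewrite /decr (negPf jl) => ->.
  by rewrite /res; have := k0 j; rewrite /decr (negPf jl) => ->.
have [l l0] : exists l, (0 < kap l)%N by apply: total_gt0; rewrite tk.
have tl : total (decr kap l) = n.+1 by have := total_decr l0; rewrite tk => -[].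
have dM l' j : (decr kap l' j <= M)%N by exact: leq_trans (decr_leq _ _ _) (kM j).
case: (pickP (fun l' => (l' != l) && (0 < kap l')%N)) => [l' /andP[l'l l'0]|k0].
  have tl' : total (decr kap l') = n.+1 by have := total_decr l'0; rewrite tk => -[].
  have mulXE m : (0 < kap m)%N -> hfun kap (fun j => 'X + (nd j - nd m)%:P) = hfun (decr kap m) (fun=> 1).
    move=> m0; rewrite -(hfun_mulX m _ (dM m)) (eq_hfun _ (decrK m0)).
    by apply: eq_bigr => j _; rewrite mulr1.
  have /eqP : (nd l' - nd l) * hfun kap (fun=> 1) = 0.
    rewrite -hfunZ; transitivity (hfun kap (fun j => ('X + (nd j - nd l)%:P) + (-1) *: ('X + (nd j - nd l')%:P))).
      apply: eq_bigr => j _; congr (res _ _ _).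
      by rewrite scaleN1r -mul_polyC mulr1 !polyCB; ring.
    by rewrite hfunD hfunZ !mulXE // (IH _ (dM l) tl) (IH _ (dM l') tl') mulN1r addrN.
  by rewrite mulf_eq0 subr_eq0 (inj_eq nd_inj) (negPf l'l) => /eqP.
have kl : kap l = n.+2.
  rewrite -tk /total (bigD1 l) //= big1 ?addn0 // => j jl.
  by apply/eqP; rewrite -leqn0 leqNgt; have := k0 j; rewrite jl /= => ->.
have kj j : j != l -> kap j = 0%N.
  by move=> jl; apply/eqP; rewrite -leqn0 leqNgt; have := k0 j; rewrite jl /= => ->.
rewrite /hfun (bigD1 l) //= big1 ?addr0 => [|j jl]; last by rewrite /res kj.
rewrite /res kl mul1r /loc big1 ?coef1 // => j jl.
by rewrite kj.
Qed.

(* Divided differences read off the top coefficient. *)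
Lemma hfun_jets n kap P : (forall j, kap j <= M)%N -> total kap = n.+1 ->
  (size P <= n.+1)%N -> hfun kap (jets P) = P`_n.
Proof.
elim: n kap P => [|n IH] kap P kM tk sP.
  have -> : P = P`_0 *: 1 by rewrite -mul_polyC mulr1; exact: size1_polyC.
  transitivity (hfun kap (fun=> P`_0 *: 1)).
    by apply: eq_bigr => j _; rewrite jetsZ /jets comp_polyC.
  by rewrite hfunZ (hfun1 kM tk) coefZ coef1 /=.
have [l l0] : exists l, (0 < kap l)%N by apply: total_gt0; rewrite tk.
have tl : total (decr kap l) = n.+1 by have := total_decr l0; rewrite tk => -[].
have dM j : (decr kap l j <= M)%N by exact: leq_trans (decr_leq _ _ _) (kM j).
have [Q PE] : exists Q, P = ('X - (nd l)%:P) * Q + P.[nd l] *: 1.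
  have /factor_theorem [Q QE] : root (P - (P.[nd l])%:P) (nd l).
    by rewrite rootE !hornerE subrr.
  exists Q; rewrite mulrC -QE -mul_polyC mulr1; ring.
have sQ : (size Q <= n.+1)%N.
  have [->|Q0] := eqVneq Q 0; first by rewrite size_poly0.
  have: (size (('X - (nd l)%:P) * Q)%R <= n.+2)%N.
    have -> : ('X - (nd l)%:P) * Q = P - P.[nd l] *: 1 by apply/esym/eqP; rewrite subr_eq; apply/eqP.
    apply: (leq_trans (size_polyD _ _)); rewrite geq_max sP size_polyN.
    by apply: (leq_trans (size_scale_leq _ _)); rewrite size_poly1.
  by rewrite mulrC size_Mmonic ?monicXsubC // size_XsubC addn2 /= ltnS.
have -> : P`_n.+1 = Q`_n.
  rewrite {1}PE coefD coefZ coef1 mulr0 addr0 mulrBl coefB coefXM coefCM /=.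
  by rewrite (nth_default _ sQ) mulr0 subr0.
rewrite -(IH _ _ dM tl sQ) -(hfun_mulX l _ dM) (eq_hfun _ (decrK l0)).
transitivity (hfun kap (fun j => jets (('X - (nd l)%:P) * Q) j + P.[nd l] *: 1)).
  by apply: eq_bigr => j _; rewrite {1}PE jetsD jetsZ jets1.
rewrite hfunD hfunZ (hfun1 kM tk) mulr0 addr0.
by apply: eq_bigr => j _; rewrite jets_mulX.
Qed.

Definition matches kap f P := forall j, eqlow (kap j) (jets P j) (f j).

Lemma hfun_matches n kap f P : (forall j, kap j <= M)%N -> total kap = n.+1 ->
  (size P <= n.+1)%N -> matches kap f P -> hfun kap f = P`_n.
Proof. by move=> kM tk sP mP; rewrite -(hfun_jets kM tk sP); apply: hfun_eqlow => j h hj; rewrite mP. Qed.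

Lemma matches0_eq0 kap P : (forall j, kap j <= M)%N ->
  (size P <= total kap)%N -> matches kap (fun=> 0) P -> P = 0.
Proof.
move Dn: (total kap) => n; elim: n kap Dn => [|n IH] kap tk kM sP mP.
  by apply/eqP; rewrite -size_poly_leq0.
have Pn : P`_n = 0.
  rewrite -(hfun_matches kM tk sP mP) /hfun big1 // => j _.
  by rewrite /res; case: (kap j) => // m; rewrite mul0r coef0.
have [l l0] : exists l, (0 < kap l)%N by apply: total_gt0; rewrite tk.
have tl : total (decr kap l) = n by have := total_decr l0; rewrite tk => -[].
apply: (IH (decr kap l)) => // [j||j h hj].
- exact: leq_trans (decr_leq _ _ _) (kM j).
- apply/leq_sizeP => i; rewrite leq_eqVlt => /orP [/eqP <- //|ni].
  by apply: nth_default; exact: leq_trans sP ni.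
- by apply: mP; exact: leq_trans hj (decr_leq _ _ _).
Qed.

Definition nodal kap : {poly F} := \prod_l ('X - (nd l)%:P) ^+ kap l.

Lemma nodal_monic kap : nodal kap \is monic.
Proof. by apply: monic_prod => l _; rewrite monic_exp // monicXsubC. Qed.

Lemma size_nodal kap : size (nodal kap) = (total kap).+1.
Proof.
rewrite /nodal size_prod => [|l _]; last by rewrite expf_neq0 // polyXsubC_eq0.
rewrite (eq_bigr (fun l => kap l + 1)%N); last by move=> l _; rewrite size_exp_XsubC addn1.
by rewrite big_split /= sum_nat_const muln1 subSn ?leq_addl // addnK.
Qed.

Lemma jets_nodal kap l : jets (nodal kap) l =
  'X^(kap l) * \prod_(j | j != l) ('X + (nd l - nd j)%:P) ^+ kap j.
Proof.
rewrite /jets /nodal rmorph_prod /= (bigD1 l) //= rmorphXn /= comp_polyB comp_polyX comp_polyC addrK.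
congr (_ * _); apply: eq_bigr => j _.
by rewrite rmorphXn /= comp_polyB comp_polyX comp_polyC polyCB addrA.
Qed.

Lemma jets_nodal_lt kap l h : (h < kap l)%N -> (jets (nodal kap) l)`_h = 0.
Proof. by move=> hk; rewrite jets_nodal coefXnM hk. Qed.

Lemma jets_nodal_neq0 kap l : (jets (nodal kap) l)`_(kap l) != 0.
Proof.
rewrite jets_nodal coefXnM ltnn subnn -horner_coef0 horner_prod.
apply/prodf_neq0 => j jl; rewrite horner_exp expf_neq0 //.
by rewrite !hornerE subr_eq0 (inj_eq nd_inj) eq_sym.
Qed.

(** Newton's step: the nodal polynomial does not disturb the conditions already met, and its next
    coefficient at node [l] is nonzero. *)
Lemma matches_incr kap f P l : matches kap f P ->
  exists c, matches (incr kap l) f (P + c *: nodal kap).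
Proof.
move=> mP; exists (((f l)`_(kap l) - (jets P l)`_(kap l)) / (jets (nodal kap) l)`_(kap l)).
move=> j h; rewrite jetsD jetsZ coefD coefZ /incr.
case: eqVneq => [->|jl hj]; last by rewrite (jets_nodal_lt hj) mulr0 addr0 mP.
rewrite ltnS leq_eqVlt => /orP [/eqP ->|hl]; last by rewrite (jets_nodal_lt hl) mulr0 addr0 mP.
by rewrite divfK ?jets_nodal_neq0 // addrC subrK.
Qed.

Lemma interpolation kap f : exists2 P : {poly F}, (size P <= total kap)%N & matches kap f P.
Proof.
move Dn: (total kap) => n; elim: n kap Dn => [|n IH] kap tk.
  exists 0; first by rewrite size_poly0.
  move=> j h; have -> // : kap j = 0%N.
  by apply/eqP; rewrite -leqn0 -tk /total (bigD1 j) //= leq_addr.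
have [l l0] : exists l, (0 < kap l)%N by apply: total_gt0; rewrite tk.
have tl : total (decr kap l) = n by have := total_decr l0; rewrite tk => -[].
have [P sP mP] := IH _ tl.
have [c mc] := matches_incr l mP.
exists (P + c *: nodal (decr kap l)).
  apply: (leq_trans (size_polyD _ _)); rewrite geq_max (leq_trans sP) //.
  by apply: (leq_trans (size_scale_leq _ _)); rewrite size_nodal tl.
by move=> j h hj; apply: mc; rewrite decrK.
Qed.

(* If adding any one node to the node system does not change the interpolation
   polynomial, then it already matches one more derivative at every node. *)
Lemma hfun_incr_eq0 kap f P : (forall j, kap j < M)%N ->
  (size P <= total kap)%N -> matches kap f P ->
  (forall i, hfun (incr kap i) f = 0) -> matches (fun j => (kap j).+1) f P.
Proof.
move=> kM sP mP h0 i; have [c mc] := matches_incr i mP.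
suff c0 : c = 0.
  by move=> h hi; have := mc i h; rewrite c0 scale0r addr0; apply; rewrite /incr eqxx.
rewrite -(h0 i) (@hfun_matches (total kap) _ _ (P + c *: nodal kap)) //.
- rewrite coefD coefZ (nth_default _ sP) add0r.
  by have /monicP := nodal_monic kap; rewrite /lead_coef size_nodal /= => ->; rewrite mulr1.
- by move=> j; rewrite /incr; case: ifP => // _; exact: ltnW.
- exact: total_incr.
- apply: (leq_trans (size_polyD _ _)); rewrite geq_max (leq_trans sP) //.
  by apply: (leq_trans (size_scale_leq _ _)); rewrite size_nodal.
Qed.
End HermiteFunctional.

Section NonVanishing.
Variables (F : numFieldType) (I : finType) (nd : I -> F) (k : nat).
Hypothesis nd_inj : injective nd.

(* The jets [f j] solve the equation [(1 + x z) y' = (k + 1/2) x y] of [(1 + x z)^(k + 1/2)]. *)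
Lemma hfun_sqrt_neq0 (x : F) (f : I -> {poly F}) : x != 0 ->
  (forall j h, (h < k)%N ->
     (f j)`_h.+1 *+ h.+1 * (1 + x * nd j) *+ 2 = (f j)`_h * x * ((2 * k + 1)%:R - (2 * h)%:R)) ->
  (forall i, hfun nd k.+1 (incr (fun=> k) i) f = 0) -> forall j, (f j)`_0 = 0.
Proof.
move=> x0 fE h0.
have [P sP mP] := interpolation nd_inj (fun=> k) f.
have mP' := hfun_incr_eq0 nd_inj (fun=> ltnSn k) sP mP h0.
suff P0 : P = 0 by move=> j; rewrite -mP' // P0 /jets comp_poly0 coef0.
(* The differential equation of [(1 + x z)^(k + 1/2)] applied to [P]. Since [P] matches one
   derivative more than it was built for, [W] vanishes to order [k] at every node, and its degree is
   below the number of these zeros. *)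
pose W := (1 + x *: 'X) * P^`() *+ 2 - (x * (2 * k + 1)%:R) *: P.
have WE n : W`_n = P`_n.+1 *+ n.+1 *+ 2 + x * (P`_n * ((2 * n)%:R - (2 * k + 1)%:R)).
  rewrite /W coefB coefMn mulrDl mul1r coefD coef_deriv -scalerAl coefZ coefXM coefZ.
  case: n => [|n] /=; first by rewrite !mulr0 muln0; ring.
  by rewrite coef_deriv -mulr_natr -[in X in X = _]mulr_natr; ring.
have W0 : W = 0.
  apply: (matches0_eq0 nd_inj (M := k) (kap := fun=> k)) => // [|j h hk].
    apply/leq_sizeP => n; rewrite WE leq_eqVlt => /orP [/eqP <-|nk].
      by rewrite !(nth_default 0 (leq_trans sP _)) ?leqnSn // mul0r mulr0 !mul0rn addr0.
    by rewrite !(nth_default 0 (leq_trans sP _)) ?(ltnW nk) ?(leq_trans (ltnW nk)) // mul0r mulr0 !mul0rn addr0.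
  have -> : jets nd W j = (((1 + x * nd j)%:P + x *: 'X) * (jets nd P j)^`()) *+ 2 - (x * (2 * k + 1)%:R) *: jets nd P j.
    rewrite /jets /W deriv_comp derivD derivX derivC addr0 mulr1.
    rewrite comp_polyB comp_polyZ rmorphMn /= comp_polyM comp_polyD comp_polyZ comp_polyX comp_polyC.
    by rewrite -!mul_polyC rmorphD rmorphM /=; ring.
  rewrite coef0 coefB coefMn mulrDl coefD coefCM coef_deriv -scalerAl coefZ coefXM coefZ.
  have := fE j h hk; rewrite -!(mP' j) //; last exact: ltnW.
  move/eqP; rewrite -subr_eq0 => /eqP; set u := jets nd P j => E; rewrite -[RHS]E.
  by case: h hk E => [|h] hk E /=; rewrite ?coef_deriv; ring.
(* At the top degree [n] of [P], the equation [W = 0] forces [2 n = 2 k + 1] unless the leading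
   coefficient vanishes: parity decides. *)
apply/eqP; rewrite -lead_coef_eq0; apply/eqP.
have := WE (size P).-1; rewrite W0 coef0 -/(lead_coef P).
rewrite (nth_default 0 (leqSpred _)) !mul0rn add0r => /esym/eqP.
rewrite !mulf_eq0 (negPf x0) subr_eq0 eqr_nat /= => /orP [/eqP //|/eqP]; lia.
Qed.
End NonVanishing.

(** * Integrality and size of the coefficients of [(1 + 4 z)^(k + 1/2)] *)

Lemma central_binomialS h : (h.+1 * 'C(2 * h.+1, h.+1) = 2 * (2 * h).+1 * 'C(2 * h, h))%N.
Proof.
have E1 := mul_bin_diag (2 * h.+1) h; have E2 := mul_bin_diag (2 * h).+1 h.
have E3 : 'C((2 * h).+1, h.+1) = 'C((2 * h).+1, h).
  by rewrite -bin_sub; [congr 'C(_, _)|]; lia.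
have E4 : (2 * h.+1).-1 = (2 * h).+1 by lia.
rewrite /= in E2; rewrite E4 in E1; nia.
Qed.

(* The integers [4^h binom(k + 1/2, h)]: the Taylor coefficients of [(1 + 4 z)^(k + 1/2)]. *)
Lemma half_binomial (k : nat) : exists e : nat -> int, e 0%N = 1 /\
  forall h : nat, (h%:Z + 1) * e h.+1 = (4 * k%:Z + 2 - 4 * h%:Z) * e h.
Proof.
have [e [e0 eE]] : exists e : nat -> int, e 0%N = 1 /\
    forall h : nat, (h%:Z + 1) * e h.+1 = (4 * k.+1%:Z - 2 - 4 * h%:Z) * e h.
  (* Induction on [n] for the exponent [n - 1/2]: up to sign, [(1 + 4 z)^(-1/2)] has the central
     binomial coefficients, and multiplying by [1 + 4 z] raises the exponent by one. *)
  elim: k.+1 => [|n [e [e0 eE]]].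
    exists (fun h => (-1) ^+ h * 'C(2 * h, h)%:Z); split => [|h]; first by rewrite mul1r.
    have -> : h%:Z + 1 = h.+1%:Z by lia.
    rewrite exprS.
    rewrite (_ : h.+1%:Z * _ = - (-1) ^+ h * (h.+1 * 'C(2 * h.+1, h.+1))%:Z); last by rewrite PoszM; ring.
    by rewrite central_binomialS !PoszM; ring.
  exists (fun h => if h is h'.+1 then e h + 4 * e h' else e h); split=> [//|[|h]].
    by rewrite mulrDr eE e0; ring.
  have E1 := eE h.+1; have E2 := eE h.
  rewrite !mulrDr E1 (_ : h.+1%:Z = h%:Z + 1) in E2 *; last by lia.
  rewrite (_ : 4 * n.+1%:Z = 4 * n%:Z + 4); last by lia.
  have -> : (4 * n%:Z + 4 - 2 - 4 * (h%:Z + 1)) * (4 * e h) = 4 * ((4 * n%:Z - 2 - 4 * h%:Z) * e h) by ring.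
  by rewrite -E2; ring.
exists e; split=> // h; rewrite eE; congr (_ * _); lia.
Qed.

(** Termwise comparison with [(1 + 4 z)^(k + 1)]: for [h <= k] the recursion factors satisfy
    [|4 k + 2 - 4 h| <= 4 (k + 1 - h)]. *)
Lemma half_binomial_le (k : nat) (e : nat -> int) : e 0%N = 1 ->
  (forall h : nat, (h%:Z + 1) * e h.+1 = (4 * k%:Z + 2 - 4 * h%:Z) * e h) ->
  forall h, (h <= k.+1)%N -> `|e h| <= (4 ^ h * 'C(k.+1, h))%:Z.
Proof.
move=> e0 eE; elim=> [_|h IH hk]; first by rewrite e0 bin0.
have h0 : (0 : int) < h.+1%:Z by [].
rewrite -(ler_pM2l h0) -[X in X * _]ger0_norm // -normrM.
rewrite (_ : h.+1%:Z * e h.+1 = (4 * k%:Z + 2 - 4 * h%:Z) * e h); last by rewrite -eE; congr (_ * _); lia.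
rewrite normrM.
have -> : h.+1%:Z * (4 ^ h.+1 * 'C(k.+1, h.+1))%:Z = (4 * (k.+1 - h))%:Z * (4 ^ h * 'C(k.+1, h))%:Z.
  by rewrite -!PoszM; congr Posz; have := mul_bin_left k.+1 h; rewrite expnS; nia.
apply: ler_pM => //; last by apply: IH; lia.
lia.
Qed.

(** * Denominators of truncated power series *)

Section Integrality.
Variable F : fieldType.
Implicit Types (d q x y : F) (P Q : {poly F}).

Definition isint x := exists m : int, x = m%:~R.

Lemma isintM x y : isint x -> isint y -> isint (x * y).
Proof. by move=> [m ->] [n ->]; exists (m * n); rewrite intrM. Qed.
Lemma isintD x y : isint x -> isint y -> isint (x + y).
Proof. by move=> [m ->] [n ->]; exists (m + n); rewrite intrD. Qed.
Lemma isint_nat n : isint n%:R.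
Proof. by exists n%:Z. Qed.
Lemma isintN x : isint x -> isint (- x).
Proof. by move=> [m ->]; exists (- m); rewrite intrN. Qed.
Lemma isintX x n : isint x -> isint (x ^+ n).
Proof. by move=> [m ->]; exists (m ^+ n); rewrite rmorphXn. Qed.
Lemma isint_sum (J : finType) (f : J -> F) : (forall j, isint (f j)) -> isint (\sum_j f j).
Proof. by move=> h; elim/big_ind: _ => [|x y|//]; [exists 0|exact: isintD]. Qed.

(* [d] clears the geometric part and [q] the constant part of the denominators of [P]. *)
Definition den d q P := forall h, isint (d ^+ h * q * P`_h).

Lemma denM d q q' P Q : den d q P -> den d q' Q -> den d (q * q') (P * Q).
Proof.
move=> dP dQ h; rewrite coefM mulr_sumr; apply: isint_sum => -[i /= ih].
rewrite ltnS in ih.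
have -> : d ^+ h * (q * q') * (P`_i * Q`_(h - i)) = (d ^+ i * q * P`_i) * (d ^+ (h - i) * q' * Q`_(h - i)).
  by rewrite -{1}(subnKC ih) exprD; ring.
exact: isintM.
Qed.

Lemma den1 d : den d 1 1.
Proof. by move=> [|h]; rewrite coef1 /= ?mulr0 ?expr0 ?mulr1; [exact: (isint_nat 1) | exact: (isint_nat 0)]. Qed.

Lemma denX d q P n : den d q P -> den d (q ^+ n) (P ^+ n).
Proof.
move=> dP; elim: n => [|n IH]; first by rewrite !expr0; exact: den1.
by rewrite !exprS; exact: denM.
Qed.

Lemma den_scale d m q P : isint m -> den d q P -> den (d * m) q P.
Proof.
move=> im dP h; rewrite exprMn (_ : _ * _ = m ^+ h * (d ^+ h * q * P`_h)); last by ring.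
by apply: isintM => //; exact: isintX.
Qed.

Lemma den_tinv M al : al != 0 -> den al al (tinv M al).
Proof.
move=> al0 h; rewrite coef_poly; case: ifP => _; last by rewrite mulr0; exact: (isint_nat 0).
rewrite -exprSr mulrN -exprMn mulrN divff //; apply: isintN; apply: isintX; apply: isintN.
exact: (isint_nat 1).
Qed.
End Integrality.

(** * A weighted norm on truncated power series *)

Section Majorants.
Variables (F : realFieldType) (M : nat) (rho : F).
Hypothesis rho_ge0 : 0 <= rho.
Implicit Types P Q U : {poly F}.

(** It replaces the maximum on a circle of radius [rho]: it is submultiplicative, and a coefficient
    is recovered at the cost of a power of [rho], as in Cauchy's estimate. *)
Definition wnorm P : F := \sum_(h < M) `|P`_h| * rho ^+ h.

Lemma wnorm_ge0 P : 0 <= wnorm P.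
Proof. by apply: sumr_ge0 => h _; rewrite mulr_ge0 // exprn_ge0. Qed.

Lemma wnormD P Q : wnorm (P + Q) <= wnorm P + wnorm Q.
Proof.
rewrite /wnorm -big_split; apply: ler_sum => h _ /=.
by rewrite -mulrDl ler_wpM2r ?exprn_ge0 // coefD ler_normD.
Qed.

Lemma eq_wnorm P Q : eqlow M P Q -> wnorm P = wnorm Q.
Proof. by move=> e; apply: eq_bigr => h _; rewrite e. Qed.

Lemma wnormC c : wnorm c%:P <= `|c|.
Proof.
rewrite /wnorm; case: M => [|m]; first by rewrite big_ord0.
rewrite big_ord_recl coefC eqxx expr0 mulr1 big1 ?addr0 // => h _.
by rewrite coefC /= normr0 mul0r.
Qed.

Lemma wnormX : wnorm 'X <= rho.
Proof.
rewrite /wnorm; case: M => [|[|m]]; first by rewrite big_ord0.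
  by rewrite big_ord_recl big_ord0 coefX normr0 mul0r addr0.
rewrite 2!big_ord_recl !coefX /= normr0 mul0r add0r normr1 mul1r expr1 big1 ?addr0 // => h _.
by rewrite coefX /= normr0 mul0r.
Qed.

Lemma wnorm_coef P n : (n < M)%N -> `|P`_n| * rho ^+ n <= wnorm P.
Proof.
move=> nM; rewrite /wnorm (bigD1 (Ordinal nM)) //= lerDl.
by apply: sumr_ge0 => h _; rewrite mulr_ge0 // exprn_ge0.
Qed.

Lemma wnormM P Q : wnorm (P * Q) <= wnorm P * wnorm Q.
Proof.
pose g (i j : nat) := `|P`_i| * rho ^+ i * (`|Q`_j| * rho ^+ j).
have g0 i j : 0 <= g i j by rewrite /g !mulr_ge0 // exprn_ge0.
have -> : wnorm P * wnorm Q = \sum_(i < M) \sum_(h < M) g i h.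
  by rewrite /wnorm mulr_suml; apply: eq_bigr => i _; rewrite mulr_sumr.
(* The truncated product runs over pairs of indices with sum below [M]; completing to the full
   square only adds nonnegative terms. *)
have H : forall i : 'I_M, \sum_(h < M) (if (i <= h)%N then g i (h - i)%N else 0) <= \sum_(h < M) g i h.
  move=> i; rewrite -(big_mkord xpredT (fun h => if (i <= h)%N then g i (h - i)%N else 0)).
  rewrite (big_cat_nat (n := i)) //=; last exact: ltnW.
  rewrite big1_seq ?add0r => [|h /andP[_]]; last first.
    by rewrite mem_index_iota => /andP [_ hi]; rewrite leqNgt hi.
  rewrite -{1}[nat_of_ord i]add0n big_addn.
  rewrite (eq_bigr (fun h => g i h)) => [|h _]; last by rewrite leq_addl addnK.
  rewrite -(big_mkord xpredT (fun h => g i h)) [leRHS](big_cat_nat (n := (M - i)%N)) ?leq_subr //=.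
  by rewrite lerDl; apply: sumr_ge0.
apply: le_trans (ler_sum _ (fun i _ => H i)).
rewrite exchange_big /=; apply: ler_sum => -[h hM] _ /=.
rewrite -big_mkcond /= coefM.
rewrite (big_ord_widen_cond M xpredT (fun i => P`_i * Q`_(h - i))) //.
apply: (le_trans (y := \sum_(i < M | (i <= h)%N) `|P`_i * Q`_(h - i)| * rho ^+ h)).
  by rewrite -mulr_suml ler_wpM2r ?exprn_ge0 // ler_norm_sum.
apply: ler_sum => i ih; have -> : rho ^+ h = rho ^+ i * rho ^+ (h - i) by rewrite -exprD subnKC.
rewrite /g normrM.
by rewrite le_eqVlt; apply/orP; left; apply/eqP; ring.
Qed.

Lemma wnorm1 : wnorm 1 <= 1.
Proof. by apply: (le_trans (wnormC 1)); rewrite normr1. Qed.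

Lemma wnormXn P B n : wnorm P <= B -> wnorm (P ^+ n) <= B ^+ n.
Proof.
move=> PB; elim: n => [|n IH]; first by rewrite !expr0; exact: wnorm1.
rewrite !exprS; apply: (le_trans (wnormM _ _)).
by apply: ler_pM => //; exact: wnorm_ge0.
Qed.

Lemma wnorm_inv U q0 q1 q2 : eqlow M ((q0%:P + q1 *: 'X + q2 *: 'X^2) * U) 1 ->
  0 < `|q0| - `|q1| * rho - `|q2| * rho ^+ 2 ->
  wnorm U <= (`|q0| - `|q1| * rho - `|q2| * rho ^+ 2)^-1.
Proof.
move=> e D0; rewrite -[leRHS]mul1r ler_pdivlMr //.
have N0 := wnorm_ge0 U.
have e' : eqlow M (q0%:P * U) (1 + ((- q1)%:P * 'X + (- q2)%:P * ('X * 'X)) * U).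
  move=> h hM; rewrite coefD -(e h hM) -coefD; congr (nth 0 (polyseq _) h).
  by rewrite -!mul_polyC !polyCN; ring.
have L : `|q0| * wnorm U = wnorm (q0%:P * U).
  rewrite /wnorm mulr_sumr; apply: eq_bigr => h _.
  by rewrite coefCM normrM mulrA.
have : `|q0| * wnorm U <= 1 + (`|q1| * rho + `|q2| * rho ^+ 2) * wnorm U.
  rewrite L (eq_wnorm e'); apply: (le_trans (wnormD _ _)); apply: lerD; first exact: wnorm1.
  apply: (le_trans (wnormM _ _)); apply: ler_wpM2r => //.
  apply: (le_trans (wnormD _ _)); apply: lerD; apply: (le_trans (wnormM _ _)).
    by apply: ler_pM; rewrite ?wnorm_ge0 ?wnormX // -normrN; exact: wnormC.
  apply: ler_pM; rewrite ?wnorm_ge0 //; first by rewrite -(normrN q2); exact: wnormC.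
  by apply: (le_trans (wnormM _ _)); rewrite expr2 ler_pM ?wnorm_ge0 ?wnormX.
by move: N0; set n := wnorm U; lra.
Qed.

Lemma wnorm_tinv al : rho < `|al| -> wnorm (tinv M al) <= (`|al| - rho)^-1.
Proof.
move=> ral; have al0 : al != 0 by rewrite -normr_gt0; exact: le_lt_trans ral.
have := @wnorm_inv (tinv M al) al 1 0; rewrite normr1 mul1r normr0 mul0r subr0; apply; last by rewrite subr_gt0.
by rewrite scale1r scale0r addr0 addrC; exact: tinvP.
Qed.
End Majorants.

(** For the last inequality: without the absolute value its right side is [(B - A - rho) (A + rho)]
    or [(A - rho) (B - A + rho)]. The factors add up to [B], like [rho] and [B - rho], and neither
    is below [rho], so their product is at least as large. *)
Lemma radius_facts (F : realFieldType) (A B rho : F) :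
  0 < rho -> 2 * rho <= A -> 2 * rho <= B - A ->
  [/\ 0 < A, 0 < B & A < B] /\
  [/\ rho < A, rho < B - A & rho < B] /\ [/\ rho <= A - rho, rho <= B - A - rho & rho <= B - rho] /\
  rho * (B - rho) <= A * (B - A) - `|A + (A - B)| * rho - 1 * rho ^+ 2.
Proof.
move=> r0 rA rB; do !split; try lra.
case: (lerP 0 (A + (A - B))) => [h|h]; [rewrite ger0_norm //|rewrite ltr0_norm //]; nra.
Qed.

(** * Residues at the nodes [0], [a], [b]: denominators and size *)

Section ThreeNodes.
Variables (F : realFieldType) (a b c k' : nat) (e : nat -> int).
Hypotheses (a_gt0 : (0 < a)%N) (ab : (a < b)%N) (c_gt0 : (0 < c)%N).
Let k := k'.+1.
Let A : F := a%:R.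
Let B : F := b%:R.
Let C : F := c%:R.
Let N : F := A * B * C.

Definition nd3 (i : 'I_3) : F := nth 0 [:: 0; a%:R; b%:R] i.
Definition i0 : 'I_3 := @Ordinal 3 0 isT.
Definition i1 : 'I_3 := @Ordinal 3 1 isT.
Definition i2 : 'I_3 := @Ordinal 3 2 isT.

(** For [V = u] and [u2 = u^2], with [u] the root of [1 + 4 z / N] at a node, this is the jet there
    of [(1 + 4 z / N)^(k + 1/2)]. Another [V] replaces the one odd factor [u] by a rational
    approximation. Stopping at order [k] keeps [k - h] nonnegative. *)
Definition sqjet (V u2 : F) : {poly F} :=
  \poly_(h < k.+1) (V * (e h)%:~R * u2 ^+ (k - h) / N ^+ h).

Lemma A0 : 0 < A. Proof. by rewrite ltr0n. Qed.
Lemma AB : A < B. Proof. by rewrite ltr_nat. Qed.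
Lemma B0 : 0 < B. Proof. exact: lt_trans A0 AB. Qed.
Lemma C0 : 0 < C. Proof. by rewrite ltr0n. Qed.
Lemma N0 : 0 < N. Proof. by rewrite !mulr_gt0 ?A0 ?B0 ?C0. Qed.

Lemma nd3_inj : injective nd3.
Proof.
have a0 := A0; have ab' := AB; have b0 := B0.
by move=> [[|[|[|i]]] p] [[|[|[|j]]] q]; rewrite /nd3 /= -/A -/B // => E; first [by apply: val_inj | by exfalso; lra].
Qed.

Lemma ord3E (P : 'I_3 -> Prop) : P i0 -> P i1 -> P i2 -> forall i, P i.
Proof.
move=> p0 p1 p2 [[|[|[|//]]] p].
- by rewrite (_ : Ordinal p = i0) //; apply: val_inj.
- by rewrite (_ : Ordinal p = i1) //; apply: val_inj.
- by rewrite (_ : Ordinal p = i2) //; apply: val_inj.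
Qed.

Lemma sum3 (V : nmodType) (f : 'I_3 -> V) : \sum_i f i = f i0 + f i1 + f i2.
Proof.
rewrite !big_ord_recl big_ord0 addr0 addrA; by congr (f _ + f _ + f _); apply: val_inj.
Qed.

Section Loc.
Variables (M : nat) (kap : 'I_3 -> nat).
Lemma loc0 : loc nd3 M kap i0 = tinv M (- A) ^+ kap i1 * tinv M (- B) ^+ kap i2.
Proof.
rewrite /loc big_mkcond !big_ord_recl big_ord0 /= mul1r mulr1 /nd3 /= !sub0r.
by congr (tinv M _ ^+ kap _ * tinv M _ ^+ kap _); apply: val_inj.
Qed.
Lemma loc1 : loc nd3 M kap i1 = tinv M A ^+ kap i0 * tinv M (A - B) ^+ kap i2.
Proof.
rewrite /loc big_mkcond !big_ord_recl big_ord0 /= mul1r mulr1 /nd3 /= !subr0.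
by congr (tinv M _ ^+ kap _ * tinv M _ ^+ kap _); apply: val_inj.
Qed.
Lemma loc2 : loc nd3 M kap i2 = tinv M B ^+ kap i0 * tinv M (B - A) ^+ kap i1.
Proof.
rewrite /loc big_mkcond !big_ord_recl big_ord0 /= !mulr1 /nd3 /= !subr0.
by congr (tinv M _ ^+ kap _ * tinv M _ ^+ kap _); apply: val_inj.
Qed.
End Loc.

(** A common denominator of the three residues, whichever node carries the extra multiplicity. *)
Definition bden : F := (A * B) ^+ (2 * k) * C ^+ k * (B - A) ^+ (2 * k).

Lemma isintBA : isint (B - A).
Proof. by rewrite /B /A -natrB ?(ltnW ab) //; exact: isint_nat. Qed.

Lemma res_isint d q w kap j u n : kap j = n.+1 -> den d q (u * loc nd3 k.+1 kap j) ->
  bden = d ^+ n * q * w -> isint w -> isint (bden * res nd3 k.+1 kap j u).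
Proof.
move=> kn du -> iw; rewrite /res kn -[_ * w * _]mulrAC; exact: isintM (du n) iw.
Qed.

Lemma den_sqjet d q V u2 :
  (forall h, (h <= k)%N -> isint (d ^+ h * q * (V * u2 ^+ (k - h) / N ^+ h))) ->
  den d q (sqjet V u2).
Proof.
move=> H h; rewrite coef_poly; case: ifP => [hk|_]; last by rewrite mulr0; exact: (isint_nat F 0).
rewrite (_ : _ * _ = (e h)%:~R * (d ^+ h * q * (V * u2 ^+ (k - h) / N ^+ h))); last by ring.
by apply: isintM; [exists (e h) | exact: H].
Qed.

(** At the node [0] the root is [1], and the node differences [a] and [b] divide [N], so [N] alone
    serves as geometric denominator. *)
Lemma bden_res0 (z : nat) i : isint (bden * res nd3 k.+1 (incr (fun=> k) i) i0 (sqjet z%:R 1)).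
Proof.
have a0 := A0; have b0 := B0; have c0 := C0; have n0 := N0.
have iA := isint_nat F a; have iB := isint_nat F b; have iC := isint_nat F c.
have D kap : den N (1 * ((- A) ^+ kap i1 * (- B) ^+ kap i2)) (sqjet z%:R 1 * loc nd3 k.+1 kap i0).
  apply: denM.
    apply: den_sqjet => h _; rewrite expr1n !mulr1 (_ : _ * _ = z%:R); first exact: isint_nat.
    by field; rewrite expf_neq0 // gt_eqF.
  rewrite loc0; apply: denM; apply: denX.
    rewrite (_ : N = - A * (- B * C)); last by rewrite /N; ring.
    apply: den_scale; last by apply: den_tinv; rewrite oppr_eq0 gt_eqF.
    by apply: isintM => //; exact: isintN.
  rewrite (_ : N = - B * (- A * C)); last by rewrite /N; ring.
  apply: den_scale; last by apply: den_tinv; rewrite oppr_eq0 gt_eqF.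
  by apply: isintM => //; exact: isintN.
have iw := isintX (2 * k) isintBA.
elim/ord3E: i.
- apply: (@res_isint _ _ ((B - A) ^+ (2 * k)) _ _ _ k (erefl _) (D _)) => //.
  rewrite /incr /= /bden /N !exprMn [(- A) ^+ _]exprNn [(- B) ^+ _]exprNn mul1r.
  have -> : (-1) ^+ k * A ^+ k * ((-1) ^+ k * B ^+ k) = A ^+ k * B ^+ k :> F.
    by rewrite mulrACA -exprMn mulrNN mulr1 expr1n mul1r.
  by rewrite mul2n -addnn !exprD; ring.
- apply: (@res_isint _ _ (- B * C * (B - A) ^+ (2 * k)) _ _ _ k' (erefl _) (D _)) => //; last first.
    by do !apply: isintM => //; exact: isintN.
  rewrite /incr /= /bden /N !exprMn exprS [(- A) ^+ _]exprNn [(- B) ^+ _]exprNn mul1r.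
  have -> : (-A * ((-1) ^+ k * A ^+ k)) * ((-1) ^+ k * B ^+ k) = - A * (A ^+ k * B ^+ k) :> F.
    by rewrite -mulrA mulrACA -exprMn mulrNN mulr1 expr1n mul1r.
  by rewrite mul2n -addnn !exprD !(exprS _ k'); ring.
- apply: (@res_isint _ _ (- A * C * (B - A) ^+ (2 * k)) _ _ _ k' (erefl _) (D _)) => //; last first.
    by do !apply: isintM => //; exact: isintN.
  rewrite /incr /= /bden /N !exprMn [(- B) ^+ _]exprS [(- A) ^+ _]exprNn [(- B) ^+ _]exprNn mul1r.
  have -> : ((-1) ^+ k * A ^+ k) * (-B * ((-1) ^+ k * B ^+ k)) = - B * (A ^+ k * B ^+ k) :> F.
    by rewrite mulrCA mulrACA -exprMn mulrNN mulr1 expr1n mul1r.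
  by rewrite mul2n -addnn !exprD !(exprS _ k'); ring.
Qed.

Lemma den_tinvN M al : al != 0 -> @den F (- al) (- al) (tinv M al).
Proof.
move=> al0 h; rewrite coef_poly; case: ifP => _; last by rewrite mulr0; exact: (isint_nat F 0).
rewrite -exprSr mulrN -exprMn mulrNN divff // expr1n; apply: isintN.
exact: (isint_nat F 1).
Qed.

(** At the node [a] one has [1 + 4 a / N = t^2 / (b c)]. In [(t^2 / (b c))^(k - h) / N^h] the powers
    of [b c] add up to [k] for every [h], so besides the node differences only [a] enters the
    geometric denominator. *)
Lemma bden_res1 (t y : nat) i : isint (bden * res nd3 k.+1 (incr (fun=> k) i) i1
  (sqjet (t%:R * y%:R / B) (t%:R ^+ 2 / (B * C)))).
Proof.
have a0 := A0; have b0 := B0; have c0 := C0; have n0 := N0; have ab' := AB.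
have iA := isint_nat F a; have iB := isint_nat F b; have iBA := isintBA.
set f := sqjet _ _.
have D kap : den (A * (B - A)) (B * (B * C) ^+ k * (A ^+ kap i0 * (B - A) ^+ kap i2)) (f * loc nd3 k.+1 kap i1).
  apply: denM.
    apply: den_sqjet => h hk.
    rewrite [X in isint X](_ : _ = (B - A) ^+ h * (t%:R * y%:R * (t%:R ^+ 2) ^+ (k - h))).
      apply: (isintM (isintX h iBA)).
      by rewrite -natrX -natrX -!natrM; exact: isint_nat.
    rewrite /N -{1}(subnK hk) expr_div_n !exprMn !exprD; field.
    by rewrite !expf_neq0 ?gt_eqF.
  rewrite loc1; apply: denM; apply: denX.
    by apply: den_scale => //; apply: den_tinv; rewrite gt_eqF.
  rewrite [A * _]mulrC; apply: den_scale => //; rewrite -(opprB A B).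
  by apply: den_tinvN; rewrite subr_eq0 lt_eqF.
elim/ord3E: i.
- apply: (@res_isint _ _ ((B - A) * B ^+ k') _ _ _ k' (erefl _) (D _)) => //; last first.
    by apply: isintM => //; exact: isintX.
  by rewrite /incr /= /bden !exprMn mul2n -addnn !exprD !(exprS _ k) !(exprS _ k'); ring.
- apply: (@res_isint _ _ (B ^+ k') _ _ _ k (erefl _) (D _)) => //; last exact: isintX.
  by rewrite /incr /= /bden !exprMn mul2n -addnn !exprD !(exprS _ k'); ring.
- apply: (@res_isint _ _ (A * B ^+ k') _ _ _ k' (erefl _) (D _)) => //; last first.
    by apply: isintM => //; exact: isintX.
  by rewrite /incr /= /bden !exprMn mul2n -addnn !exprD !(exprS _ k) !(exprS _ k'); ring.
Qed.

Lemma bden_res2 (s x : nat) i : isint (bden * res nd3 k.+1 (incr (fun=> k) i) i2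
  (sqjet (s%:R * x%:R / A) (s%:R ^+ 2 / (A * C)))).
Proof.
have a0 := A0; have b0 := B0; have c0 := C0; have n0 := N0; have ab' := AB.
have iA := isint_nat F a; have iB := isint_nat F b; have iBA := isintBA.
set f := sqjet _ _.
have D kap : den (B * (B - A)) (A * (A * C) ^+ k * (B ^+ kap i0 * (B - A) ^+ kap i1)) (f * loc nd3 k.+1 kap i2).
  apply: denM.
    apply: den_sqjet => h hk.
    rewrite [X in isint X](_ : _ = (B - A) ^+ h * (s%:R * x%:R * (s%:R ^+ 2) ^+ (k - h))).
      apply: (isintM (isintX h iBA)).
      by rewrite -natrX -natrX -!natrM; exact: isint_nat.
    rewrite /N -{1}(subnK hk) expr_div_n !exprMn !exprD; field.
    by rewrite !expf_neq0 ?gt_eqF.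
  rewrite loc2; apply: denM; apply: denX.
    by apply: den_scale => //; apply: den_tinv; rewrite gt_eqF.
  rewrite [B * _]mulrC; apply: den_scale => //.
  by apply: den_tinv; rewrite subr_eq0 gt_eqF.
elim/ord3E: i.
- apply: (@res_isint _ _ ((B - A) * A ^+ k') _ _ _ k' (erefl _) (D _)) => //; last first.
    by apply: isintM => //; exact: isintX.
  by rewrite /incr /= /bden !exprMn mul2n -addnn !exprD !(exprS _ k) !(exprS _ k'); ring.
- apply: (@res_isint _ _ (B * A ^+ k') _ _ _ k' (erefl _) (D _)) => //; last first.
    by apply: isintM => //; exact: isintX.
  by rewrite /incr /= /bden !exprMn mul2n -addnn !exprD !(exprS _ k) !(exprS _ k'); ring.
- apply: (@res_isint _ _ (A ^+ k') _ _ _ k (erefl _) (D _)) => //; last exact: isintX.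
  by rewrite /incr /= /bden !exprMn mul2n -addnn !exprD !(exprS _ k'); ring.
Qed.

Section Size.
Variable rho : F.
Hypotheses (rho0 : 0 < rho) (rhoA : 2 * rho <= A) (rhoB : 2 * rho <= B - A).
Hypothesis e_le : forall h, (h <= k.+1)%N -> `|e h| <= (4 ^ h * 'C(k.+1, h))%:Z.

(** As [u2 >= 1], its powers are at most [u2^k]; the rest is dominated by the binomial expansion on
    the right, through the bound on [e]. *)
Lemma wnorm_sqjet V u2 : 1 <= u2 ->
  wnorm k.+1 rho (sqjet V u2) <= `|V| * u2 ^+ k * (1 + 4 * rho / N) ^+ k.+1.
Proof.
move=> u1; have n0 := N0.
have u0 : 0 < u2 by exact: lt_le_trans u1.
have -> : (1 + 4 * rho / N) ^+ k.+1 = \sum_(h < k.+2) (4 * rho / N) ^+ h *+ 'C(k.+1, h).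
  by rewrite exprDn; apply: eq_bigr => h _; rewrite expr1n mul1r.
rewrite mulr_sumr big_ord_recr /=.
apply: (le_trans (y := \sum_(h < k.+1) `|V| * u2 ^+ k * ((4 * rho / N) ^+ h *+ 'C(k.+1, h)))); last first.
  rewrite lerDl; apply: mulr_ge0; first by rewrite mulr_ge0 // exprn_ge0 // ltW.
  by rewrite mulrn_wge0 // exprn_ge0 // divr_ge0 // ?mulr_ge0 // ltW.
apply: ler_sum => h _; rewrite coef_poly ltn_ord.
have hk : (h <= k)%N by rewrite -ltnS ltn_ord.
have E1 : `|(e h)%:~R| <= 4 ^+ h * ('C(k.+1, h))%:R :> F.
  rewrite -intr_norm; have := e_le (leqW hk); rewrite -(ler_int F) => /le_trans; apply.
  by rewrite -natrX -natrM.
rewrite !normrM normfV !normrX (gtr0_norm u0) (gtr0_norm n0).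
have E2 : u2 ^+ (k - h) <= u2 ^+ k by apply: ler_weXn2l => //; exact: leq_subr.
have -> : `|V| * `|(e h)%:~R| * u2 ^+ (k - h) / N ^+ h * rho ^+ h =
  `|V| * (u2 ^+ (k - h) * `|(e h)%:~R|) * (rho ^+ h / N ^+ h) by ring.
have -> : `|V| * u2 ^+ k * ((4 * rho / N) ^+ h *+ 'C(k.+1, h)) =
  `|V| * (u2 ^+ k * (4 ^+ h * ('C(k.+1, h))%:R)) * (rho ^+ h / N ^+ h).
  by rewrite -mulr_natr expr_div_n exprMn; ring.
apply: ler_wpM2r; first by rewrite divr_ge0 ?exprn_ge0 ?ltW.
apply: ler_wpM2l => //; apply: ler_pM => //; by rewrite exprn_ge0 ?ltW.
Qed.

(** A lower bound of [|z (z - a) (z - b)|] on the circles of radius [rho] around [a] and [b]. *)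
Let Lam : F := rho ^+ 2 * (B - rho).

Lemma Lam_gt0 : 0 < Lam.
Proof.
have a0 := A0; have ab' := AB.
have [_ [_ [[_ _ h] _]]] := radius_facts rho0 rhoA rhoB.
by apply: mulr_gt0; [exact: exprn_gt0 | exact: lt_le_trans h].
Qed.

(* [U] is the product of the two inverse factors raised to [k], [T] the extra factor due to the additional node. *)
Lemma res_le (i j : 'I_3) (u U T L : {poly F}) :
  wnorm k.+1 rho U <= rho / Lam -> wnorm k.+1 rho T <= rho^-1 ->
  (if i == j then L = U ^+ k else L = U ^+ k * T) -> loc nd3 k.+1 (incr (fun=> k) i) j = L ->
  `|res nd3 k.+1 (incr (fun=> k) i) j u| <= wnorm k.+1 rho u / Lam ^+ k.
Proof.
move=> hU hT hL EL; have lam0 := Lam_gt0; have rh := ltW rho0.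
have w0 P := wnorm_ge0 k.+1 rh P.
have hUk : wnorm k.+1 rho (U ^+ k) <= rho ^+ k / Lam ^+ k by rewrite -expr_div_n; exact: wnormXn.
rewrite /res /incr eq_sym -/(incr (fun=> k) i) EL.
case: eqVneq hL => [ij|ij] -> /=.
  rewrite -(ler_pM2r (exprn_gt0 k rho0)); apply: (le_trans (wnorm_coef (M := k.+1) rh _ _)) => //.
  apply: (le_trans (wnormM k.+1 rh _ _)).
  rewrite -mulrA [_^-1 * _]mulrC; exact: ler_wpM2l.
rewrite -(ler_pM2r (exprn_gt0 k' rho0)); apply: (le_trans (wnorm_coef (M := k.+1) rh _ _)) => //.
apply: (le_trans (wnormM k.+1 rh _ _)); rewrite -[leRHS]mulrA; apply: ler_wpM2l => //.
apply: (le_trans (wnormM k.+1 rh _ _)).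
apply: (le_trans (ler_pM (w0 _) (w0 _) hUk hT)).
rewrite exprS [leRHS](_ : _ = rho * rho ^+ k' / Lam ^+ k / rho) //.
by field; rewrite expf_neq0 ?gt_eqF.
Qed.

(** The node [a] lies between the two others, so its differences to them have opposite signs; their
    inverses are estimated together, as a quadratic, to profit from the cancellation. *)
Lemma res1_le i u : `|res nd3 k.+1 (incr (fun=> k) i) i1 u| <= wnorm k.+1 rho u / Lam ^+ k.
Proof.
have [_ [[ra rba rb] [[ra' rba' rb'] key0]]] := radius_facts rho0 rhoA rhoB.
have a0 := A0; have ab' := AB; have rh := ltW rho0; have lam0 := Lam_gt0.
have nA : `|A| = A by rewrite gtr0_norm.
have nAB : `|A - B| = B - A by rewrite distrC gtr0_norm // subr_gt0.
have TA : wnorm k.+1 rho (tinv k.+1 A) <= rho^-1.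
  apply: (le_trans (wnorm_tinv _ rh _)); rewrite nA //.
  by rewrite lef_pV2 ?posrE // (lt_le_trans rho0).
have TB : wnorm k.+1 rho (tinv k.+1 (A - B)) <= rho^-1.
  apply: (le_trans (wnorm_tinv _ rh _)); rewrite nAB //.
  by rewrite lef_pV2 ?posrE // (lt_le_trans rho0).
have hU : wnorm k.+1 rho (tinv k.+1 A * tinv k.+1 (A - B)) <= rho / Lam.
  have key : Lam / rho <= `|A * (A - B)| - `|A + (A - B)| * rho - `|1| * rho ^+ 2.
    rewrite normrM nA nAB normr1 mul1r.
    have -> : Lam / rho = rho * (B - rho) by rewrite /Lam; field; rewrite gt_eqF.
    by rewrite -[rho ^+ 2]mul1r.
  have lr : 0 < Lam / rho by rewrite divr_gt0.
  apply: (le_trans (wnorm_inv rh (q0 := A * (A - B)) (q1 := A + (A - B)) (q2 := 1) _ (lt_le_trans lr key))).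
    have -> : ((A * (A - B))%:P + (A + (A - B)) *: 'X + 1 *: 'X^2) * (tinv k.+1 A * tinv k.+1 (A - B)) =
       (('X + A%:P) * tinv k.+1 A) * (('X + (A - B)%:P) * tinv k.+1 (A - B)).
      by rewrite -!mul_polyC !(polyCM, polyCD, polyCB, polyCN) polyC1; ring.
    rewrite -[X in eqlow _ _ X]mulr1; apply: eqlowM; apply: tinvP; first by rewrite gt_eqF.
    by rewrite lt_eqF // subr_lt0.
  by rewrite -[rho / Lam]invf_div lef_pV2 ?posrE // (lt_le_trans lr).
elim/ord3E: i.
- apply: (@res_le i0 i1 u _ _ ((tinv k.+1 A * tinv k.+1 (A - B)) ^+ k * tinv k.+1 A) hU TA) => //.
  by rewrite loc1 /incr /= exprMn [_ ^+ k.+1]exprS; ring.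
- apply: (@res_le i1 i1 u _ _ ((tinv k.+1 A * tinv k.+1 (A - B)) ^+ k) hU TA) => //.
  by rewrite loc1 /incr /= exprMn.
- apply: (@res_le i2 i1 u _ _ ((tinv k.+1 A * tinv k.+1 (A - B)) ^+ k * tinv k.+1 (A - B)) hU TB) => //.
  by rewrite loc1 /incr /= exprMn [_ ^+ k.+1]exprS; ring.
Qed.

Lemma res2_le i u : `|res nd3 k.+1 (incr (fun=> k) i) i2 u| <= wnorm k.+1 rho u / Lam ^+ k.
Proof.
have [_ [[ra rba rb] [[ra' rba' rb'] key0]]] := radius_facts rho0 rhoA rhoB.
have a0 := A0; have ab' := AB; have rh := ltW rho0; have lam0 := Lam_gt0; have b0 := B0.
have nB : `|B| = B by rewrite gtr0_norm.
have nBA : `|B - A| = B - A by rewrite gtr0_norm // subr_gt0.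
have NB : wnorm k.+1 rho (tinv k.+1 B) <= (B - rho)^-1.
  by apply: (le_trans (wnorm_tinv _ rh _)); rewrite nB.
have TBA : wnorm k.+1 rho (tinv k.+1 (B - A)) <= rho^-1.
  apply: (le_trans (wnorm_tinv _ rh _)); rewrite nBA //.
  by rewrite lef_pV2 ?posrE // (lt_le_trans rho0).
have TB : wnorm k.+1 rho (tinv k.+1 B) <= rho^-1.
  by apply: (le_trans NB); rewrite lef_pV2 ?posrE // (lt_le_trans rho0).
have hU : wnorm k.+1 rho (tinv k.+1 B * tinv k.+1 (B - A)) <= rho / Lam.
  apply: (le_trans (wnormM k.+1 rh _ _)).
  apply: (le_trans (ler_pM (wnorm_ge0 _ rh _) (wnorm_ge0 _ rh _) NB TBA)).
  rewrite /Lam le_eqVlt; apply/orP; left; apply/eqP; field.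
  by rewrite !gt_eqF // (lt_le_trans rho0).
elim/ord3E: i.
- apply: (@res_le i0 i2 u _ _ ((tinv k.+1 B * tinv k.+1 (B - A)) ^+ k * tinv k.+1 B) hU TB) => //.
  by rewrite loc2 /incr /= exprMn [_ ^+ k.+1]exprS; ring.
- apply: (@res_le i1 i2 u _ _ ((tinv k.+1 B * tinv k.+1 (B - A)) ^+ k * tinv k.+1 (B - A)) hU TBA) => //.
  by rewrite loc2 /incr /= exprMn [_ ^+ k.+1]exprS; ring.
- apply: (@res_le i2 i2 u _ _ ((tinv k.+1 B * tinv k.+1 (B - A)) ^+ k) hU TB) => //.
  by rewrite loc2 /incr /= exprMn.
Qed.
End Size.
End ThreeNodes.

(** * Exact jets: the divided difference as a derivative at an intermediate point *)

Lemma derivable_pt_lim_horner (p : {poly R}) (z : R) :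
  derivable_pt_lim (fun z => p.[z]) z p^`().[z].
Proof.
elim/poly_ind: p => [|p c IH].
  rewrite (_ : (fun z => _) = fct_cte 0); last by apply: functional_extensionality => w; rewrite horner0.
  by rewrite deriv0 horner0; exact: derivable_pt_lim_const.
rewrite (_ : (fun z => _) = plus_fct (mult_fct (fun z => p.[z]) id) (fct_cte c)); last first.
  by apply: functional_extensionality => w; rewrite !hornerE.
have -> : (p * 'X + c%:P)^`().[z] = Rplus (Rplus (Rmult p^`().[z] z) (Rmult p.[z] 1)) 0.
  by rewrite derivD derivM derivX derivC !hornerE /=.
apply: derivable_pt_lim_plus; last exact: derivable_pt_lim_const.
by apply: derivable_pt_lim_mult => //; exact: derivable_pt_lim_id.
Qed.

Lemma jets_derivn (F : fieldType) (I : finType) (nd : I -> F) (P : {poly F}) j h :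
  P^`(h).[nd j] = (jets nd P j)`_h *+ h`!.
Proof.
have -> : P^`(h).[nd j] = (jets nd P^`(h) j).[0] by rewrite /jets horner_comp !hornerE.
have -> : jets nd P^`(h) j = (jets nd P j)^`(h).
  elim: h => [|h IH]; first by rewrite !derivn0.
  by rewrite !derivnS -IH /jets deriv_comp derivD derivX derivC addr0 mulr1.
by rewrite horner_coef0 coef_derivn addn0 ffactnn.
Qed.

Section Remainder.
Variables (a b c k' : nat) (e : nat -> int).
Hypotheses (a_gt0 : (0 < a)%N) (ab : (a < b)%N) (c_gt0 : (0 < c)%N).
Let k := k'.+1.
Hypothesis eE : forall h : nat, (h%:Z + 1) * e h.+1 = (4 * k%:Z + 2 - 4 * h%:Z) * e h.
Let N : R := (a%:R * b%:R * c%:R)%R.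
Let x : R := (4 / N)%R.
Let nd : 'I_3 -> R := @nd3 R a b.

Definition pw (z p : R) : R := Rpower (1 + x * z)%R p.
Definition uroot j : R := pw (nd j) (1 / 2)%R.

Let gam h : R := ((h`!)%:R * (e h)%:~R / N ^+ h)%R.
Let G h (z : R) : R := (gam h * pw z (k%:R + 1 / 2 - h%:R)%R)%R.

Lemma Npos : 0 < N.
Proof. by rewrite !mulr_gt0 // ltr0n // (ltn_trans a_gt0). Qed.

Lemma xpos : 0 < x.
Proof. by apply: divr_gt0; [rewrite ltr0n | exact: Npos]. Qed.

Lemma gamS h : gam h.+1 = gam h * ((k%:R + 1 / 2 - h%:R) * x).
Proof.
have n0 := Npos.
have E : (h%:R + 1) * (e h.+1)%:~R = (4 * k%:R + 2 - 4 * h%:R) * (e h)%:~R :> R.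
  have /(congr1 (fun m : int => m%:~R : R)) := eE h.
  by rewrite !(intrM, intrD, intrN, rmorphB) /=.
rewrite /gam factS natrM exprS (_ : h.+1%:R = h%:R + 1); last by rewrite -addn1 natrD.
rewrite (_ : (h%:R + 1) * h`!%:R * (e h.+1)%:~R = h`!%:R * ((h%:R + 1) * (e h.+1)%:~R)); last by ring.
by rewrite E /x; field; rewrite expf_neq0 gt_eqF.
Qed.

Lemma G_deriv h z : 0 <= z -> derivable_pt_lim (G h) z (G h.+1 z).
Proof.
move=> z0; have x0 := xpos.
set p : R := (k%:R + 1 / 2 - h%:R)%R.
have w0 : 0 < 1 + x * z by apply: ltr_wpDr; [apply: mulr_ge0 => //; exact: ltW | exact: ltr01].
have -> : G h.+1 z = Rmult (gam h) (Rmult (Rmult p (Rpower (1 + x * z)%R (Rminus p 1))) x).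
  rewrite /G gamS /pw -/p (_ : k%:R + 1 / 2 - h.+1%:R = p - 1); last by rewrite /p -addn1 natrD; ring.
  rewrite !RmultE RminusE; set w := Rpower _ _; by rewrite -mulrA; congr (_ * _); rewrite mulrAC.
have -> : G h = mult_real_fct (gam h) (comp (fun w => Rpower w p) (fun z => 1 + x * z)) by [].
apply: derivable_pt_lim_scal; apply: (@derivable_pt_lim_comp (fun z : R => 1 + x * z)%R (fun w => Rpower w p)).
  have -> : (fun z : R => 1 + x * z)%R = plus_fct (fct_cte 1) (mult_real_fct x id) by [].
  rewrite [X in derivable_pt_lim _ _ X](_ : x = Rplus 0 (Rmult x 1)); last by rewrite RplusE RmultE mulr1 add0r.
  apply: derivable_pt_lim_plus; first exact: derivable_pt_lim_const.
  by apply: derivable_pt_lim_scal; exact: derivable_pt_lim_id.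
by apply: derivable_pt_lim_power; apply/RltP.
Qed.

Lemma pw_pos z p : 0 < pw z p.
Proof. by apply/RltP; exact: exp_pos. Qed.

Lemma pwD z p q : pw z (p + q)%R = pw z p * pw z q.
Proof. exact: Rpower_plus. Qed.

Lemma nd_ge0 j : 0 <= nd j.
Proof. by elim/ord3E: j; rewrite /nd /nd3 /= ?ler0n. Qed.

Lemma arg_pos z : 0 <= z -> 0 < 1 + x * z.
Proof.
by have x0 := xpos => z0; apply: ltr_wpDr; [apply: mulr_ge0 => //; exact: ltW | exact: ltr01].
Qed.

Lemma pw_nat z n : 0 <= z -> pw z n%:R = (1 + x * z) ^+ n.
Proof. by move=> z0; rewrite /pw -INRE Rpower_pow ?RpowE //; apply/RltP; exact: arg_pos. Qed.

Lemma uroot_sqr j : uroot j ^+ 2 = 1 + x * nd j.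
Proof.
rewrite expr2 /uroot -pwD (_ : 1 / 2 + 1 / 2 = 1%:R); first by rewrite pw_nat ?nd_ge0.
by field.
Qed.

Lemma uroot_gt0 j : 0 < uroot j.
Proof. exact: pw_pos. Qed.

Lemma G_node j h : (h <= k)%N ->
  G h (nd j) = (@sqjet R a b c k' e (uroot j) (uroot j ^+ 2))`_h *+ h`!.
Proof.
move=> hk; rewrite coef_poly ltnS hk uroot_sqr -pw_nat ?nd_ge0 //.
rewrite /G (_ : k%:R + 1 / 2 - h%:R = 1 / 2 + (k - h)%:R); last by rewrite natrB //; ring.
by rewrite pwD /gam /uroot -mulr_natr; ring.
Qed.

(** The function minus its interpolation polynomial [P] has [3 k + 1] zeros on the nodes, so by
    Rolle its derivative of order [3 k] meets that of [P], which is [(3 k)!] times the top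
    coefficient, the divided difference. *)
Lemma remainder (i : 'I_3) : exists2 xi : R, 0 <= xi &
  hfun nd k.+1 (incr (fun=> k) i) (fun j => @sqjet R a b c k' e (uroot j) (uroot j ^+ 2)) =
  (e (3 * k))%:~R / N ^+ (3 * k) * pw xi (k%:R + 1 / 2 - (3 * k)%:R)%R.
Proof.
set kap := incr _ _; pose f j := @sqjet R a b c k' e (uroot j) (uroot j ^+ 2); rewrite -/f.
have nd_inj : injective nd by apply: nd3_inj.
have [P sP mP] := interpolation nd_inj kap f.
have tk : total kap = (3 * k).+1.
  by rewrite /kap total_incr /total sum_nat_const card_ord.
have kM j : (kap j <= k.+1)%N by rewrite /kap /incr; case: ifP.
rewrite tk in sP.
rewrite (hfun_matches nd_inj kM tk sP mP).
have tk3 : (kap i0 + kap i1 + kap i2 = (3 * k).+1)%N.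
  by rewrite -tk /total !big_ord_recl big_ord0 addn0 addnA; congr (kap _ + kap _ + kap _)%N; apply: val_inj.
(* The nodes in increasing order, each repeated according to [kap], as [rolle_multiple] expects
   them. *)
pose node n := if (n < kap i0)%N then i0 else if (n < kap i0 + kap i1)%N then i1 else i2.
have nd01 : nd i0 <= nd i1 by rewrite /nd /nd3 /= ler0n.
have nd12 : nd i1 <= nd i2 by rewrite /nd /nd3 /= ler_nat ltnW.
have nodeM n : nd (node n) <= nd (node n.+1).
  rewrite /node; have nd02 := le_trans nd01 nd12.
  by do ![case: ifP => //] => *; lia.
have node0 : node 0 = i0 by rewrite /node /kap /incr; case: (_ == _).
have [|m z hm [z0 _]|m j hmj E|xi [[xi0 _] Hxi]] := @rolle_multiple (3 * k)
  (fun h z => Rminus (G h z) P^`(h).[z]) (fun n => nd (node n)).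
- by move=> m _; apply/RleP; exact: nodeM.
- apply: derivable_pt_lim_minus.
    by apply: G_deriv; apply: le_trans (nd_ge0 (node 0)) _; apply/RleP.
  by rewrite derivnS; exact: derivable_pt_lim_horner.
- have {}E : node m = node (m + j)%N by apply: nd_inj.
  have {}hmj : (m + j <= 3 * k)%N by apply/ssrnat.leP.
  have jk : (j < kap (node m))%N.
    move: E; rewrite /node.
    by do ![case: ifP => //] => *; lia.
  have jk' : (j <= k)%N by rewrite -ltnS; exact: leq_trans (kM (node m)).
  rewrite RminusE G_node // jets_derivn mP // subrr //.
exists xi; first by apply: le_trans (nd_ge0 (node 0)) _; apply/RleP.
have n0 : ((3 * k)`!)%:R != 0 :> R by rewrite pnatr_eq0 -lt0n fact_gt0.
apply: (mulfI n0).
have PE : P^`(3 * k).[xi] = (3 * k)`!%:R * P`_(3 * k).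
  have /size1_polyC -> : (size P^`(3 * k) <= 1)%N.
    apply/leq_sizeP => m m0; rewrite coef_derivn nth_default ?mul0rn //.
    by apply: leq_trans sP _; lia.
  by rewrite hornerC coef_derivn addn0 ffactnn mulr_natl.
rewrite -PE; move/eqP: Hxi; rewrite RminusE subr_eq0 => /eqP <-.
by rewrite /G /gam; ring.
Qed.
End Remainder.

(** * Size of the coefficient of order [3 k] *)

Section HalfBinomialSize.
Variable F : realFieldType.
(** Equal to [h!] times the coefficient [e h]; the factorial is kept so that no division occurs. *)
Definition hnum (k h : nat) : F := \prod_(i < h) ((4 * k + 2)%:R - (4 * i)%:R).

Lemma hnumS k h : hnum k h.+1 = hnum k h * ((4 * k + 2)%:R - (4 * h)%:R).
Proof. by rewrite /hnum big_ord_recr. Qed.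

Lemma hnumSS k h : hnum k.+1 h.+1 = (4 * k + 6)%:R * hnum k h.
Proof.
rewrite /hnum big_ord_recl subr0; congr (_ * _); first by congr (_%:R); lia.
apply: eq_bigr => i _; rewrite (_ : 4 * k.+1 + 2 = 4 * k + 2 + 4)%N; last by lia.
by rewrite (_ : 4 * lift ord0 i = 4 * i + 4)%N; [rewrite !natrD; ring | rewrite /= /bump; lia].
Qed.

(** In the induction step, the quotient by the factorial is multiplied by [(4 k + 10) (8 k + 6) (8 k
    + 10) / ((3 k + 6) (3 k + 5) (3 k + 4))], which stays below its limit [256 / 27]. The factor
    [27 / 64] gives equality at the start. *)
Lemma hnum_le k : `|hnum k.+1 (3 * k.+1)| <= 27 / 64 * (256 / 27) ^+ k.+1 * ((3 * k.+1)`!)%:R.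
Proof.
elim: k => [|k IH].
  rewrite (_ : 3 * 1 = 3)%N // !hnumS /hnum big_ord0 mul1r (_ : 3`! = 6)%N // expr1.
  rewrite [leRHS](_ : _ = 24); last by field.
  rewrite [X in `|X|](_ : _ = -24); last by ring.
  by rewrite normrN ger0_norm.
have [n nn] : exists n, n = (3 * k.+1)%N by exists (3 * k.+1)%N.
rewrite -nn in IH; have -> : (3 * k.+2 = n.+3)%N by lia.
rewrite hnumSS (hnumS _ n.+1) (hnumS _ n) (factS n.+2) (factS n.+1) (factS n) !natrM exprS.
set w := hnum _ _ in IH *; set g := n`!%:R in IH *.
have {IH} IH : `|w| <= 27 / 64 * (256 / 27) ^+ k.+1 * g by [].
set q : F := 27 / 64 * (256 / 27) ^+ k.+1 in IH *.
have q0 : 0 <= q by apply: mulr_ge0; [|apply: exprn_ge0]; rewrite divr_ge0 ?ler0n.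
have g0 : 0 <= g by rewrite ler0n.
set K : F := k%:R; have K0 : 0 <= K by rewrite ler0n.
have k1E : k.+1%:R = K + 1 :> F by rewrite natr1.
have nE : n%:R = 3 * K + 3 :> F by rewrite nn natrM k1E; ring.
rewrite (_ : (4 * k.+1 + 6)%:R = 4 * K + 10); last by rewrite natrD natrM k1E; ring.
rewrite (_ : (4 * k.+1 + 2)%:R = 4 * K + 6); last by rewrite natrD natrM k1E; ring.
rewrite -[n.+3%:R]natr1 -[n.+2%:R]natr1 -[n.+1%:R]natr1 nE.
rewrite !normrM [`|4 * K + 10|]ger0_norm; last by lra.
rewrite [`|4 * K + 6 - 4 * (3 * K + 3)|]ler0_norm; last by lra.
rewrite [`|4 * K + 6 - 4 * (3 * K + 3 + 1)|]ler0_norm; last by lra.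
apply: (le_trans (y := (q * g) * ((4 * K + 10) * (8 * K + 6) * (8 * K + 10)))).
  rewrite (_ : _ * _ = `|w| * ((4 * K + 10) * (8 * K + 6) * (8 * K + 10))); last by ring.
  by apply: ler_wpM2r => //; rewrite !mulr_ge0 //; lra.
rewrite [leRHS](_ : _ = (q * g) * (256 / 27 * ((3 * K + 6) * (3 * K + 5) * (3 * K + 4)))); last first.
  by rewrite /q; field.
apply: ler_wpM2l; first exact: mulr_ge0.
set L := (4 * K + 10) * _ * _; set M := (3 * K + 6) * _ * _.
have LM : 0 <= 256 * M - 27 * L.
  have -> : 256 * M - 27 * L = 3456 * K ^+ 2 + 15792 * K + 14520 by rewrite /L /M; ring.
  have K2 : 0 <= K ^+ 2 by exact: exprn_ge0.
  by lra.
by rewrite mulrAC ler_pdivlMr ?ltr0n // mulrC -subr_ge0.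
Qed.
End HalfBinomialSize.

Lemma half_binomial_hnum (F : realFieldType) (k : nat) (e : nat -> int) : e 0%N = 1 ->
  (forall h : nat, (h%:Z + 1) * e h.+1 = (4 * k%:Z + 2 - 4 * h%:Z) * e h) ->
  forall h, (e h)%:~R * (h`!)%:R = hnum F k h.
Proof.
move=> e0 eE; elim=> [|h IH]; first by rewrite e0 /hnum big_ord0 mul1r.
rewrite hnumS -IH factS natrM.
have /(congr1 (fun m : int => m%:~R : F)) := eE h.
rewrite !(intrM, intrD, intrN, rmorphB) /= => E.
rewrite mulrA [_ * h.+1%:R]mulrC -natr1 E natrD !natrM; ring.
Qed.

(** The difference of squares is divided by the sum [p + z u], which is at least [2 z]. *)
Lemma sqrt_approx (F : realFieldType) (z u tau b c p : F) :
  0 < z -> 0 < b -> b <= c -> 1 <= u -> u ^+ 2 = tau -> 0 <= p ->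
  p ^+ 2 - (z * u) ^+ 2 = 4 * tau * (c - b) / b -> `|p - z * u| <= 2 * c / (b * z) * tau.
Proof.
move=> z0 b0 bc u1 ut p0 E; set q := z * u in E *.
have tau0 : 0 <= tau by rewrite -ut sqr_ge0.
have qz : z <= q by rewrite ler_peMr // ltW.
have q0 : 0 < q by exact: lt_le_trans qz.
have bcz : 0 <= c - b by rewrite subr_ge0.
have RE : 0 <= 4 * tau * (c - b) / b by apply: divr_ge0; [|exact: ltW]; rewrite !mulr_ge0.
have pq : q <= p.
  by rewrite -(ler_pXn2r (n := 2)) ?nnegrE ?(ltW q0) // -subr_ge0 E.
rewrite ger0_norm ?subr_ge0 //.
have H : (p - q) * (2 * q) <= 4 * tau * (c - b) / b.
  rewrite -E subr_sqr; apply: ler_wpM2l; first by rewrite subr_ge0.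
  by lra.
have H2 : (p - q) * (2 * z) <= 4 * tau * c / b.
  apply: (le_trans (y := (p - q) * (2 * q))).
    by apply: ler_wpM2l; [rewrite subr_ge0 | lra].
  apply: (le_trans H); apply: ler_wpM2r; first by rewrite invr_ge0 ltW.
  by apply: ler_wpM2l; [rewrite mulr_ge0 | lra].
have z2 : 0 < 2 * z by rewrite mulr_gt0.
rewrite -(ler_pM2r z2); apply: (le_trans H2).
by rewrite le_eqVlt; apply/orP; left; apply/eqP; field; rewrite !gt_eqF.
Qed.

Lemma isint_norm_ge1 (F : realFieldType) (m : F) : isint m -> m != 0 -> 1 <= `|m|.
Proof.
move=> [n ->]; rewrite intr_eq0 => n0.
by rewrite -intr_norm -[1]/(1%:~R) ler_int -gtz0_ge1 normr_gt0.
Qed.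

Lemma sqjetZD (F : realFieldType) a b c k' e (V W w u2 : F) :
  @sqjet F a b c k' e V u2 = w *: @sqjet F a b c k' e W u2 + @sqjet F a b c k' e (V - w * W) u2.
Proof.
apply/polyP => h; rewrite coefD coefZ !coef_poly; case: ifP => _; last by rewrite mulr0 addr0.
by ring.
Qed.

(** A nonzero integer is compared with an upper bound for its size. The first summand comes from the
    exact jets, the second from the errors at the nodes [a] and [b]; its exponent [2 k + 2] consists
    of [k] for [u2^k], [k + 1] for the majorant and one for the root approximation. *)
Theorem pade_bound (a b c s t x y z k : nat) (rho : R) :
  (0 < a)%N -> (a < b)%N -> (b < c)%N -> (0 < k)%N -> (0 < z)%N ->
  (s ^ 2 = a * c + 4)%N -> (t ^ 2 = b * c + 4)%N ->
  (a * z ^ 2 + 4 * c = c * x ^ 2 + 4 * a)%N -> (b * z ^ 2 + 4 * c = c * y ^ 2 + 4 * b)%N ->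
  0 < rho -> 2 * rho <= a%:R -> 2 * rho <= b%:R - a%:R ->
  1 <= z%:R * (27 / 64) * (256 / 27 * (b%:R - a%:R) ^+ 2 / (a%:R * b%:R * c%:R ^+ 2)) ^+ k +
    (2 * c%:R / (b%:R * z%:R) + 2 * c%:R / (a%:R * z%:R)) * (1 + 4 / (a%:R * c%:R)) ^+ (2 * k + 2) *
    ((a%:R * b%:R) ^+ 2 * c%:R * (b%:R - a%:R) ^+ 2 / (rho ^+ 2 * (b%:R - rho))) ^+ k.
Proof.
case: k => // k' a_gt0 ab bc _ z_gt0 Es Et Ex Ey rho0 rhoA rhoB.
have c_gt0 : (0 < c)%N by apply: leq_ltn_trans bc.
set A : R := a%:R in rhoA rhoB *; set B : R := b%:R in rhoB *; set C : R := c%:R; set Z : R := z%:R.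
have A0 : 0 < A by rewrite ltr0n.
have AB : A < B by rewrite ltr_nat.
have BC : B < C by rewrite ltr_nat.
have B0 := lt_trans A0 AB; have C0 := lt_trans B0 BC.
have Z0 : 0 < Z by rewrite ltr0n.
set k := k'.+1; set phi : R := (1 + 4 / (A * C))%R.
have [e [e0 eE]] := half_binomial k.
have e_le := half_binomial_le e0 eE.
pose N : R := (A * B * C)%R; have N0 : 0 < N by rewrite !mulr_gt0.
pose ur := uroot a b c.
have ur2 j := uroot_sqr a_gt0 ab c_gt0 j : ur j ^+ 2 = 1 + 4 / N * nd3 R a b j.
have ur0 j := uroot_gt0 a b c j : 0 < ur j.
have u0E : ur i0 = 1.
  have := ur2 i0; rewrite /nd3 /= mulr0 addr0 => /eqP.
  rewrite -[X in _ == X](expr1n _ 2) eqrXn2 // ?ltW //; exact/eqP.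
have u1E : ur i1 ^+ 2 = t%:R ^+ 2 / (B * C).
  rewrite ur2 /nd3 /= -/A -natrX Et natrD natrM -/B -/C /N; field.
  by rewrite !gt_eqF.
have u2E : ur i2 ^+ 2 = s%:R ^+ 2 / (A * C).
  rewrite ur2 /nd3 /= -/B -natrX Es natrD natrM -/A -/C /N; field.
  by rewrite !gt_eqF.
pose V (j : 'I_3) : R := nth 0 [:: Z; t%:R * y%:R / B; s%:R * x%:R / A]%R j.
pose f j := @sqjet R a b c k' e (V j) (ur j ^+ 2).
pose nd := nd3 R a b; have nd_inj : injective nd by apply: nd3_inj.
pose H i u := hfun nd k.+1 (incr (fun=> k) i) u.
(* It is unknown which node should take the extra multiplicity, but one of the three works:
   otherwise the jet at the node [0] would have value zero, and its value is [z]. *)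
have [i Hi] : exists i, H i f != 0.
  case: (pickP (fun i => H i f != 0)) => [i hi|h0]; first by exists i.
  have x0 : 4 / N != 0 :> R by rewrite gt_eqF // divr_gt0 // ltr0n.
  have := @hfun_sqrt_neq0 _ _ nd k nd_inj (4 / N)%R f x0 _ (fun i => elimT eqP (negbFE (h0 i))) i0.
  rewrite /f coef_poly /= e0 u0E !expr1n expr0 /V /= !mulr1 divr1 => Z00.
  suff /eqP : Z = 0 by rewrite gt_eqF.
  apply: Z00 => j h hk; rewrite !coef_poly ltnS hk (ltn_trans hk) //= -ur2.
  have /(congr1 (fun m : int => m%:~R : R)) := eE h.
  rewrite !(intrM, intrD, intrN, rmorphB) /= => E.
  rewrite -/(V j) -(subnSK hk); set u2 := ur j ^+ 2.
  rewrite [u2 ^+ _.+1]exprS [N ^+ h.+1]exprS -[_ *+ h.+1]mulr_natr -natr1 -[_ *+ 2]mulr_natr natrD !natrM.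
  set w := u2 ^+ _; set m := N ^+ h.
  have m0 : m != 0 by rewrite expf_neq0 // gt_eqF.
  transitivity (V j * u2 * w / (N * m) * 2 * ((h%:R + 1) * (e h.+1)%:~R)); first by ring.
  by rewrite E; field; rewrite m0 gt_eqF.
have Hsum u : H i u = res nd k.+1 (incr (fun=> k) i) i0 (u i0) + res nd k.+1 (incr (fun=> k) i) i1 (u i1)
   + res nd k.+1 (incr (fun=> k) i) i2 (u i2) by rewrite /H /hfun sum3.
pose D := bden R a b c k'.
have D0 : 0 < D.
  by rewrite /D /bden -/A -/B -/C !mulr_gt0 ?exprn_gt0 ?mulr_gt0 ?subr_gt0.
have iD : isint (D * H i f).
  rewrite Hsum !mulrDr; apply: isintD; first apply: isintD.
  - by rewrite /f u0E expr1n; exact: bden_res0.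
  - by rewrite /f u1E; exact: bden_res1.
  - by rewrite /f u2E; exact: bden_res2.
have ge1 : 1 <= D * `|H i f|.
  rewrite -[D]gtr0_norm // -normrM; apply: isint_norm_ge1 => //.
  by rewrite mulf_neq0 // gt_eqF.
(* Split [V = z u + (V - z u)]: [g] carries the true roots, [d] the approximation errors, which
   vanish at the node [0]. *)
pose g j := @sqjet R a b c k' e (ur j) (ur j ^+ 2).
pose d j := @sqjet R a b c k' e (V j - Z * ur j) (ur j ^+ 2).
have HE : H i f = Z * H i g + H i d.
  rewrite /H -hfunZ -hfunD; apply: eq_bigr => j _; congr (res _ _ _ _ _).
  exact: sqjetZD.
have Hg : `|H i g| <= 27 / 64 * (256 / 27) ^+ k / N ^+ (3 * k).
  have [xi xi0 HR] := remainder a_gt0 ab c_gt0 eE i.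
  rewrite [H i g]HR !normrM normfV [`|_ ^+ (3 * k)|]ger0_norm; last by rewrite exprn_ge0 // ltW.
  have pw1 : `|pw a b c xi (k%:R + 1 / 2 - (3 * k)%:R)%R| <= 1.
    rewrite ger0_norm; last exact: ltW (pw_pos _ _ _ _ _).
    have w1 : 1 <= 1 + 4 / (A * B * C) * xi.
      by rewrite lerDl mulr_ge0 // divr_ge0 ?ler0n // ltW.
    rewrite /pw; apply/RleP.
    set w := (1 + 4 / (A * B * C) * xi)%R in w1 *.
    have w0 : Rlt 0 w by apply/RltP; exact: lt_le_trans w1.
    apply: (Rle_trans _ (Rpower w 0)); last by rewrite Rpower_O //; exact: Rle_refl.
    apply: Rle_Rpower; first exact/RleP.
    apply/RleP; rewrite natrM; have : 1 <= k%:R :> R by rewrite ler1n.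
    set K : R := k%:R; move=> K1; change (K + 1 / 2 - 3 * K <= 0 :> R)%R; lra.
  have E3 : `|(e (3 * k)%N)%:~R| <= 27 / 64 * (256 / 27) ^+ k :> R.
    have f0 : 0 < ((3 * k)`!)%:R :> R by rewrite ltr0n fact_gt0.
    rewrite -(ler_pM2r f0) -[X in _ * X <= _]gtr0_norm // -normrM (half_binomial_hnum _ e0 eE).
    exact: hnum_le.
  rewrite -[leRHS]mulr1; apply: ler_pM => //.
    by rewrite mulr_ge0 // invr_ge0 exprn_ge0 // ltW.
  by apply: ler_wpM2r => //; rewrite invr_ge0 exprn_ge0 // ltW.
have phi1 : 1 <= phi by rewrite lerDl divr_ge0 ?ler0n ?mulr_ge0 ?ltW.
have urphi j : j != i0 -> 1 <= ur j ^+ 2 <= phi.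
  rewrite ur2; elim/ord3E: j => // _; rewrite /nd3 /= -/A -/B lerDl lerD2l; apply/andP; split.
  - by rewrite mulr_ge0 ?divr_ge0 ?ler0n ?ltW.
  - rewrite /N ler_pdivlMr ?mulr_gt0 // [leLHS](_ : _ = 4 * (A / B)); last by field; rewrite !gt_eqF.
    by rewrite ler_piMr ?ler0n // ler_pdivrMr // mul1r ltW.
  - by rewrite mulr_ge0 ?divr_ge0 ?ler0n ?ltW.
  - rewrite /N ler_pdivlMr ?mulr_gt0 // [leLHS](_ : _ = 4); last by field; rewrite !gt_eqF.
    by [].
have sqrt_case (v w m : R) j : 0 < m -> m <= C -> 0 <= w -> j != i0 -> V j = w ->
    w ^+ 2 - (Z * ur j) ^+ 2 = 4 * ur j ^+ 2 * (C - m) / m -> `|V j - Z * ur j| <= 2 * C / (m * Z) * phi.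
  move=> m0 mC w0 j0 -> E; have /andP [ur1 urp] := urphi j j0.
  apply: (le_trans (y := 2 * C / (m * Z) * ur j ^+ 2)); last first.
    by apply: ler_wpM2l => //; rewrite divr_ge0 ?mulr_ge0 // ?ler0n // ltW.
  apply: sqrt_approx => //.
  by rewrite -(ler_pXn2r (n := 2)) ?nnegrE ?ler01 ?expr1n // ltW.
have eqR (m n : nat) : m = n -> m%:R = n%:R :> R by move->.
have Vd1 : `|V i1 - Z * ur i1| <= 2 * C / (B * Z) * phi.
  apply: (sqrt_case (t%:R * y%:R / B) (t%:R * y%:R / B)) => //; first exact: ltW.
    by rewrite divr_ge0 ?mulr_ge0 ?ler0n // ltW.
  rewrite [(Z * _) ^+ 2]exprMn u1E; have := eqR _ _ Ey; rewrite !(natrD, natrM, natrX) -/B -/C -/Z => E.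
  have -> : (t%:R * y%:R / B) ^+ 2 - Z ^+ 2 * (t%:R ^+ 2 / (B * C)) =
    t%:R ^+ 2 / (B ^+ 2 * C) * ((C * y%:R ^+ 2 + 4 * B) - (B * Z ^+ 2) - 4 * B).
    by field; rewrite !gt_eqF.
  by rewrite -E; field; rewrite !gt_eqF.
have Vd2 : `|V i2 - Z * ur i2| <= 2 * C / (A * Z) * phi.
  apply: (sqrt_case (s%:R * x%:R / A) (s%:R * x%:R / A)) => //; first exact: ltW (lt_trans AB _).
    by rewrite divr_ge0 ?mulr_ge0 ?ler0n // ltW.
  rewrite [(Z * _) ^+ 2]exprMn u2E; have := eqR _ _ Ex; rewrite !(natrD, natrM, natrX) -/A -/C -/Z => E.
  have -> : (s%:R * x%:R / A) ^+ 2 - Z ^+ 2 * (s%:R ^+ 2 / (A * C)) =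
    s%:R ^+ 2 / (A ^+ 2 * C) * ((C * x%:R ^+ 2 + 4 * A) - (A * Z ^+ 2) - 4 * A).
    by field; rewrite !gt_eqF.
  by rewrite -E; field; rewrite !gt_eqF.
pose Lam := (rho ^+ 2 * (B - rho))%R.
have Lam0 := @Lam_gt0 R a b a_gt0 ab rho rho0 rhoA rhoB.
have wd j : j != i0 -> wnorm k.+1 rho (d j) <= `|V j - Z * ur j| * phi ^+ (2 * k + 1).
  move=> j0; have /andP [ur1 urp] := urphi j j0.
  apply: (le_trans (wnorm_sqjet a_gt0 ab c_gt0 rho0 e_le _ ur1)).
  rewrite -mulrA; apply: ler_wpM2l => //.
  rewrite mul2n -addnn addn1 -addnS.
  rewrite exprD; apply: ler_pM; rewrite ?exprn_ge0 //.
  - exact: ltW.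
  - by rewrite addr_ge0 // divr_ge0 // ?mulr_ge0 ?ler0n ?ltW // !mulr_gt0.
  - by apply: lerXn2r => //; rewrite nnegrE; [exact: le_trans ler01 ur1 | exact: le_trans ler01 phi1].
  apply: lerXn2r; rewrite ?nnegrE.
  - by rewrite addr_ge0 // divr_ge0 // ?mulr_ge0 ?ler0n ?ltW // !mulr_gt0.
  - by rewrite (le_trans _ phi1).
  rewrite lerD2l /N ler_pdivrMr ?mulr_gt0 // (_ : _ * (A * B * C) = 4 * B); last by field; rewrite !gt_eqF.
  have rho2 : rho <= 2 * rho by lra.
  by rewrite ler_wpM2l ?ler0n // (le_trans rho2) // (le_trans rhoA) // ltW.
have Hd : `|H i d| <= (2 * C / (B * Z) + 2 * C / (A * Z)) * phi ^+ (2 * k + 2) / Lam ^+ k.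
  have d0 : d i0 = 0.
    rewrite /d u0E /V /= mulr1 subrr; apply/polyP => h.
    by rewrite coef_poly coef0; case: ifP => // _; rewrite !mul0r.
  have r0 : res nd k.+1 (incr (fun=> k) i) i0 (d i0) = 0.
    by rewrite d0 /res; case: (incr _ _ _) => // m; rewrite mul0r coef0.
  rewrite Hsum r0 add0r [(2 * k + 2)%N]addnS.
  have L0 : 0 <= (Lam ^+ k)^-1 by rewrite invr_ge0 exprn_ge0 // ltW.
  have p0 : 0 <= phi ^+ (2 * k + 1) by rewrite exprn_ge0 // (le_trans _ phi1).
  apply: (le_trans (ler_normD _ _)); rewrite [phi ^+ _.+1]exprS mulrDl mulrDl.
  apply: lerD.
  - have R1 := @res1_le R a b k' a_gt0 ab rho rho0 rhoA rhoB i (d i1).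
    apply: (le_trans R1).
    apply: ler_wpM2r => //; apply: (le_trans (wd i1 _)) => //.
    by rewrite mulrA; apply: ler_wpM2r.
  - have R2 := @res2_le R a b k' a_gt0 ab rho rho0 rhoA rhoB i (d i2).
    apply: (le_trans R2).
    apply: ler_wpM2r => //; apply: (le_trans (wd i2 _)) => //.
    by rewrite mulrA; apply: ler_wpM2r.
apply: (le_trans ge1); rewrite HE.
apply: (le_trans (y := D * (Z * (27 / 64 * (256 / 27) ^+ k / N ^+ (3 * k)) +
   (2 * C / (B * Z) + 2 * C / (A * Z)) * phi ^+ (2 * k + 2) / Lam ^+ k))).
  apply: ler_wpM2l; first exact: ltW.
  apply: (le_trans (ler_normD _ _)); apply: lerD => //.
  by rewrite normrM [`|Z|]gtr0_norm //; apply: ler_wpM2l => //; exact: ltW.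
rewrite le_eqVlt; apply/orP; left; apply/eqP.
have DE : D = (A ^+ k) ^+ 2 * (B ^+ k) ^+ 2 * C ^+ k * ((B - A) ^+ k) ^+ 2.
  by rewrite /D /bden !exprM -/A -/B -/C [X in X * _ * _]exprAC exprMn [X in _ * X]exprAC [X in X * _ * _]exprMn.
have NE : N ^+ (3 * k) = (A ^+ k * B ^+ k * C ^+ k) ^+ 3.
  by rewrite exprM exprAC /N [(A * B * C) ^+ k]exprMn [(A * B) ^+ k]exprMn.
have [Ak Bk Ck] : [/\ A ^+ k != 0, B ^+ k != 0 & C ^+ k != 0] by rewrite !expf_neq0 ?gt_eqF.
have Lk : Lam ^+ k != 0 by rewrite expf_neq0 ?gt_eqF.
rewrite mulrDr DE NE; congr (_ + _).
  rewrite [(_ / (A * B * C ^+ 2)) ^+ k]expr_div_n [(256 / 27 * _) ^+ k]exprMn.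
  rewrite [(A * B * C ^+ 2) ^+ k]exprMn [(A * B) ^+ k]exprMn [(C ^+ 2) ^+ k]exprAC [((B - A) ^+ 2) ^+ k]exprAC.
  set q := (256 / 27) ^+ k; clearbody q; field.
  by rewrite Ak Bk Ck.
rewrite -/Lam [(_ / Lam) ^+ k]expr_div_n [(_ * (B - A) ^+ 2) ^+ k]exprMn [((A * B) ^+ 2 * C) ^+ k]exprMn.
rewrite [((B - A) ^+ 2) ^+ k]exprAC [((A * B) ^+ 2) ^+ k]exprAC [(A * B) ^+ k]exprMn.
set P := phi ^+ _; clearbody P; field.
by rewrite Lk !gt_eqF.
Qed.


End Pade.

Module PadeReal.
Local Delimit Scope R_scope with Re.
Import all_boot all_order all_algebra Rstruct zify.
Import Order.TTheory GRing.Theory Num.Theory.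

(** The bridge between the two libraries: the same inequality in the operations of the standard
    naturals and reals. *)
Theorem pade_real (a b c s t x y z k : nat) (rho : R) :
  (0 < a)%coq_nat -> (a < b)%coq_nat -> (b < c)%coq_nat -> (0 < k)%coq_nat -> (0 < z)%coq_nat ->
  (s * s)%coq_nat = (a * c + 4)%coq_nat -> (t * t)%coq_nat = (b * c + 4)%coq_nat ->
  (a * (z * z) + 4 * c)%coq_nat = (c * (x * x) + 4 * a)%coq_nat ->
  (b * (z * z) + 4 * c)%coq_nat = (c * (y * y) + 4 * b)%coq_nat ->
  (0 < rho -> 2 * rho <= INR a -> 2 * rho <= INR b - INR a ->
  1 <= INR z * (27 / 64) * (256 / 27 * (INR b - INR a) ^ 2 / (INR a * INR b * INR c ^ 2)) ^ k +
    (2 * INR c / (INR b * INR z) + 2 * INR c / (INR a * INR z)) * (1 + 4 / (INR a * INR c)) ^ (2 * k + 2)%coq_nat *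
    ((INR a * INR b) ^ 2 * INR c * (INR b - INR a) ^ 2 / (rho ^ 2 * (INR b - rho))) ^ k)%Re.
Proof.
move=> H1 H2 H3 H4 H5 H6 H7 H8 H9 r0 r1 r2.
have := @Pade.pade_bound a b c s t x y z k rho.
move/(_ (introT ssrnat.ltP H1) (introT ssrnat.ltP H2) (introT ssrnat.ltP H3) (introT ssrnat.ltP H4) (introT ssrnat.ltP H5)).
move/(_ H6 H7 H8 H9).
rewrite -!INRE -?RdivE -?RminusE -?RplusE -?RmultE -?RpowE.
rewrite ![INR (S (S _))]INR_IZR_INZ /=.
by move/(_ (introT RltP r0) (introT RleP r1) (introT RleP r2))/RleP.
Qed.
End PadeReal.

(** * Chains of solutions *)

(* Multiplication of the solution [(z, x)] of [a z^2 - c x^2 = 4 (a - c)] by the unit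
   [((s + sqrt (a c)) / 2)^2], in the coordinates [z] and [y = (a z + s x) / 2]. *)
Fixpoint chain (a c z y : Z) (m : nat) : Z * Z :=
  match m with
  | O => (z, y)
  | S m => let '(z', y') := chain a c z y m in (z' + c * y', y' + a * (z' + c * y'))
  end.

Definition zch (a c z y : Z) (m : nat) : Z := fst (chain a c z y m).
Definition ych (a c z y : Z) (m : nat) : Z := snd (chain a c z y m).

Lemma zch0 a c z y : zch a c z y 0 = z. Proof. reflexivity. Qed.
Lemma ych0 a c z y : ych a c z y 0 = y. Proof. reflexivity. Qed.
Lemma zchS a c z y m : zch a c z y (S m) = zch a c z y m + c * ych a c z y m.
Proof. unfold zch, ych; simpl; now destruct (chain a c z y m). Qed.
Lemma ychS a c z y m : ych a c z y (S m) = ych a c z y m + a * zch a c z y (S m).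
Proof. unfold zch, ych; simpl; now destruct (chain a c z y m). Qed.

(** Modulo [c] the second coordinate is linear in [m], hence modulo [c^2] the first one is
    quadratic. Doubling avoids the division in [m (m - 1) / 2]. *)
Lemma chain_mod a c z y m : exists u v,
  ych a c z y m = y + a * Z.of_nat m * z + c * v /\
  2 * zch a c z y m = 2 * z + c * (2 * Z.of_nat m * y + a * z * (Z.of_nat m * (Z.of_nat m - 1))) + 2 * c ^ 2 * u.
Proof.
  induction m as [|m [u [v [Hy Hz]]]].
  - exists 0, 0. rewrite zch0, ych0. simpl Z.of_nat. split; ring.
  - rewrite zchS, ychS, zchS, Hy, Nat2Z.inj_succ.
    assert (E : exists w, zch a c z y m = z + c * w).
    { clear - m. induction m as [|m [w IH]]; [exists 0; rewrite zch0; ring|].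
      exists (w + ych a c z y m). rewrite zchS, IH. ring. }
    destruct E as [w Ew].
    exists (u + v), (v + a * w + a * (y + a * Z.of_nat m * z + c * v)). split.
    + rewrite Ew. unfold Z.succ. ring.
    + unfold Z.succ.
      replace (2 * (zch a c z y m + c * (y + a * Z.of_nat m * z + c * v)))
        with (2 * zch a c z y m + 2 * c * (y + a * Z.of_nat m * z + c * v)) by ring.
      rewrite Hz. ring.
Qed.

(** The invariant [a z <= y] yields the factor [a c + 1] at each step. It starts after the first
    step, since [p < c <= p + c y0] forces [y0 > 0]. *)
Lemma chain_growth a c p y0 m : 0 < a -> 0 < c -> p < c -> c <= zch a c p y0 1 ->
  zch a c p y0 1 * (a * c + 1) ^ Z.of_nat m <= zch a c p y0 (S m) /\
  a * zch a c p y0 (S m) <= ych a c p y0 (S m).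
Proof.
  intros Ha Hc Hp H1. induction m as [|m [IH1 IH2]].
  - change (Z.of_nat 0) with 0. rewrite Z.pow_0_r, Z.mul_1_r. split; [lia|].
    rewrite ychS. rewrite zchS, zch0, ych0 in *.
    assert (0 < y0) by nia. lia.
  - rewrite ychS, (zchS a c p y0 (S m)), Nat2Z.inj_succ, Z.pow_succ_r by lia.
    set (Z1 := zch a c p y0 (S m)) in *. set (Y1 := ych a c p y0 (S m)) in *.
    set (V := zch a c p y0 1) in *.
    set (w := (a * c + 1) ^ Z.of_nat m) in *.
    assert (Hw : 0 <= w) by (apply Z.pow_nonneg; nia).
    assert (A3 : 0 <= V * w) by (apply Z.mul_nonneg_nonneg; lia).
    assert (A1 : c * (a * Z1) <= c * Y1) by (apply Z.mul_le_mono_nonneg_l; lia).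
    assert (A2 : (a * c + 1) * (V * w) <= (a * c + 1) * Z1) by (apply Z.mul_le_mono_nonneg_l; nia).
    assert (0 <= a * Z1) by (apply Z.mul_nonneg_nonneg; lia).
    split; lia.
Qed.

(** Consecutive terms satisfy [z'' + z = (a c + 2) z'], and [- z <= z']. *)
Lemma chain_upper a c p y0 m : 0 < a -> 0 < c -> - c < p < c -> c <= zch a c p y0 1 ->
  zch a c p y0 (S m) <= zch a c p y0 1 * (a * c + 3) ^ Z.of_nat m.
Proof.
  intros Ha Hc Hp H1. induction m as [|m IH].
  - change (Z.of_nat 0) with 0. rewrite Z.pow_0_r. lia.
  - rewrite Nat2Z.inj_succ, Z.pow_succ_r by lia.
    assert (E : zch a c p y0 (S (S m)) + zch a c p y0 m = (a * c + 2) * zch a c p y0 (S m)).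
    { rewrite !zchS, ychS, zchS. ring. }
    assert (L : - zch a c p y0 m <= zch a c p y0 (S m)).
    { destruct m as [|m]; [rewrite zch0; lia|].
      pose proof (chain_growth a c p y0 m Ha Hc (proj2 Hp) H1) as [G1 _].
      pose proof (chain_growth a c p y0 (S m) Ha Hc (proj2 Hp) H1) as [G2 _].
      assert (0 <= zch a c p y0 1 * (a * c + 1) ^ Z.of_nat m)
        by (apply Z.mul_nonneg_nonneg; [lia|apply Z.pow_nonneg; nia]).
      assert (0 <= zch a c p y0 1 * (a * c + 1) ^ Z.of_nat (S m))
        by (apply Z.mul_nonneg_nonneg; [lia|apply Z.pow_nonneg; nia]).
      lia. }
    set (w := (a * c + 3) ^ Z.of_nat m) in *.
    set (V := zch a c p y0 (S m)) in *.
    assert (A : (a * c + 3) * V <= (a * c + 3) * (zch a c p y0 1 * w)) by (apply Z.mul_le_mono_nonneg_l; nia).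
    lia.
Qed.

(* [e] extends the pair [(a, c)]: [a e + 4 = x^2] and [c e + 4 = z^2]. *)
Definition ext (a c e z x : Z) : Prop := 0 < x /\ z ^ 2 = c * e + 4 /\ x ^ 2 = a * e + 4.

Lemma even_of_sq_even u : Z.Even (u * u) -> Z.Even u.
Proof.
  intros H. destruct (Z.Even_or_Odd u) as [E|[k ->]]; [exact E|]. exfalso.
  destruct H as [j Hj]. lia.
Qed.

Lemma ext_parity a c e s z x : s ^ 2 = a * c + 4 -> ext a c e z x ->
  (exists y, 2 * y = a * z + s * x) /\ (exists w, 2 * w = c * x + s * z).
Proof.
  intros Hs [_ [Hz Hx]]. split.
  - assert (E : Z.Even (a * z + s * x)).
    { apply even_of_sq_even.
      replace ((a * z + s * x) * (a * z + s * x)) with (a * a * z ^ 2 + 2 * a * z * s * x + s ^ 2 * x ^ 2) by ring.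
      rewrite Hs, Hz, Hx.
      exists (a * z * s * x + a * a * c * e + 2 * a * a + 2 * a * c + 2 * a * e + 8). ring. }
    destruct E as [y Hy]; exists y; lia.
  - assert (E : Z.Even (c * x + s * z)).
    { apply even_of_sq_even.
      replace ((c * x + s * z) * (c * x + s * z)) with (c * c * x ^ 2 + 2 * c * x * s * z + s ^ 2 * z ^ 2) by ring.
      rewrite Hs, Hz, Hx.
      exists (c * x * s * z + a * c * c * e + 2 * c * c + 2 * a * c + 2 * c * e + 8). ring. }
    destruct E as [y Hy]; exists y; lia.
Qed.

Lemma sq_lt_lt u v : 0 <= v -> u ^ 2 < v ^ 2 -> u < v.
Proof. intros; nia. Qed.

(** Steps are undone while [c <= z]. Each inverse step decreases [z] but keeps it above [- c], so
    the descent ends at some [|p| < c]; the last step undone started from a value at least [c],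
    which is the bound on the first forward step. *)
Lemma descent a c s : 0 < a < c -> 0 < s -> s ^ 2 = a * c + 4 ->
  forall z x e, 0 <= z -> ext a c e z x -> forall y, 2 * y = a * z + s * x ->
  exists m p xp ep y0, - c < p < c /\ ext a c ep p xp /\ 2 * y0 = a * p + s * xp /\
    chain a c p y0 m = (z, y) /\ (m <> O -> c <= zch a c p y0 1) /\ (c <= z -> m <> O).
Proof.
  intros Hac Hs0 Hs.
  assert (main : forall n z x e, Z.of_nat n = z -> 0 <= z -> ext a c e z x -> forall y, 2 * y = a * z + s * x ->
    exists m p xp ep y0, - c < p < c /\ ext a c ep p xp /\ 2 * y0 = a * p + s * xp /\
    chain a c p y0 m = (z, y) /\ (m <> O -> c <= zch a c p y0 1) /\ (c <= z -> m <> O)).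
  2:{ intros z x e Hz. apply (main (Z.to_nat z)); lia. }
  induction n as [n IH] using (well_founded_induction lt_wf).
  intros z x e Hn Hz He y Hy.
  destruct (Z_lt_le_dec z c) as [Hzc|Hzc].
  - exists O, z, x, e, y. repeat split; try tauto; try lia; try apply He.
  - destruct (ext_parity _ _ _ _ _ _ Hs He) as [_ [w Hw]].
    destruct He as [Hx [Ez Ex]].
    (* Multiplication by the inverse unit: [2 y1] is the conjugate [s x - a z] of [2 y]. *)
    set (y1 := y - a * z). set (z1 := z - c * y1). set (x1 := x + a * (w - s * z)).
    assert (Hy1 : 2 * y1 = s * x - a * z) by (unfold y1; lia).
    assert (Hx1 : 2 * x1 = (a * c + 2) * x - a * s * z).
    { unfold x1. replace (2 * (x + a * (w - s * z))) with (2 * x + a * (2 * w) - 2 * a * s * z) by ring.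
      rewrite Hw. ring. }
    assert (Hz1 : 2 * z1 = (a * c + 2) * z - c * s * x).
    { unfold z1. replace (2 * (z - c * y1)) with (2 * z - c * (2 * y1)) by ring. rewrite Hy1. ring. }
    assert (Eq : a * z ^ 2 + 4 * c = c * x ^ 2 + 4 * a) by (rewrite Ez, Ex; ring).
    assert (x1pos : 0 < x1).
    { assert ((a * s * z) ^ 2 < ((a * c + 2) * x) ^ 2).
      { replace ((a * s * z) ^ 2) with (a * s ^ 2 * (a * z ^ 2)) by ring.
        replace (a * z ^ 2) with (c * x ^ 2 + 4 * a - 4 * c) by lia.
        rewrite Hs. replace (((a * c + 2) * x) ^ 2) with ((a * c + 2) ^ 2 * x ^ 2) by ring.
        assert (0 < x ^ 2) by nia.
        assert (0 < a * (a * c + 4) * (c - a)) by (apply Z.mul_pos_pos; nia).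
        lia. }
      assert (0 <= (a * c + 2) * x) by (clear - Hac Hx; apply Z.mul_nonneg_nonneg; nia).
      assert (a * s * z < (a * c + 2) * x) by (apply sq_lt_lt; lia). lia. }
    assert (e1 : exists e1, ext a c e1 z1 x1).
    { exists (e - 2 * z * y1 + c * y1 ^ 2). split; [exact x1pos|].
      assert (A1 : z1 ^ 2 = c * (e - 2 * z * y1 + c * y1 ^ 2) + 4).
      { unfold z1. replace ((z - c * y1) ^ 2) with (z ^ 2 + c * (- 2 * z * y1 + c * y1 ^ 2)) by ring.
        rewrite Ez. ring. }
      split; [exact A1|].
      assert (A2 : a * z1 ^ 2 + 4 * c = c * x1 ^ 2 + 4 * a).
      { assert (4 * (a * z1 ^ 2 + 4 * c) = 4 * (c * x1 ^ 2 + 4 * a)); [|lia].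
        replace (4 * (a * z1 ^ 2 + 4 * c)) with (a * (2 * z1) ^ 2 + 16 * c) by ring.
        replace (4 * (c * x1 ^ 2 + 4 * a)) with (c * (2 * x1) ^ 2 + 16 * a) by ring.
        rewrite Hz1, Hx1.
        replace (a * ((a * c + 2) * z - c * s * x) ^ 2 + 16 * c) with
          ((a * c + 2) ^ 2 * (a * z ^ 2) - 2 * a * c * s * (a * c + 2) * z * x + a * c ^ 2 * s ^ 2 * x ^ 2 + 16 * c) by ring.
        replace (c * ((a * c + 2) * x - a * s * z) ^ 2 + 16 * a) with
          ((a * c + 2) ^ 2 * (c * x ^ 2) - 2 * a * c * s * (a * c + 2) * z * x + a * c * s ^ 2 * (a * z ^ 2) + 16 * a) by ring.
        rewrite Hs. replace (c * x ^ 2) with (a * z ^ 2 + 4 * c - 4 * a) by lia.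
        replace (a * c ^ 2 * (a * c + 4) * x ^ 2) with (a * c * (a * c + 4) * (c * x ^ 2)) by ring.
        replace (c * x ^ 2) with (a * z ^ 2 + 4 * c - 4 * a) by lia. ring. }
      rewrite A1 in A2. apply (Z.mul_reg_l _ _ c); lia. }
    assert (zlt : z1 < z).
    { assert (0 < y1); [|unfold z1; assert (0 < c * y1) by (apply Z.mul_pos_pos; lia); lia].
      assert (a * z < s * x); [|lia].
      apply sq_lt_lt; [apply Z.mul_nonneg_nonneg; lia|].
      apply (Z.mul_lt_mono_pos_l c); [lia|].
      replace (c * (s * x) ^ 2) with (s ^ 2 * (c * x ^ 2)) by ring.
      replace (c * x ^ 2) with (a * z ^ 2 + 4 * c - 4 * a) by lia. rewrite Hs.
      assert (0 <= a * z ^ 2) by (apply Z.mul_nonneg_nonneg; [lia|apply Z.pow_nonneg; lia]).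
      assert (0 < (a * c + 4) * (c - a)) by (apply Z.mul_pos_pos; nia).
      lia. }
    assert (zgt : - c < z1).
    { assert (A : c * s * x < (a * c + 2) * z + 2 * c); [|lia].
      assert (0 <= (a * c + 2) * z) by (apply Z.mul_nonneg_nonneg; nia).
      apply sq_lt_lt; [lia|].
      replace ((c * s * x) ^ 2) with (c * s ^ 2 * (c * x ^ 2)) by ring.
      replace (c * x ^ 2) with (a * z ^ 2 + 4 * c - 4 * a) by lia. rewrite Hs.
      assert (ac0 : 0 < a * c) by (apply Z.mul_pos_pos; lia).
      assert (c * c <= z * z) by (apply Z.mul_le_mono_nonneg; lia).
      assert (c * (a * c + 2) * c <= c * (a * c + 2) * z)
        by (apply Z.mul_le_mono_nonneg_l; [apply Z.mul_nonneg_nonneg|]; lia).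
      assert (0 < a * c * (a * c)) by (apply Z.mul_pos_pos; lia).
      lia. }
    destruct e1 as [e1 He1].
    assert (Y1 : 2 * y1 = a * z1 + s * x1).
    { assert (2 * (2 * y1) = 2 * (a * z1 + s * x1)); [|lia].
      replace (2 * (a * z1 + s * x1)) with (a * (2 * z1) + s * (2 * x1)) by ring.
      rewrite Hz1, Hx1, Hy1.
      replace (a * ((a * c + 2) * z - c * s * x) + s * ((a * c + 2) * x - a * s * z)) with
        (a * (a * c + 2) * z + 2 * s * x - a * s ^ 2 * z) by ring.
      rewrite Hs. ring. }
    assert (top : z1 + c * y1 = z /\ y1 + a * z = y) by (unfold z1, y1; lia).
    destruct top as [T1 T2].
    destruct (Z_lt_le_dec z1 c) as [Hz1c|Hz1c].
    + exists 1%nat, z1, x1, e1, y1. repeat split; try tauto; try lia; try apply He1.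
      * simpl. rewrite T1, T2. reflexivity.
      * intros _. rewrite zchS, zch0, ych0. lia.
    + destruct (IH (Z.to_nat z1) ltac:(lia) z1 x1 e1 ltac:(lia) ltac:(lia) He1 y1 Y1)
        as (m & p & xp & ep & y0 & H1 & H2 & H3 & H4 & H5 & H6).
      exists (S m), p, xp, ep, y0. repeat split; try tauto; try lia; try apply H2.
      change (chain a c p y0 (S m)) with (let '(z', y') := chain a c p y0 m in (z' + c * y', y' + a * (z' + c * y'))).
      rewrite H4. rewrite T1, T2. reflexivity.
Qed.

Lemma even_sub_of_sq u v : Z.Even (u * u + v * v) -> Z.Even (u - v).
Proof.
  intros [k Hk]. apply even_of_sq_even. exists (k - u * v). lia.
Qed.

Lemma ext_neg a c e z x : ext a c e z x -> ext a c e (- z) x.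
Proof. intros [H1 [H2 H3]]. repeat split; auto. replace ((- z) ^ 2) with (z ^ 2) by ring. exact H2. Qed.

(* The step from [(p, x)] to [(w, y)] has norm one; it lands on [(2, 2)]. *)
Lemma ext_near_end a c e s p x : 0 < a < c -> 5 <= c -> 0 < s -> s ^ 2 = a * c + 4 ->
  ext a c e p x -> - c < p -> 2 * p <= - c -> p = s - c /\ x = s - a.
Proof.
  intros Hac Hc5 Hs0 Hs He Hp1 Hp2.
  destruct (ext_parity _ _ _ _ _ _ Hs He) as [[y Hy] [w Hw]].
  destruct He as [Hx [Ez Ex]].
  (* [f] is one of the two regular extensions of [{a, c, e}], with [w] and [y] as roots of [c f + 4]
     and [a f + 4]; it will turn out to be [0]. *)
  assert (F : exists f, 2 * f = a * c * e + 2 * (a + c + e) + s * x * p).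
  { destruct (even_sub_of_sq (a * c * e) (s * x * p)) as [f Hf].
    - replace (s * x * p * (s * x * p)) with (s ^ 2 * x ^ 2 * p ^ 2) by ring. rewrite Hs, Ex, Ez.
      exists (a * a * c * c * e * e + 2 * a * c * e * (a + c + e) + 8 * (a * c + a * e + c * e) + 32). ring.
    - exists (a * c * e + a + c + e - f). lia. }
  destruct F as [f Hf].
  assert (Ew : w ^ 2 = c * f + 4).
  { assert (4 * w ^ 2 = 4 * (c * f + 4)); [|lia].
    replace (4 * w ^ 2) with ((2 * w) ^ 2) by ring. rewrite Hw.
    replace (4 * (c * f + 4)) with (2 * c * (2 * f) + 16) by ring. rewrite Hf.
    replace ((c * x + s * p) ^ 2) with (c ^ 2 * x ^ 2 + 2 * c * (s * x * p) + s ^ 2 * p ^ 2) by ring.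
    rewrite Hs, Ex, Ez. ring. }
  assert (Ey : y ^ 2 = a * f + 4).
  { assert (4 * y ^ 2 = 4 * (a * f + 4)); [|lia].
    replace (4 * y ^ 2) with ((2 * y) ^ 2) by ring. rewrite Hy.
    replace (4 * (a * f + 4)) with (2 * a * (2 * f) + 16) by ring. rewrite Hf.
    replace ((a * p + s * x) ^ 2) with (a ^ 2 * p ^ 2 + 2 * a * (s * x * p) + s ^ 2 * x ^ 2) by ring.
    rewrite Hs, Ex, Ez. ring. }
  assert (Hf0 : 0 <= f) by (clear - Ew Hc5; nia).
  assert (Epos : 0 <= e) by (clear - Ez Hc5; nia).
  assert (y0 : 0 < y).
  { assert (- (a * p) < s * x); [|lia]. apply sq_lt_lt; [apply Z.mul_nonneg_nonneg; lia|].
    replace ((s * x) ^ 2) with (s ^ 2 * x ^ 2) by ring. rewrite Hs, Ex.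
    replace ((- (a * p)) ^ 2) with (a * a * p ^ 2) by ring. rewrite Ez.
    assert (0 <= a * e) by (apply Z.mul_nonneg_nonneg; lia).
    assert (a * a < a * c) by (apply Z.mul_lt_mono_pos_l; lia). lia. }
  assert (Y : y * (s * x - a * p) = 2 * (a * (c + e - a) + 4)).
  { assert (2 * (y * (s * x - a * p)) = 2 * (2 * (a * (c + e - a) + 4))); [|lia].
    replace (2 * (y * (s * x - a * p))) with ((2 * y) * (s * x - a * p)) by ring. rewrite Hy.
    replace ((a * p + s * x) * (s * x - a * p)) with (s ^ 2 * x ^ 2 - a * a * p ^ 2) by ring.
    rewrite Hs, Ex, Ez. ring. }
  (* By [Y] the product of [y] with its conjugate is known; for [p <= - c / 2] the conjugate is so
     large that [y >= 3] would exceed this product. *)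
  assert (y3 : y < 3).
  { destruct (Z_lt_le_dec y 3) as [L|L]; [exact L|exfalso].
    assert (sx : - (2 * (a * p)) + 6 <= s * x - a * p) by lia.
    assert (Q : 3 * (- (2 * (a * p)) + 6) <= 2 * (a * (c + e - a) + 4)).
    { rewrite <- Y. apply Z.mul_le_mono_nonneg; lia. }
    assert (Q2 : 0 <= c * (2 * (a * (c + e - a) + 4) + 6 * (a * p) - 18)) by (apply Z.mul_nonneg_nonneg; lia).
    replace (c * (2 * (a * (c + e - a) + 4) + 6 * (a * p) - 18)) with
      (2 * a * (c * c - a * c + (c * e + 4) + 3 * c * p) - 8 * a - 10 * c) in Q2 by ring.
    rewrite <- Ez in Q2.
    assert (R : 4 * (c * c + p ^ 2 + 3 * c * p) <= - (c * c)) by (clear - Hp1 Hp2 Hc5; nia).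
    clear - R Q2 Hac Hc5.
    assert (R2 : 2 * a * (4 * (c * c + p ^ 2 + 3 * c * p)) <= 2 * a * (- (c * c))) by (apply Z.mul_le_mono_nonneg_l; lia).
    assert (0 <= a * a * c) by (repeat apply Z.mul_nonneg_nonneg; lia).
    assert (0 <= a * c * c) by (repeat apply Z.mul_nonneg_nonneg; lia).
    lia. }
  assert (y2 : y = 2) by (assert (y <> 1) by (intro; subst y; clear - Ey Hf0 Hac; nia); lia).
  subst y. assert (f0 : f = 0) by (clear - Ey Hac; nia).
  subst f. assert (W : w = 2 \/ w = -2) by (clear - Ew; nia).
  assert (B1 : 2 * (2 * p) = s * (2 * w) - c * (2 * 2)).
  { rewrite Hw, Hy. replace (s * (c * x + s * p) - c * (a * p + s * x)) with (s ^ 2 * p - a * c * p) by ring.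
    rewrite Hs. ring. }
  assert (B2 : 2 * (2 * x) = s * (2 * 2) - a * (2 * w)).
  { rewrite Hw, Hy. replace (s * (a * p + s * x) - a * (c * x + s * p)) with (s ^ 2 * x - a * c * x) by ring.
    rewrite Hs. ring. }
  destruct W as [W|W]; subst w; lia.
Qed.

(** The starting values differ by [0] or, up to sign, by [c]. In the second case one of them has
    absolute value at least [c / 2] and is determined by [ext_near_end]; this fixes the other one
    and its extension. *)
Lemma classify a b c s t e1 e2 p xp q yq : 0 < a < b -> b < c -> 5 <= c -> 0 < s -> 0 < t ->
  s ^ 2 = a * c + 4 -> t ^ 2 = b * c + 4 ->
  - c < p < c -> - c < q < c -> ext a c e1 p xp -> ext b c e2 q yq -> (c | q - p) ->
  (p = q /\ e1 = e2) \/
  (exists eps, (eps = 1 \/ eps = -1) /\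
    ((p = eps * (s - c) /\ xp = s - a /\ q = eps * s /\ e2 = a) \/
     (p = eps * t /\ e1 = b /\ q = eps * (t - c) /\ yq = t - b))).
Proof.
  intros Hab Hbc Hc5 Hs0 Ht0 Hs Ht Hp Hq E1 E2 [j Hj].
  assert (J : j = 0 \/ j = 1 \/ j = -1) by (clear - Hj Hp Hq Hc5; nia).
  assert (S1 : forall e q yq, ext b c e q yq -> q ^ 2 = s ^ 2 -> e = a).
  { intros e q' yq' [_ [H _]] H'. rewrite Hs in H'. apply (Z.mul_reg_l _ _ c); lia. }
  assert (T1 : forall e q xq, ext a c e q xq -> q ^ 2 = t ^ 2 -> e = b).
  { intros e q' yq' [_ [H _]] H'. rewrite Ht in H'. apply (Z.mul_reg_l _ _ c); lia. }
  destruct J as [J|[J|J]]; subst j.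
  - left. assert (p = q) by lia. subst q. split; [reflexivity|].
    destruct E1 as [_ [A _]], E2 as [_ [B _]]. apply (Z.mul_reg_l _ _ c); lia.
  - right. destruct (Z_lt_le_dec (- c) (2 * p)) as [L|L].
    + exists (-1). split; [auto|]. right.
      destruct (ext_near_end b c e2 t (- q) yq) as [A B]; try lia; auto using ext_neg.
      assert (p = - t) by lia. repeat split; try lia. apply (T1 _ _ _ E1). subst p. ring.
    + exists 1. split; [auto|]. left.
      destruct (ext_near_end a c e1 s p xp) as [A B]; try lia; auto.
      assert (q = s) by lia. repeat split; try lia. apply (S1 _ _ _ E2). subst q. ring.
  - right. destruct (Z_lt_le_dec (2 * p) c) as [L|L].
    + exists 1. split; [auto|]. right.
      destruct (ext_near_end b c e2 t q yq) as [A B]; try lia; auto.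
      assert (p = t) by lia. repeat split; try lia. apply (T1 _ _ _ E1). subst p. ring.
    + exists (-1). split; [auto|]. left.
      destruct (ext_near_end a c e1 s (- p) xp) as [A B]; try lia; auto using ext_neg.
      assert (q = - s) by lia. repeat split; try lia. apply (S1 _ _ _ E2). subst q. ring.
Qed.

(** * Powers with a perturbed base *)

Lemma pow_one_add_le (N k n : Z) : 0 < N -> 0 <= k -> 0 <= n ->
  (IZR ((N + k) ^ n) <= exp (IZR n * (IZR k / IZR N)) * IZR (N ^ n))%R.
Proof.
  intros HN Hk Hn. rewrite <- (Z2Nat.id n Hn). set (i := Z.to_nat n). clearbody i. clear n Hn.
  assert (N0 : (0 < IZR N)%R) by (apply IZR_lt; lia).
  assert (K0 : (0 <= IZR k)%R) by (apply IZR_le; lia).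
  induction i as [|i IH].
  - simpl Z.of_nat. rewrite !Z.pow_0_r, Rmult_0_l, exp_0. lra.
  - rewrite Nat2Z.inj_succ, !Z.pow_succ_r by lia. rewrite !mult_IZR, succ_IZR, plus_IZR.
    replace ((IZR (Z.of_nat i) + 1) * (IZR k / IZR N))%R with
      (IZR k / IZR N + IZR (Z.of_nat i) * (IZR k / IZR N))%R by ring.
    rewrite exp_plus.
    assert (E : (IZR N + IZR k <= exp (IZR k / IZR N) * IZR N)%R).
    { assert (U : (1 + IZR k / IZR N <= exp (IZR k / IZR N))%R).
      { destruct (Req_dec (IZR k / IZR N) 0) as [->|Hne]; [rewrite exp_0; lra|left; now apply exp_ineq1]. }
      replace (IZR N + IZR k)%R with ((1 + IZR k / IZR N) * IZR N)%R by (field; lra).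
      apply Rmult_le_compat_r; lra. }
    assert (0 <= IZR ((N + k) ^ Z.of_nat i))%R by (apply IZR_le, Z.pow_nonneg; lia).
    assert (0 <= IZR (N ^ Z.of_nat i))%R by (apply IZR_le, Z.pow_nonneg; lia).
    pose proof (exp_pos (IZR k / IZR N)).
    pose proof (exp_pos (IZR (Z.of_nat i) * (IZR k / IZR N))).
    apply Rle_trans with ((IZR N + IZR k) * (exp (IZR (Z.of_nat i) * (IZR k / IZR N)) * IZR (N ^ Z.of_nat i)))%R.
    + apply Rmult_le_compat_l; lra.
    + replace (exp (IZR k / IZR N) * exp (IZR (Z.of_nat i) * (IZR k / IZR N)) * (IZR N * IZR (N ^ Z.of_nat i)))%R
        with ((exp (IZR k / IZR N) * IZR N) * (exp (IZR (Z.of_nat i) * (IZR k / IZR N)) * IZR (N ^ Z.of_nat i)))%R by ring.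
      apply Rmult_le_compat_r; [apply Rmult_le_pos; lra|exact E].
Qed.

Lemma exp_le_pow3 (u : Z) : 0 <= u -> (exp (IZR u) <= IZR (3 ^ u))%R.
Proof.
  intros Hu. rewrite <- (Z2Nat.id u Hu). set (i := Z.to_nat u). clearbody i.
  induction i as [|i IH]; [simpl; rewrite exp_0; lra|].
  rewrite Nat2Z.inj_succ, Z.pow_succ_r by lia. rewrite mult_IZR, succ_IZR, Rplus_comm, exp_plus.
  pose proof exp_le_3. pose proof (exp_pos 1). pose proof (exp_pos (IZR (Z.of_nat i))).
  apply Rmult_le_compat; lra.
Qed.

(** [(1 + u / n)^n <= exp u], with [3] in place of the base to stay within the integers. *)
Lemma pow_add_le_pow3 (n u : Z) : 0 < n -> 0 <= u -> (n + u) ^ n <= 3 ^ u * n ^ n.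
Proof.
  intros Hn Hu. apply le_IZR. rewrite mult_IZR.
  eapply Rle_trans; [apply pow_one_add_le; lia|].
  replace (IZR n * (IZR u / IZR n))%R with (IZR u) by (field; apply not_0_IZR; lia).
  apply Rmult_le_compat_r; [apply IZR_le, Z.pow_nonneg; lia|now apply exp_le_pow3].
Qed.

Lemma pow_small_increment (N k n : Z) : 0 < N -> 0 <= k -> 0 <= n -> n * k <= N -> (N + k) ^ n <= 3 * N ^ n.
Proof.
  intros HN Hk Hn Hle. apply le_IZR. rewrite mult_IZR.
  eapply Rle_trans; [apply pow_one_add_le; lia|].
  apply Rmult_le_compat_r; [apply IZR_le, Z.pow_nonneg; lia|].
  apply Rle_trans with (exp 1); [|exact exp_le_3].
  assert (N0 : (0 < IZR N)%R) by (apply IZR_lt; lia).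
  assert (U : (IZR n * (IZR k / IZR N) <= 1)%R).
  { apply Rmult_le_reg_r with (IZR N); [exact N0|].
    replace (IZR n * (IZR k / IZR N) * IZR N)%R with (IZR n * IZR k)%R by (field; lra).
    rewrite <- mult_IZR, Rmult_1_l. now apply IZR_le. }
  destruct U as [U|U]; [left; now apply exp_increasing|rewrite U; lra].
Qed.

(** * Two chains with a common end *)

Section TwoChains.
Variables a b c s t : Z.
Hypotheses (Hab : 0 < a < b) (Hbc : b < c) (Hc5 : 5 <= c) (Hs0 : 0 < s) (Ht0 : 0 < t).
Hypotheses (Hs : s ^ 2 = a * c + 4) (Ht : t ^ 2 = b * c + 4).

Set Implicit Arguments.
(* [p] and [q] are the reduced starting values of the two chains leading to [z];
   [m] and [n] are the numbers of steps. *)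
Record meet (d z p xp ya q yq yb e1 e2 m n : Z) : Prop := {
  meet_p : - c < p < c;
  meet_q : - c < q < c;
  meet_ext1 : ext a c e1 p xp;
  meet_ext2 : ext b c e2 q yq;
  meet_ya : 2 * ya = a * p + s * xp;
  meet_yb : 2 * yb = b * q + t * yq;
  meet_d : z ^ 2 = c * d + 4;
  meet_m : 1 <= m;
  meet_n : 1 <= n;
  meet_V1 : c <= p + c * ya;
  meet_W1 : c <= q + c * yb;
  meet_zV : (p + c * ya) * (a * c + 1) ^ (m - 1) <= z;
  meet_zW : (q + c * yb) * (b * c + 1) ^ (n - 1) <= z;
  meet_zV' : z <= (p + c * ya) * (a * c + 3) ^ (m - 1);
  meet_zW' : z <= (q + c * yb) * (b * c + 3) ^ (n - 1);
  meet_cong : (2 * c ^ 2 | 2 * (p - q) + c * (2 * m * ya + a * p * (m * (m - 1)) - 2 * n * yb - b * q * (n * (n - 1))));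
  meet_1 : m = 1 -> z = p + c * ya;
  meet_1' : n = 1 -> z = q + c * yb;
  meet_2 : m = 2 -> z = (p + c * ya) + c * (ya + a * (p + c * ya))
}.
Unset Implicit Arguments.


Lemma meet_exists d z x y : 0 < z -> c < d -> ext a c d z x -> ext b c d z y ->
  exists p xp ya q yq yb e1 e2 m n, meet d z p xp ya q yq yb e1 e2 m n.
Proof.
  intros Hz Hd E1 E2.
  assert (Hcz : c <= z) by (destruct E1 as [_ [E _]]; nia).
  destruct (ext_parity _ _ _ _ _ _ Hs E1) as [[y1 Hy1] _].
  destruct (ext_parity _ _ _ _ _ _ Ht E2) as [[y2 Hy2] _].
  destruct (descent a c s ltac:(lia) Hs0 Hs z x d ltac:(lia) E1 y1 Hy1)
    as (m & p & xp & e1 & ya & P1 & P2 & P3 & P4 & P5 & P6).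
  destruct (descent b c t ltac:(lia) Ht0 Ht z y d ltac:(lia) E2 y2 Hy2)
    as (n & q & yq & e2 & yb & Q1 & Q2 & Q3 & Q4 & Q5 & Q6).
  specialize (P6 Hcz). specialize (Q6 Hcz). specialize (P5 P6). specialize (Q5 Q6).
  destruct m as [|m]; [congruence|]. destruct n as [|n]; [congruence|].
  assert (Zp : zch a c p ya (S m) = z) by (unfold zch; now rewrite P4).
  assert (Zq : zch b c q yb (S n) = z) by (unfold zch; now rewrite Q4).
  assert (V1 : zch a c p ya 1 = p + c * ya) by now rewrite zchS, zch0, ych0.
  assert (W1 : zch b c q yb 1 = q + c * yb) by now rewrite zchS, zch0, ych0.
  exists p, xp, ya, q, yq, yb, e1, e2, (Z.of_nat (S m)), (Z.of_nat (S n)).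
  assert (Em : Z.of_nat (S m) - 1 = Z.of_nat m) by lia.
  assert (En : Z.of_nat (S n) - 1 = Z.of_nat n) by lia.
  constructor; rewrite ?Em, ?En, <- ?V1, <- ?W1; auto; try lia.
  - apply E1.
  - rewrite <- Zp. refine (proj1 (chain_growth a c p ya m _ _ _ _)); lia.
  - rewrite <- Zq. refine (proj1 (chain_growth b c q yb n _ _ _ _)); lia.
  - rewrite <- Zp. apply chain_upper; lia.
  - rewrite <- Zq. apply chain_upper; lia.
  - destruct (chain_mod a c p ya (S m)) as (u & _ & _ & Hu).
    destruct (chain_mod b c q yb (S n)) as (u' & _ & _ & Hu').
    rewrite Zp in Hu. rewrite Zq in Hu'. rewrite Em in Hu. rewrite En in Hu'.
    exists (u' - u). lia.
  - intros E. assert (m = O) by lia. subst m. congruence.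
  - intros E. assert (n = O) by lia. subst n. congruence.
  - intros E. assert (m = 1%nat) by lia. subst m. rewrite <- Zp.
    now rewrite zchS, ychS, V1, ych0.
Qed.

Lemma ext_step_le a' s' e p xp : 0 < a' < c -> 0 < s' -> s' ^ 2 = a' * c + 4 -> - c < p < c -> ext a' c e p xp ->
  0 < s' * xp <= a' * c + 4 /\ e < c.
Proof.
  intros Ha Hs' Es Hp [Hx [E1 E2]].
  assert (He : e < c) by (clear - E1 Hp Hc5; nia).
  split; [|exact He]. split; [apply Z.mul_pos_pos; lia|].
  apply Z.lt_succ_r. apply sq_lt_lt; [nia|].
  replace ((s' * xp) ^ 2) with (s' ^ 2 * xp ^ 2) by ring. rewrite Es, E2.
  assert (0 <= a' * c) by (apply Z.mul_nonneg_nonneg; lia).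
  assert ((a' * c + 4) * (a' * e + 4) <= (a' * c + 4) * (a' * c + 4)); [|unfold Z.succ; lia].
  apply Z.mul_le_mono_nonneg_l; [lia|]. assert (a' * e <= a' * c) by (apply Z.mul_le_mono_nonneg_l; lia). lia.
Qed.

Section Meet.
Variables d z p xp ya q yq yb e1 e2 m n : Z.
Hypothesis H : meet d z p xp ya q yq yb e1 e2 m n.

Lemma V1_le : p + c * ya <= c * (a * c + 3).
Proof.
  pose proof (meet_p H) as Hp.
  pose proof (meet_ext1 H) as Hext1.
  pose proof (meet_ya H) as Hya.
  destruct (ext_step_le a s e1 p xp) as [[_ L] _]; try lia; auto.
  assert (a * p <= a * c) by (apply Z.mul_le_mono_nonneg_l; lia).
  assert (ya <= a * c + 2) by lia.
  assert (c * ya <= c * (a * c + 2)) by (apply Z.mul_le_mono_nonneg_l; lia). lia.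
Qed.

Lemma W1_le : q + c * yb <= c * (b * c + 3).
Proof.
  pose proof (meet_q H) as Hq.
  pose proof (meet_ext2 H) as Hext2.
  pose proof (meet_yb H) as Hyb.
  destruct (ext_step_le b t e2 q yq) as [[_ L] _]; try lia; auto.
  assert (b * q <= b * c) by (apply Z.mul_le_mono_nonneg_l; lia).
  assert (yb <= b * c + 2) by lia.
  assert (c * yb <= c * (b * c + 2)) by (apply Z.mul_le_mono_nonneg_l; lia). lia.
Qed.

Lemma ac_pos : 0 < a * c /\ a * c + 5 <= b * c.
Proof.
  split; [apply Z.mul_pos_pos; lia|].
  assert ((a + 1) * c <= b * c) by (apply Z.mul_le_mono_nonneg_r; lia). lia.
Qed.

(** A step of the chain for [b] multiplies by at least [b c + 1], one of the chain for [a] by at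
    most [a c + 3], which is smaller. *)
Lemma meet_n_le_m : n <= m.
Proof.
  pose proof V1_le as L. pose proof ac_pos as [A0 A1].
  pose proof (meet_m H) as Hm.
  pose proof (meet_n H) as Hn.
  pose proof (meet_V1 H) as HV1.
  pose proof (meet_W1 H) as HW1.
  pose proof (meet_zW H) as HzW.
  pose proof (meet_zV' H) as HzV'.
  destruct (Z_lt_le_dec m n) as [G|G]; [exfalso|exact G].
  assert (P1 : (b * c + 1) ^ m <= (b * c + 1) ^ (n - 1)) by (apply Z.pow_le_mono_r; lia).
  assert (P2 : (a * c + 3) ^ m < (b * c + 1) ^ m) by (apply Z.pow_lt_mono_l; lia).
  assert (P3 : c * (b * c + 1) ^ (n - 1) <= z).
  { eapply Z.le_trans; [|exact HzW]. apply Z.mul_le_mono_nonneg_r; [|lia].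
    apply Z.pow_nonneg; lia. }
  assert (P4 : z <= c * (a * c + 3) ^ m).
  { eapply Z.le_trans; [exact HzV'|].
    replace m with (Z.succ (m - 1)) at 2 by lia. rewrite Z.pow_succ_r by lia.
    rewrite Z.mul_assoc. apply Z.mul_le_mono_nonneg_r; [|exact L]. apply Z.pow_nonneg; lia. }
  assert (P5 : c * (b * c + 1) ^ (n - 1) <= c * (a * c + 3) ^ m) by lia.
  apply Z.mul_le_mono_pos_l in P5; lia.
Qed.

(** Since [b c + 3 <= (a c + 1)^2], a step for [b] is worth at most two steps for [a]; this gives
    [m - 1 <= 2 n]. *)
Lemma meet_m_le_3n : m <= 3 * n.
Proof.
  pose proof W1_le as L. pose proof ac_pos as [A0 A1].
  pose proof (meet_m H) as Hm.
  pose proof (meet_n H) as Hn.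
  pose proof (meet_V1 H) as HV1.
  pose proof (meet_W1 H) as HW1.
  pose proof (meet_zV H) as HzV.
  pose proof (meet_zW' H) as HzW'.
  assert (P3 : c * (a * c + 1) ^ (m - 1) <= z).
  { eapply Z.le_trans; [|exact HzV]. apply Z.mul_le_mono_nonneg_r; [|lia].
    apply Z.pow_nonneg; lia. }
  assert (P4 : z <= c * (b * c + 3) ^ n).
  { eapply Z.le_trans; [exact HzW'|].
    replace n with (Z.succ (n - 1)) at 2 by lia. rewrite Z.pow_succ_r by lia.
    rewrite Z.mul_assoc. apply Z.mul_le_mono_nonneg_r; [|exact L]. apply Z.pow_nonneg; lia. }
  assert (P5 : c * (a * c + 1) ^ (m - 1) <= c * (b * c + 3) ^ n) by lia.
  apply Z.mul_le_mono_pos_l in P5; [|lia].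
  assert (B : b * c + 3 <= (a * c + 1) ^ 2).
  { replace ((a * c + 1) ^ 2) with (a * c * (a * c) + 2 * (a * c) + 1) by ring.
    assert (c * c <= a * c * (a * c)) by (apply Z.mul_le_mono_nonneg; nia).
    assert (b * c <= c * c) by (apply Z.mul_le_mono_nonneg_r; lia). nia. }
  assert (P6 : (b * c + 3) ^ n <= (a * c + 1) ^ (2 * n)).
  { rewrite Z.pow_mul_r by lia. apply Z.pow_le_mono_l; lia. }
  assert (P7 : (a * c + 1) ^ (m - 1) <= (a * c + 1) ^ (2 * n)) by lia.
  apply Z.pow_le_mono_r_iff in P7; lia.
Qed.

(** The lower bound of [z] from one chain against the upper bound from the other. Replacing
    [(b c + 3) / (a c + 1)] by [b / a] costs at most [(1 + 3 a / N)^(n - 1)] with [N = b (a c + 1)],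
    hence a factor [3] for [3 a n <= N]. *)
Lemma meet_ratio : 3 * a * n <= b * (a * c + 1) ->
  a ^ (n - 1) * (a * c + 1) ^ (m - n) * (p + c * ya) <= 3 * b ^ (n - 1) * (q + c * yb).
Proof.
  intros Hsmall. pose proof meet_n_le_m as L. pose proof ac_pos as [A0 A1].
  pose proof (meet_m H) as Hm.
  pose proof (meet_n H) as Hn.
  pose proof (meet_V1 H) as HV1.
  pose proof (meet_W1 H) as HW1.
  pose proof (meet_zV H) as HzV.
  pose proof (meet_zW' H) as HzW'.
  set (N := b * (a * c + 1)).
  assert (Q1 : (a * (b * c + 3)) ^ (n - 1) <= 3 * N ^ (n - 1)).
  { eapply Z.le_trans; [|apply (pow_small_increment N (3 * a) (n - 1)); unfold N; nia].
    apply Z.pow_le_mono_l. unfold N. nia. }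
  assert (Q2 : (p + c * ya) * (a * c + 1) ^ (m - 1) <= (q + c * yb) * (b * c + 3) ^ (n - 1)) by lia.
  assert (an : 0 < a ^ (n - 1)) by (apply Z.pow_pos_nonneg; lia).
  assert (Q3 : a ^ (n - 1) * ((p + c * ya) * (a * c + 1) ^ (m - 1)) <= (q + c * yb) * (3 * N ^ (n - 1))).
  { eapply Z.le_trans; [apply Z.mul_le_mono_nonneg_l; [lia|exact Q2]|].
    replace (a ^ (n - 1) * ((q + c * yb) * (b * c + 3) ^ (n - 1))) with
      ((q + c * yb) * (a * (b * c + 3)) ^ (n - 1)) by (rewrite Z.pow_mul_l; ring).
    apply Z.mul_le_mono_nonneg_l; lia. }
  replace (m - 1) with ((m - n) + (n - 1)) in Q3 by lia.
  unfold N in Q3. rewrite Z.pow_add_r, Z.pow_mul_l in Q3 by lia.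
  assert (w : 0 < (a * c + 1) ^ (n - 1)) by (apply Z.pow_pos_nonneg; lia).
  apply (Z.mul_le_mono_pos_r _ _ _ w). lia.
Qed.
End Meet.
End TwoChains.

(** * The gap principle *)

(* A quadratic equation for [d], whose roots are the two regular extensions of [{a, b, c}]. *)
Definition regular (a b c d : Z) : Prop := (a + b - c - d) ^ 2 = (a * b + 4) * (c * d + 4).

Lemma sq_le_le u v : 0 <= v -> u ^ 2 <= v ^ 2 -> u <= v.
Proof. intros; nia. Qed.

(** The norm equation of a chain in the coordinates [p] and [y]. *)
Lemma step_sq a c e s p x y : s ^ 2 = a * c + 4 -> p ^ 2 = c * e + 4 -> x ^ 2 = a * e + 4 ->
  2 * y = a * p + s * x -> y ^ 2 - a * (p * y) = a * (c + e - a) + 4.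
Proof.
  intros Hs Hp Hx Hy.
  assert (4 * (y ^ 2 - a * (p * y)) = 4 * (a * (c + e - a) + 4)); [|lia].
  replace (4 * (y ^ 2 - a * (p * y))) with ((2 * y - a * p) ^ 2 - a * a * p ^ 2) by ring.
  replace (2 * y - a * p) with (s * x) by lia.
  replace ((s * x) ^ 2) with (s ^ 2 * x ^ 2) by ring. rewrite Hs, Hp, Hx. ring.
Qed.

(** Both chains share the point [(p, y)]. Subtracting their norm equations gives
    [p y = a + b - c - e], hence [y^2 = a b + 4]: so [e] is regular, and by Vieta [d] is the other
    root. *)
Lemma regular_step a b c d e s t p x x' y : a <> b -> 0 < c -> s ^ 2 = a * c + 4 -> t ^ 2 = b * c + 4 ->
  p ^ 2 = c * e + 4 -> x ^ 2 = a * e + 4 -> x' ^ 2 = b * e + 4 ->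
  2 * y = a * p + s * x -> 2 * y = b * p + t * x' -> (p + c * y) ^ 2 = c * d + 4 -> regular a b c d.
Proof.
  intros Hab Hc Hs Ht Hp Hx Hx' Y1 Y2 Hd.
  pose proof (step_sq _ _ _ _ _ _ _ Hs Hp Hx Y1) as S1.
  pose proof (step_sq _ _ _ _ _ _ _ Ht Hp Hx' Y2) as S2.
  assert (E : p * y = a + b - c - e).
  { apply (Z.mul_reg_l _ _ (b - a)); [clear - Hab; lia|]. clear - S1 S2.
    transitivity ((y ^ 2 - a * (p * y)) - (y ^ 2 - b * (p * y))); [ring|]. rewrite S1, S2. ring. }
  rewrite E in S1. assert (Y : y ^ 2 = a * b + 4) by (clear - S1; lia).
  assert (D : d + e = a * b * c + 2 * (a + b + c)).
  { apply (Z.mul_reg_l _ _ c); [lia|].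
    replace ((p + c * y) ^ 2) with (p ^ 2 + 2 * c * (p * y) + c * c * y ^ 2) in Hd by ring.
    rewrite Hp, E, Y in Hd. clear - Hd. lia. }
  assert (R : (a + b - c - e) ^ 2 = (a * b + 4) * (c * e + 4)).
  { rewrite <- E, <- Y, <- Hp. ring. }
  unfold regular. replace d with (a * b * c + 2 * (a + b + c) - e) by (clear - D; lia).
  apply Zminus_eq. transitivity ((a + b - c - e) ^ 2 - (a * b + 4) * (c * e + 4)); [ring|].
  rewrite R. ring.
Qed.

Lemma a_yb_le a b c e s t p x x' ya yb : 0 < a < b -> 0 <= c -> 0 <= e -> 0 < s -> 0 < x ->
  s ^ 2 = a * c + 4 -> t ^ 2 = b * c + 4 -> x ^ 2 = a * e + 4 -> x' ^ 2 = b * e + 4 ->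
  2 * ya = a * p + s * x -> 2 * yb = b * p + t * x' -> a * yb <= b * ya.
Proof.
  intros Hab Hc He Hs0 Hx0 Hs Ht Hx Hx' Ya Yb.
  assert (A : a * (t * x') <= b * (s * x)).
  { assert (0 <= s * x) by (apply Z.mul_nonneg_nonneg; lia).
    apply sq_le_le; [apply Z.mul_nonneg_nonneg; lia|].
    replace ((a * (t * x')) ^ 2) with (a ^ 2 * (t ^ 2 * x' ^ 2)) by ring.
    replace ((b * (s * x)) ^ 2) with (b ^ 2 * (s ^ 2 * x ^ 2)) by ring.
    rewrite Hs, Ht, Hx, Hx'.
    assert (0 <= a * b * (b - a) * (c + e)) by (repeat apply Z.mul_nonneg_nonneg; lia).
    assert (0 <= (b - a) * (b + a)) by (apply Z.mul_nonneg_nonneg; lia).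
    lia. }
  lia.
Qed.

Section Gap.
Variables a b c s t : Z.
Hypotheses (Hab : 0 < a < b) (Hbc : b < c) (Hc5 : 5 <= c) (Hs0 : 0 < s) (Ht0 : 0 < t).
Hypotheses (Hs : s ^ 2 = a * c + 4) (Ht : t ^ 2 = b * c + 4).
Variables d z p xp ya q yq yb e1 e2 m n : Z.
Hypothesis H : meet a b c s t d z p xp ya q yq yb e1 e2 m n.

Lemma ext_nonneg a' e x w : ext a' c e w x -> 0 <= e.
Proof. intros [_ [E _]]. clear - E Hc5. nia. Qed.

(** By [a_yb_le] the first terms have ratio about [b / a] at most; a negative [p] is absorbed by the
    factor [2], since then [ya >= 2]. *)
Lemma aW1_le : p = q -> e1 = e2 -> a * (q + c * yb) <= 2 * b * (p + c * ya).
Proof.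
  intros Epq Ee. subst q e2.
  pose proof (ext_nonneg _ _ _ _ (meet_ext1 H)) as He.
  destruct (meet_ext1 H) as [Hx [Hp Hxp]]. destruct (meet_ext2 H) as [Hy [_ Hyq]].
  pose proof (a_yb_le a b c e1 s t p xp yq ya yb Hab ltac:(lia) He Hs0 Hx Hs Ht Hxp Hyq (meet_ya H) (meet_yb H)) as L.
  pose proof (meet_V1 H) as V. pose proof (meet_p H) as P.
  assert (c * (a * yb) <= c * (b * ya)) by (apply Z.mul_le_mono_nonneg_l; lia).
  destruct (Z_lt_le_dec p 0) as [G|G].
  - assert (2 <= ya) by (clear - G V Hc5; nia).
    assert (b * c * 2 <= b * c * ya) by (apply Z.mul_le_mono_nonneg_l; nia).
    assert (0 <= a * (- p)) by (apply Z.mul_nonneg_nonneg; lia).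
    assert (b * (- p) <= b * c) by (apply Z.mul_le_mono_nonneg_l; lia).
    lia.
  - assert (0 <= ya) by (clear - P V Hc5; nia).
    assert (0 <= b * (c * ya)) by (repeat apply Z.mul_nonneg_nonneg; lia).
    assert (a * p <= b * p) by (apply Z.mul_le_mono_nonneg_r; lia).
    lia.
Qed.

Lemma meet_dvd : (c | q - p).
Proof.
  destruct (meet_cong H) as [k Hk].
  assert (E : forall i, exists h, i * (i - 1) = 2 * h).
  { intros i. destruct (Z.Even_or_Odd i) as [[h ->]|[h ->]];
      [exists (h * (2 * h - 1))|exists ((2 * h + 1) * h)]; ring. }
  destruct (E m) as [h1 E1]. destruct (E n) as [h2 E2]. rewrite E1, E2 in Hk.
  exists (m * ya + a * p * h1 - n * yb - b * q * h2 - k * c). clear - Hk.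
  apply (Z.mul_reg_l _ _ 2); [lia|].
  transitivity (c * (2 * m * ya + a * p * (2 * h1) - 2 * n * yb - b * q * (2 * h2)) - k * (2 * c ^ 2)); [|ring].
  rewrite <- Hk. ring.
Qed.

Lemma meet_regular : m = 1 -> n = 1 -> p = q -> e1 = e2 -> regular a b c d.
Proof.
  intros Em En Epq Ee.
  pose proof (meet_1 H Em) as Z1. pose proof (meet_1' H En) as Z2.
  pose proof (meet_d H) as Hd. pose proof (meet_ya H) as Ya. pose proof (meet_yb H) as Yb.
  destruct (meet_ext1 H) as [Hx [Hp Hxp]]. destruct (meet_ext2 H) as [Hy [_ Hyq]].
  subst q e2. assert (yb = ya) by (apply (Z.mul_reg_l _ _ c); lia). subst yb.
  apply (regular_step a b c d e1 s t p xp yq ya); auto; lia.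
Qed.

Lemma meet_classify :
  (p = q /\ e1 = e2) \/
  (exists eps, (eps = 1 \/ eps = -1) /\
    ((p = eps * (s - c) /\ xp = s - a /\ q = eps * s /\ e2 = a) \/
     (p = eps * t /\ e1 = b /\ q = eps * (t - c) /\ yq = t - b))).
Proof.
  apply (classify a b c s t e1 e2 p xp q yq); auto.
  - exact (meet_p H).
  - exact (meet_q H).
  - exact (meet_ext1 H).
  - exact (meet_ext2 H).
  - exact meet_dvd.
Qed.

Variable r : Z.
Hypotheses (Hr0 : 0 < r) (Hr : r ^ 2 = a * b + 4).

Lemma pair_ge4 : 4 <= b.
Proof.
  destruct (Z_lt_le_dec b 4) as [L|L]; [exfalso|exact L].
  assert (B : a * b <= 6) by (clear - L Hab; nia).
  assert (A : 2 <= a * b) by (clear - Hab; nia).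
  assert (R : r < 4) by (clear - Hr B; nia).
  assert (R' : r = 1 \/ r = 2 \/ r = 3) by lia.
  assert (P : a * b = 5) by (destruct R' as [->|[->| ->]]; lia).
  clear - P Hab L. assert (b = 2 \/ b = 3) as [-> | ->] by lia; lia.
Qed.

Lemma ext_root e w x u v : ext v c e w x -> 0 < u -> u ^ 2 = v * e + 4 -> x = u.
Proof. intros [Hx [_ E]] Hu Eu. clear - Hx E Hu Eu. nia. Qed.

(* In the cases [2a] and [2b] of [meet_classify], one chain starts at a conjugate of [z = +-2];
   plus and minus refer to [eps]. *)
Lemma meet_2a_plus : p = s - c -> xp = s - a -> q = s -> e2 = a ->
  ya = 2 /\ 2 * yb = b * s + t * r.
Proof.
  intros Ep Ex Eq Ee. pose proof (meet_ya H) as Ya. pose proof (meet_yb H) as Yb.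
  assert (yq = r) by (apply (ext_root e2 q yq r b); [exact (meet_ext2 H)|auto|rewrite Ee; lia]).
  subst p xp q yq. split; [|exact Yb].
  clear - Ya Hs. replace (a * (s - c) + s * (s - a)) with (s ^ 2 - a * c) in Ya by ring. lia.
Qed.

Lemma meet_2a_minus : p = c - s -> xp = s - a -> q = - s -> e2 = a ->
  ya = a * c + 2 - a * s /\ 2 * yb = t * r - b * s.
Proof.
  intros Ep Ex Eq Ee. pose proof (meet_ya H) as Ya. pose proof (meet_yb H) as Yb.
  assert (yq = r) by (apply (ext_root e2 q yq r b); [exact (meet_ext2 H)|auto|rewrite Ee; lia]).
  subst p xp q yq. split; [|lia].
  clear - Ya Hs. replace (a * (c - s) + s * (s - a)) with (s ^ 2 + a * c - 2 * a * s) in Ya by ring. lia.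
Qed.

Lemma meet_2b_plus : p = t -> e1 = b -> q = t - c -> yq = t - b ->
  2 * ya = a * t + s * r /\ yb = 2.
Proof.
  intros Ep Ex Eq Ee. pose proof (meet_ya H) as Ya. pose proof (meet_yb H) as Yb.
  assert (xp = r) by (apply (ext_root e1 p xp r a); [exact (meet_ext1 H)|auto|rewrite Ex; lia]).
  subst p xp q yq. split; [exact Ya|].
  clear - Yb Ht. replace (b * (t - c) + t * (t - b)) with (t ^ 2 - b * c) in Yb by ring. lia.
Qed.

Lemma meet_2b_minus : p = - t -> e1 = b -> q = c - t -> yq = t - b ->
  2 * ya = s * r - a * t /\ yb = b * c + 2 - b * t.
Proof.
  intros Ep Ex Eq Ee. pose proof (meet_ya H) as Ya. pose proof (meet_yb H) as Yb.
  assert (xp = r) by (apply (ext_root e1 p xp r a); [exact (meet_ext1 H)|auto|rewrite Ex; lia]).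
  subst p xp q yq. split; [lia|].
  clear - Yb Ht. replace (b * (c - t) + t * (t - b)) with (t ^ 2 + b * c - 2 * b * t) in Yb by ring. lia.
Qed.

Lemma tr_sq : (t * r) ^ 2 = (b * s) ^ 2 + 4 * b * (a + c - b) + 16.
Proof.
  replace ((t * r) ^ 2) with (t ^ 2 * r ^ 2) by ring. replace ((b * s) ^ 2) with (b ^ 2 * s ^ 2) by ring.
  rewrite Hs, Ht, Hr. ring.
Qed.

Lemma tr_gt : b * s < t * r.
Proof.
  apply sq_lt_lt; [apply Z.mul_nonneg_nonneg; lia|]. rewrite tr_sq.
  assert (0 <= b * (a + c - b)) by (apply Z.mul_nonneg_nonneg; lia). lia.
Qed.

(** [(t r)^2 - (b s)^2] is at most [4 b c] and is divided by [t r + b s], which exceeds [2 b s]. *)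
Lemma tr_sub_le : s * (t * r - b * s) <= 2 * c.
Proof.
  pose proof tr_sq as E. pose proof tr_gt as G. pose proof pair_ge4 as B.
  apply (Z.mul_le_mono_pos_l _ _ (2 * b)); [lia|].
  apply Z.le_trans with ((t * r + b * s) * (t * r - b * s)).
  - replace (2 * b * (s * (t * r - b * s))) with ((b * s + b * s) * (t * r - b * s)) by ring.
    apply Z.mul_le_mono_nonneg_r; lia.
  - replace ((t * r + b * s) * (t * r - b * s)) with ((t * r) ^ 2 - (b * s) ^ 2) by ring. rewrite E.
    assert (b * a <= b * (b - 1)) by (apply Z.mul_le_mono_nonneg_l; lia). lia.
Qed.

Lemma sr_gt : a * t < s * r.
Proof.
  apply sq_lt_lt; [apply Z.mul_nonneg_nonneg; lia|].
  replace ((s * r) ^ 2) with (s ^ 2 * r ^ 2) by ring. replace ((a * t) ^ 2) with (a ^ 2 * t ^ 2) by ring.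
  rewrite Hs, Ht, Hr.
  assert (0 <= a * (b + c - a)) by (apply Z.mul_nonneg_nonneg; lia). lia.
Qed.

Hypothesis Hbig : 4 * b < c.

Lemma ac1_pow_le i j : i <= j -> (a * c + 1) ^ i <= (a * c + 1) ^ j.
Proof.
  intros Hi. assert (0 < a * c) by (apply Z.mul_pos_pos; lia). apply Z.pow_le_mono_r; lia.
Qed.

(** Two steps for [b] give [z >= c (b c + 1)], and [d = (z^2 - 4) / c]. *)
Lemma gap_two_steps : 2 <= n -> b ^ 2 * c ^ 3 <= 4 * d.
Proof.
  intros Hn. pose proof (meet_zW H) as Z1. pose proof (meet_W1 H) as W. pose proof (meet_d H) as Hd.
  assert (B : b * c + 1 <= (b * c + 1) ^ (n - 1)).
  { rewrite <- (Z.pow_1_r (b * c + 1)) at 1. apply Z.pow_le_mono_r; [nia|lia]. }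
  assert (bc0 : 0 < b * c) by (apply Z.mul_pos_pos; lia).
  assert (Z2 : c * (b * c + 1) <= z).
  { eapply Z.le_trans; [|exact Z1]. apply Z.mul_le_mono_nonneg; lia. }
  assert (Z3 : (c * (b * c + 1)) * (c * (b * c + 1)) <= z * z) by (apply Z.mul_le_mono_nonneg; nia).
  clear - Z3 Hd bc0 Hc5. apply (Z.mul_le_mono_pos_l _ _ c); [lia|].
  replace (c * (4 * d)) with (4 * (z * z) - 16) by lia.
  assert (0 <= b * c * (c * c)) by (repeat apply Z.mul_nonneg_nonneg; lia).
  assert (0 <= (b * c) * (b * c) * (c * c)) by (repeat apply Z.mul_nonneg_nonneg; lia).
  assert (5 * 5 <= c * c) by (apply Z.mul_le_mono_nonneg; lia).
  replace (c * (b ^ 2 * c ^ 3)) with ((b * c) * (b * c) * (c * c)) by ring. lia.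
Qed.

Lemma gap_one_step_2b_minus : n = 1 -> p = - t -> e1 = b -> q = c - t -> yq = t - b -> b ^ 2 * c ^ 3 <= 4 * d.
Proof.
  intros Hn P1 P2 P3 P4. destruct (meet_2b_minus P1 P2 P3 P4) as [_ Yb].
  pose proof (meet_1' H Hn) as Z1. pose proof (meet_d H) as Hd. pose proof pair_ge4 as B.
  subst q. rewrite Yb in Z1.
  assert (T : 2 * t <= c) by (clear - Ht Ht0 Hbig B; nia).
  assert (BT : b * (2 * t) <= b * c) by (apply Z.mul_le_mono_nonneg_l; lia).
  assert (CB : c * (b * (2 * t)) <= c * (b * c)) by (apply Z.mul_le_mono_nonneg_l; lia).
  assert (bc0 : 0 < b * c) by (apply Z.mul_pos_pos; lia).
  assert (Z2 : c * (b * c + 1) <= 2 * z) by lia.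
  assert (Z3 : (c * (b * c + 1)) * (c * (b * c + 1)) <= (2 * z) * (2 * z)) by (apply Z.mul_le_mono_nonneg; nia).
  clear - Z3 Hd bc0 Hc5 B. apply (Z.mul_le_mono_pos_l _ _ c); [lia|].
  replace (c * (4 * d)) with (4 * (z * z) - 16) by lia.
  assert (4 * 1 <= b * c * (c * c)) by (apply Z.mul_le_mono_nonneg; nia).
  assert (0 <= (b * c) * (b * c) * (c * c)) by (repeat apply Z.mul_nonneg_nonneg; lia).
  assert (5 * 5 <= c * c) by (apply Z.mul_le_mono_nonneg; lia).
  replace (c * (b ^ 2 * c ^ 3)) with ((b * c) * (b * c) * (c * c)) by ring. lia.
Qed.

Lemma gap_first_step : n = 1 -> (p + c * ya) * (a * c + 1) ^ (m - 1) <= q + c * yb.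
Proof. intros Hn. rewrite <- (meet_1' H Hn). exact (meet_zV H). Qed.

Lemma ac1_pow_ge1 i : 0 <= i -> 1 <= (a * c + 1) ^ i.
Proof.
  intros Hi. assert (0 < a * c) by (apply Z.mul_pos_pos; lia).
  assert (0 < (a * c + 1) ^ i) by (apply Z.pow_pos_nonneg; lia). lia.
Qed.

Lemma gap_one_step_diag : n = 1 -> p = q -> e1 = e2 -> regular a b c d.
Proof.
  intros Hn E1 E2. pose proof (gap_first_step Hn) as L. pose proof (aW1_le E1 E2) as A.
  pose proof (meet_V1 H) as V. pose proof (meet_m H) as Hm.
  apply meet_regular; auto.
  destruct (Z_lt_le_dec m 2) as [G|G]; [lia|exfalso].
  assert (B : a * c + 1 <= (a * c + 1) ^ (m - 1)).
  { rewrite <- (Z.pow_1_r (a * c + 1)) at 1. apply ac1_pow_le; lia. }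
  assert (L2 : a * ((p + c * ya) * (a * c + 1)) <= 2 * b * (p + c * ya)).
  { eapply Z.le_trans; [|exact A]. apply Z.mul_le_mono_nonneg_l; [lia|].
    eapply Z.le_trans; [|exact L]. apply Z.mul_le_mono_nonneg_l; lia. }
  assert (L3 : a * (a * c + 1) <= 2 * b).
  { apply (Z.mul_le_mono_pos_r _ _ (p + c * ya)); lia. }
  clear - L3 Hab Hbig. assert (1 * c <= a * a * c) by (apply Z.mul_le_mono_nonneg_r; nia). lia.
Qed.

Lemma gap_one_step_2a_plus : n = 1 -> p = s - c -> xp = s - a -> q = s -> e2 = a -> False.
Proof.
  intros Hn P1 P2 P3 P4. destruct (meet_2a_plus P1 P2 P3 P4) as [Ya Yb].
  pose proof (gap_first_step Hn) as L. pose proof (meet_m H) as Hm. pose proof (W1_le _ _ _ _ _ Hab Hbc Hc5 Hs0 Ht0 Hs Ht _ _ _ _ _ _ _ _ _ _ _ _ H) as W.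
  pose proof tr_gt as G. pose proof tr_sq as E. pose proof pair_ge4 as B4.
  pose proof (meet_V1 H) as V. pose proof (meet_1' H Hn) as Zn.
  destruct (Z_lt_le_dec m 3) as [M3|M3].
  - assert (M : m = 1 \/ m = 2) by lia. destruct M as [M|M].
    + pose proof (meet_1 H M) as Zm. subst p q ya. clear - Zm Zn Yb G Hc5 B4 Hs0 Hab.
      assert (yb = 1) by (apply (Z.mul_reg_l _ _ c); lia). nia.
    + pose proof (meet_2 H M) as Zm. subst p q ya.
      (* Two steps for [a] against one for [b]: the common [z] fixes [yb] and then [t r], which is
         too large for [tr_sq] if [s > b - a] and too small for [tr_gt] otherwise. *)
      assert (Y : yb = 3 + a * (s + c)).
      { apply (Z.mul_reg_l _ _ c); [lia|]. clear - Zm Zn. lia. }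
      subst yb.
      assert (T : t * r = s * (2 * a - b) + 2 * s ^ 2 - 2) by (clear - Yb Hs; lia).
      destruct (Z_lt_le_dec (b - a) s) as [S|S].
      * assert (R : b * s + 2 * s - 2 <= t * r).
        { rewrite T. assert (s * (b - a + 1) <= s * s) by (apply Z.mul_le_mono_nonneg_l; lia). lia. }
        assert (0 <= b * s) by (apply Z.mul_nonneg_nonneg; lia).
        assert (R2 : (b * s + 2 * s - 2) ^ 2 <= (t * r) ^ 2) by (apply Z.pow_le_mono_l; lia).
        rewrite E in R2. clear - R2 Hs Hab Hbig B4 Hs0.
        replace ((b * s + 2 * s - 2) ^ 2) with ((b * s) ^ 2 + 4 * b * s ^ 2 - 4 * b * s + 4 * (s - 1) ^ 2) in R2 by ring.
        rewrite Hs in R2.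
        assert (R3 : b * (a * c + 4) - b * s + (s - 1) ^ 2 <= b * (a + c - b) + 4) by lia.
        clear R2. assert (Q : 0 <= (2 * s - (b + 2)) ^ 2) by (apply Z.pow_even_nonneg; exists 1; lia).
        replace ((s - 1) ^ 2) with (s ^ 2 - 2 * s + 1) in R3 by ring.
        replace ((2 * s - (b + 2)) ^ 2) with (4 * s ^ 2 - 4 * (b * s) - 8 * s + (b + 2) ^ 2) in Q by ring.
        assert (4 * b <= b * b) by (apply Z.mul_le_mono_nonneg_r; lia).
        destruct (Z_lt_le_dec a 2) as [A|A].
        -- assert (a = 1) by lia. subst a. lia.
        -- assert (1 * (b * (4 * b)) <= (a - 1) * (b * c)).
           { apply Z.mul_le_mono_nonneg; try lia. apply Z.mul_le_mono_nonneg_l; lia. }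
           assert (a * b <= b * b) by (apply Z.mul_le_mono_nonneg_r; lia). lia.
      * assert (s * s <= s * (b - a)) by (apply Z.mul_le_mono_nonneg_l; lia). lia.
  - assert (B : (a * c + 1) ^ 2 <= (a * c + 1) ^ (m - 1)) by (apply ac1_pow_le; lia).
    assert (L2 : c * (a * c + 1) ^ 2 <= c * (b * c + 3)).
    { eapply Z.le_trans; [|exact W]. eapply Z.le_trans; [|exact L].
      apply Z.mul_le_mono_nonneg; [lia|exact V|apply Z.pow_even_nonneg; now exists 1|exact B]. }
    apply Z.mul_le_mono_pos_l in L2; [|lia].
    clear - L2 Hab Hbig B4.
    assert (1 * c <= a * c) by (apply Z.mul_le_mono_nonneg_r; lia).
    assert (c * c <= (a * c) * (a * c)) by (apply Z.mul_le_mono_nonneg; lia).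
    assert (4 * b * c <= c * c) by (apply Z.mul_le_mono_nonneg_r; lia). lia.
Qed.

Lemma gap_one_step_2a_minus : n = 1 -> p = c - s -> xp = s - a -> q = - s -> e2 = a -> False.
Proof.
  intros Hn P1 P2 P3 P4. destruct (meet_2a_minus P1 P2 P3 P4) as [Ya Yb].
  pose proof (gap_first_step Hn) as L. pose proof (meet_m H) as Hm.
  pose proof tr_sub_le as G. pose proof pair_ge4 as B4. pose proof (meet_V1 H) as V.
  pose proof (ac1_pow_ge1 (m - 1) ltac:(lia)) as B.
  assert (L2 : p + c * ya <= q + c * yb).
  { eapply Z.le_trans; [|exact L].
    rewrite <- (Z.mul_1_r (p + c * ya)) at 1. apply Z.mul_le_mono_nonneg_l; lia. }
  subst p q ya. rewrite <- Yb in G.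
  assert (Y : s * yb <= c) by (clear - G; lia).
  assert (L3 : c * (a * c + 3 - a * s) <= c * yb) by lia.
  apply Z.mul_le_mono_pos_l in L3; [|lia].
  assert (SA : 2 * a <= s) by (clear - Hs Hab Hbig Hs0; nia).
  assert (L4 : s * (a * c + 3 - a * s) <= c) by (eapply Z.le_trans; [|exact Y]; apply Z.mul_le_mono_nonneg_l; lia).
  clear - L4 SA Hs Hab Hbig B4 Hs0.
  assert (s * (2 * a) <= s * s) by (apply Z.mul_le_mono_nonneg_l; lia).
  assert (s * (a * c + 2) <= 2 * c).
  { assert (s * (a * c + 2) <= s * (2 * (a * c + 3 - a * s))); [|lia].
    apply Z.mul_le_mono_nonneg_l; [lia|]. lia. }
  assert (1 * c <= a * c) by (apply Z.mul_le_mono_nonneg_r; lia).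
  assert (4 <= s) by nia.
  assert (4 * (a * c + 2) <= s * (a * c + 2)) by (apply Z.mul_le_mono_nonneg_r; lia). lia.
Qed.

Lemma gap_one_step_2b_plus : n = 1 -> p = t -> e1 = b -> q = t - c -> yq = t - b -> False.
Proof.
  intros Hn P1 P2 P3 P4. destruct (meet_2b_plus P1 P2 P3 P4) as [Ya Yb].
  pose proof (gap_first_step Hn) as L. pose proof (meet_m H) as Hm.
  pose proof (meet_V1 H) as V. pose proof sr_gt as G.
  pose proof (ac1_pow_ge1 (m - 1) ltac:(lia)) as B.
  assert (L2 : p + c * ya <= q + c * yb).
  { eapply Z.le_trans; [|exact L].
    rewrite <- (Z.mul_1_r (p + c * ya)) at 1. apply Z.mul_le_mono_nonneg_l; lia. }
  subst p q yb. assert (ya <= 1) by (apply (Z.mul_le_mono_pos_l _ _ c); lia).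
  clear - H0 Ya G Hab Hbig Ht Ht0. assert (0 < a * t) by (apply Z.mul_pos_pos; lia).
  assert (c < t * t) by nia. assert (4 < t) by nia.
  assert (1 * t <= a * t) by (apply Z.mul_le_mono_nonneg_r; lia). lia.
Qed.

(** With a single step for [b], a starting configuration makes [d] regular, is impossible, or, in
    [gap_one_step_2b_minus], starts so high that the bound holds all the same. *)
Lemma gap : ~ regular a b c d -> b ^ 2 * c ^ 3 <= 4 * d.
Proof.
  intros Hreg. destruct (Z_lt_le_dec n 2) as [G|G]; [|exact (gap_two_steps G)].
  pose proof (meet_n H) as N1. assert (N : n = 1) by lia.
  destruct meet_classify as [[E1 E2]|(eps & [-> | ->] & [(E1 & E2 & E3 & E4)|(E1 & E2 & E3 & E4)])].
  - now elim Hreg; apply gap_one_step_diag.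
  - exfalso. apply gap_one_step_2a_plus; auto; lia.
  - exfalso. apply gap_one_step_2b_plus; auto; lia.
  - exfalso. apply gap_one_step_2a_minus; auto; lia.
  - apply gap_one_step_2b_minus; auto; lia.
Qed.
End Gap.

(** * Chains that meet too early *)

(** [(1 + u / n)^(2 n) <= 3^(2 u)]: a comparison of quadratic expressions becomes one of [n]-th
    powers. *)
Lemma pow_ratio a b n u : 0 < a -> 0 <= b -> 0 < n -> 0 <= u -> b * n ^ 2 <= a * (n + u) ^ 2 -> b ^ n <= a ^ n * 3 ^ (2 * u).
Proof.
  intros Ha Hb Hn Hu L.
  assert (N : 0 < n ^ n) by (apply Z.pow_pos_nonneg; lia).
  assert (A : 0 < a ^ n) by (apply Z.pow_pos_nonneg; lia).
  assert (L1 : (b * n ^ 2) ^ n <= (a * (n + u) ^ 2) ^ n) by (apply Z.pow_le_mono_l; nia).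
  rewrite !Z.pow_mul_l, <- !Z.pow_mul_r, (Z.mul_comm 2 n), !Z.pow_mul_r in L1 by lia.
  pose proof (pow_add_le_pow3 n u Hn Hu) as E.
  assert (E2 : ((n + u) ^ n) ^ 2 <= (3 ^ u * n ^ n) ^ 2).
  { apply Z.pow_le_mono_l. split; [apply Z.pow_nonneg; lia|exact E]. }
  apply (Z.mul_le_mono_pos_r _ _ ((n ^ n) ^ 2)); [apply Z.pow_pos_nonneg; lia|].
  eapply Z.le_trans; [exact L1|].
  rewrite (Z.mul_comm 2 u), Z.pow_mul_r by lia.
  rewrite <- Z.mul_assoc. apply Z.mul_le_mono_nonneg_l; [lia|].
  rewrite <- Z.pow_mul_l. exact E2.
Qed.

(** The congruences are quadratic in the step numbers while the growth is exponential; this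
    translates the latter into the former. Otherwise [pow_ratio] gives [w^j <= 6 * 3^(10 j)], and
    [354294 = 6 * 3^10]. *)
Lemma ratio_gap a b n j w : 0 < a -> 0 <= b -> 0 < n -> 0 < j -> 354294 < w ->
  a ^ n * w ^ j <= 6 * b ^ n -> a * (n + 5 * j) ^ 2 < b * n ^ 2.
Proof.
  intros Ha Hb Hn Hj Hw L. destruct (Z_lt_le_dec (a * (n + 5 * j) ^ 2) (b * n ^ 2)) as [G|G]; [exact G|exfalso].
  pose proof (pow_ratio a b n (5 * j) Ha Hb Hn ltac:(lia) G) as P.
  assert (A : 0 < a ^ n) by (apply Z.pow_pos_nonneg; lia).
  assert (W : w ^ j <= 6 * 3 ^ (2 * (5 * j))).
  { apply (Z.mul_le_mono_pos_l _ _ (a ^ n) A). lia. }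
  replace (2 * (5 * j)) with (10 * j) in W by lia. rewrite Z.pow_mul_r in W by lia.
  change (3 ^ 10) with 59049 in W.
  assert (S : 6 <= 6 ^ j) by (rewrite <- (Z.pow_1_r 6) at 1; apply Z.pow_le_mono_r; lia).
  assert (K : 0 < 59049 ^ j) by (apply Z.pow_pos_nonneg; lia).
  assert (W2 : 354294 ^ j < w ^ j) by (apply Z.pow_lt_mono_l; lia).
  change 354294 with (6 * 59049) in W2. rewrite Z.pow_mul_l in W2.
  assert (6 * 59049 ^ j <= 6 ^ j * 59049 ^ j) by (apply Z.mul_le_mono_nonneg_r; lia). lia.
Qed.

(** A variant that also covers [j = 0]: the extra factor [s] pays for two more steps, with
    [486 = 6 * 3^4]. *)
Lemma ratio_gap_strong a b n j w s : 0 < a -> 0 <= b -> 0 < n -> 0 <= j -> 9 <= w -> 486 < s ->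
  a ^ n * w ^ j * s <= 6 * b ^ n -> a * (n + (j + 2)) ^ 2 < b * n ^ 2.
Proof.
  intros Ha Hb Hn Hj Hw Hs L. destruct (Z_lt_le_dec (a * (n + (j + 2)) ^ 2) (b * n ^ 2)) as [G|G]; [exact G|exfalso].
  pose proof (pow_ratio a b n (j + 2) Ha Hb Hn ltac:(lia) G) as P.
  assert (A : 0 < a ^ n) by (apply Z.pow_pos_nonneg; lia).
  assert (W : w ^ j * s <= 6 * 3 ^ (2 * (j + 2))).
  { apply (Z.mul_le_mono_pos_l _ _ (a ^ n) A). lia. }
  rewrite Z.pow_mul_r, Z.pow_add_r in W by lia. change (3 ^ 2) with 9 in W. change (9 ^ 2) with 81 in W.
  assert (K : 0 < 9 ^ j) by (apply Z.pow_pos_nonneg; lia).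
  assert (W2 : 9 ^ j <= w ^ j) by (apply Z.pow_le_mono_l; lia).
  assert (9 ^ j * s <= w ^ j * s) by (apply Z.mul_le_mono_nonneg_r; lia).
  assert (9 ^ j * 486 < 9 ^ j * s) by (apply Z.mul_lt_mono_pos_l; lia). lia.
Qed.

Lemma dvd_small c x : 0 < c -> (c | x) -> - c < x < c -> x = 0.
Proof. intros Hc [k ->] L. assert (k = 0) by nia. subst k. lia. Qed.

Lemma no_sq_add4 u x : 0 < u -> 0 < x -> x ^ 2 <> u * u + 4.
Proof.
  intros Hu Hx E. assert (u < x) by nia.
  assert (x = u + 1 \/ u + 2 <= x) as [-> | L] by lia; [lia|nia].
Qed.

(** [a (a + 2) + 4 = (a + 1)^2 + 3] is no square, and [a (a + 1) + 4] is one only for [a = 3]. *)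
Lemma pair_gap a b r : 0 < a < b -> 0 < r -> r ^ 2 = a * b + 4 -> a + 3 <= b \/ (a = 3 /\ b = 4).
Proof.
  intros Hab Hr E. destruct (Z_lt_le_dec b (a + 3)) as [L|L]; [right|left; exact L].
  assert (B : b = a + 1 \/ b = a + 2) by lia. destruct B as [-> | ->].
  - assert (a < r) by nia. assert (R : r = a + 1 \/ a + 2 <= r) by lia. destruct R as [-> | R]; [lia|nia].
  - exfalso. assert (a + 1 < r) by nia. assert (a + 2 <= r) by lia. nia.
Qed.

(** * Size of the smaller regular extension *)

Section FBounds.
Variables a c e f : Z.
Hypotheses (Ha : 0 < a) (He : 0 < e) (Hace : a + e < c).
Hypothesis Hf : f * (a * c * e + 2 * (a + c + e) - f) = (c - a - e) ^ 2 - 4 * (a * e + 4).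
Hypothesis Hf2 : 2 * f <= a * c * e + 2 * (a + c + e).

(** With [u = c - a - e], the two roots have a product below [u^2], and for [f <= u] the larger one
    is at least [(a e + 1) u]. Together with [f_lower] this places [f] near [c / (a e)]. *)
Lemma f_upper : f * (a * e + 1) <= c - a - e.
Proof.
  destruct (Z_lt_le_dec (c - a - e) (f * (a * e + 1))) as [L|L]; [exfalso|exact L].
  set (u := c - a - e) in *. assert (u0 : 0 < u) by (unfold u; lia).
  assert (k0 : 0 < a * e) by (apply Z.mul_pos_pos; lia).
  assert (f0 : 0 < f) by (clear - L u0 k0; nia).
  assert (S : a * c * e + 2 * (a + c + e) - f - (a * e + 1) * u - u - (a * e + 4) * (a + e) + f = 0) by (unfold u; ring).
  set (G := a * c * e + 2 * (a + c + e) - f) in *.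
  assert (0 <= (a * e + 4) * (a + e)) by (apply Z.mul_nonneg_nonneg; lia).
  destruct (Z_lt_le_dec u f) as [M|M].
  - assert (f * f <= f * G) by (apply Z.mul_le_mono_nonneg_l; lia).
    assert (u * u <= f * f) by (apply Z.mul_le_mono_nonneg; lia). clear - Hf H0 H1 k0. lia.
  - assert (f * ((a * e + 1) * u) <= f * G) by (apply Z.mul_le_mono_nonneg_l; lia).
    assert (u * u <= u * (f * (a * e + 1))) by (apply Z.mul_le_mono_nonneg_l; lia). clear - Hf H0 H1 k0. lia.
Qed.

Lemma f_lower : 6 <= c -> 0 <= f -> c - 2 * a - 2 * e - 4 <= f * (a * e + 2).
Proof.
  intros Hc f0. pose proof f_upper as U.
  destruct (Z_lt_le_dec (f * (a * e + 2)) (c - 2 * a - 2 * e - 4)) as [L|L]; [exfalso|exact L].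
  assert (k0 : 0 <= (a - 1) * (e - 1)) by (apply Z.mul_nonneg_nonneg; lia).
  assert (F : f * (a + e) <= f * (a * e + 1)) by (apply Z.mul_le_mono_nonneg_l; lia).
  assert (L2 : c * (f * (a * e + 2)) <= c * (c - 2 * a - 2 * e - 5)) by (apply Z.mul_le_mono_nonneg_l; lia).
  assert (0 <= (a - e) ^ 2) by (apply Z.pow_even_nonneg; now exists 1).
  assert (0 <= f * f) by (apply Z.mul_nonneg_nonneg; lia).
  clear - Hf F L2 H H0 Hc U Ha He. lia.
Qed.
End FBounds.

Lemma f_unique S f g : 2 * f <= S -> 2 * g < S -> f * (S - f) = g * (S - g) -> f = g.
Proof.
  intros F G E. assert (P : (f - g) * (S - f - g) = 0) by lia.
  apply Z.mul_eq_0 in P. lia.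
Qed.

(* [f] is the smaller extension of the triple [{a, c, e}]. *)
Lemma conj_exists a c e s x p : s ^ 2 = a * c + 4 -> x ^ 2 = a * e + 4 -> p ^ 2 = c * e + 4 ->
  exists f, 2 * f = a * c * e + 2 * (a + c + e) - s * x * p /\
    f * (a * c * e + 2 * (a + c + e) - f) = (c - a - e) ^ 2 - 4 * (a * e + 4).
Proof.
  intros Hs Hx Hp. destruct (even_sub_of_sq (a * c * e) (s * x * p)) as [h Hh].
  - replace (s * x * p * (s * x * p)) with (s ^ 2 * x ^ 2 * p ^ 2) by ring. rewrite Hs, Hx, Hp.
    exists (a * a * c * c * e * e + 2 * a * c * e * (a + c + e) + 8 * (a * c + a * e + c * e) + 32). ring.
  - exists (h + a + c + e). assert (E : 2 * (h + a + c + e) = a * c * e + 2 * (a + c + e) - s * x * p) by lia.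
    split; [exact E|]. set (f := h + a + c + e) in *.
    assert (Q : (2 * f) * (2 * (a * c * e + 2 * (a + c + e)) - 2 * f) = 4 * ((c - a - e) ^ 2 - 4 * (a * e + 4))); [|clear - Q; lia].
    rewrite E. transitivity ((a * c * e + 2 * (a + c + e)) ^ 2 - s ^ 2 * x ^ 2 * p ^ 2); [ring|].
    rewrite Hs, Hx, Hp. ring.
Qed.

(** For a starting extension [e > b], with [u = m + 1]. The alternative in the hypotheses is that of
    the gap principle; in its second branch third powers are compared, because
    [(b^2 e)^3 <= 4 c b^4]. *)
Lemma size_bounds b c e u v : 4 <= b -> b < e -> 2 <= u -> v = u * u -> 890 * b ^ 4 <= c ->
  29 * (b * b * b * v) < 2 * c -> b * b * b * (v * v) < 4 * c -> (e <= 4 * b \/ b ^ 2 * e ^ 3 <= 4 * c) ->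
  20 * (u * (b * b * e)) <= c /\ 2 * (b * b * e * v) < c /\ 4 * (b * (e * e)) <= c.
Proof.
  intros Hb He Hu Hv Hc H1 H2 H3.
  assert (b2 : 16 <= b * b) by (clear - Hb; nia).
  assert (b3 : 0 < b * b * b) by (clear - Hb b2; apply Z.mul_pos_pos; lia).
  assert (b4 : b * b * b * 4 <= b ^ 4).
  { replace (b ^ 4) with (b * b * b * b) by ring. apply Z.mul_le_mono_nonneg_l; lia. }
  assert (b42 : 16 * (b * b) <= b ^ 4).
  { replace (b ^ 4) with (b * b * (b * b)) by ring. apply Z.mul_le_mono_nonneg_r; lia. }
  assert (u4 : 2 * u <= v) by (clear - Hu Hv; nia).
  destruct H3 as [H3|H3].
  - assert (E1 : b * b * e <= b * b * (4 * b)) by (clear - H3 b2; apply Z.mul_le_mono_nonneg_l; lia).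
    assert (e2 : e * e <= (4 * b) * (4 * b)) by (clear - He Hb H3; apply Z.mul_le_mono_nonneg; lia).
    assert (E2 : b * (e * e) <= b * (16 * (b * b))) by (clear - Hb e2; apply Z.mul_le_mono_nonneg_l; lia).
    split; [|split].
    + assert (E3 : u * (b * b * e) <= u * (4 * (b * b * b))) by (clear - Hu E1; apply Z.mul_le_mono_nonneg_l; lia).
      destruct (Z_lt_le_dec u 45) as [U|U].
      * assert (u * (4 * (b * b * b)) <= 44 * (4 * (b * b * b))) by (clear - U b3; apply Z.mul_le_mono_nonneg_r; lia). lia.
      * assert (45 * u <= v) by (clear - Hv U; nia).
        assert (b * b * b * (45 * u) <= b * b * b * v) by (clear - H b3; apply Z.mul_le_mono_nonneg_l; lia). lia.
    + assert (b * b * e * v <= 4 * (b * b * b) * v) by (clear - E1 u4 Hu; apply Z.mul_le_mono_nonneg_r; lia). lia.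
    + lia.
  - assert (c0 : 0 < c) by (clear - Hc b42 b2; lia).
    set (g := b * b * e). assert (g0 : 0 < g) by (unfold g; apply Z.mul_pos_pos; lia).
    assert (G3 : g ^ 3 <= 4 * c * b ^ 4).
    { unfold g. replace ((b * b * e) ^ 3) with (b ^ 2 * e ^ 3 * b ^ 4) by ring. apply Z.mul_le_mono_nonneg_r; lia. }
    assert (A : 2 * (g * v) < c).
    { destruct (Z_lt_le_dec (2 * (g * v)) c) as [L|L]; [exact L|exfalso].
      assert (L3 : c ^ 3 <= (2 * (g * v)) ^ 3) by (apply Z.pow_le_mono_l; lia).
      replace ((2 * (g * v)) ^ 3) with (8 * v ^ 3 * g ^ 3) in L3 by ring.
      assert (v3 : 0 < v ^ 3) by (apply Z.pow_pos_nonneg; lia).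
      assert (L4 : 8 * v ^ 3 * g ^ 3 <= 8 * v ^ 3 * (4 * c * b ^ 4)) by (apply Z.mul_le_mono_nonneg_l; lia).
      assert (L5 : c ^ 2 <= 32 * v ^ 3 * b ^ 4).
      { apply (Z.mul_le_mono_pos_l _ _ c c0). replace (c * c ^ 2) with (c ^ 3) by ring. clear - L3 L4. lia. }
      assert (L6 : (c ^ 2) ^ 2 <= (32 * v ^ 3 * b ^ 4) ^ 2) by (apply Z.pow_le_mono_l; split; [apply Z.pow_nonneg; lia|exact L5]).
      assert (L7 : (b * b * b * (v * v)) ^ 3 <= (4 * c) ^ 3).
      { apply Z.pow_le_mono_l. split; [|apply Z.lt_le_incl, H2].
        apply Z.mul_nonneg_nonneg; [apply Z.lt_le_incl, b3|apply Z.square_nonneg]. }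
      clear - L6 L7 c0 Hb Hc b42.
      assert (c3 : 0 < c ^ 3) by (apply Z.pow_pos_nonneg; clear - c0; lia).
      (* Eliminating [v] from the two bounds leaves [b c <= 65536], too small for [c >= 890 b^4]. *)
      assert (L8 : b * c ^ 3 * c <= 65536 * c ^ 3).
      { replace (b * c ^ 3 * c) with (b * (c ^ 2) ^ 2) by ring. replace (65536 * c ^ 3) with (1024 * (4 * c) ^ 3) by ring.
        eapply Z.le_trans; [apply Z.mul_le_mono_nonneg_l; [clear - Hb; lia|exact L6]|].
        replace (b * (32 * v ^ 3 * b ^ 4) ^ 2) with (1024 * (b * b * b * (v * v)) ^ 3) by ring.
        apply Z.mul_le_mono_nonneg_l; [discriminate|exact L7]. }
      replace (b * c ^ 3 * c) with (b * c * c ^ 3) in L8 by ring. apply Z.mul_le_mono_pos_r in L8; [|exact c3].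
      assert (b16 : 16 <= b * b) by (clear - Hb; nia).
      assert (4 * c <= b * c) by (apply Z.mul_le_mono_nonneg_r; clear - Hb c0; lia).
      clear - Hc b42 b16 L8 H. lia. }
    split; [|split; [exact A|]].
    + destruct (Z_lt_le_dec u 10) as [U|U].
      * destruct (Z_le_gt_dec (20 * (u * g)) c) as [L|L]; [exact L|exfalso].
        assert (L1 : c <= 180 * g).
        { assert (u * g <= 9 * g) by (apply Z.mul_le_mono_nonneg_r; lia). lia. }
        assert (L3 : c ^ 3 <= (180 * g) ^ 3) by (apply Z.pow_le_mono_l; lia).
        replace ((180 * g) ^ 3) with (5832000 * g ^ 3) in L3 by ring.
        assert (L5 : c ^ 2 <= 23328000 * b ^ 4).
        { apply (Z.mul_le_mono_pos_l _ _ c c0). replace (c * c ^ 2) with (c ^ 3) by ring. clear - L3 G3. lia. }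
        assert (L6 : (14240 * (b * b)) ^ 2 <= c ^ 2) by (apply Z.pow_le_mono_l; lia).
        replace ((14240 * (b * b)) ^ 2) with (202777600 * b ^ 4) in L6 by ring. lia.
      * assert (10 * u <= v) by (clear - Hv U; nia).
        assert (g * (10 * u) <= g * v) by (apply Z.mul_le_mono_nonneg_l; lia). lia.
    + assert (E : 16 * (b * (e * e)) <= (b * e) * (b * (e * e))).
      { apply Z.mul_le_mono_nonneg_r; [repeat apply Z.mul_nonneg_nonneg; lia|clear - Hb He; nia]. }
      replace (b ^ 2 * e ^ 3) with (b * e * (b * (e * e))) in H3 by ring. lia.
Qed.

(* [big_alpha] turns the congruences modulo [2 c] below into equalities; the last two fields
   handle starting values [e] of moderate size. *)
Record big (a b c t m : Z) : Prop := {
  big_c : 890 * b ^ 4 <= c;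
  big_alpha : b * t * (m + 1) ^ 2 < 2 * c;
  big_ab : m <= 4 * (a * b);
  big_ext : forall e x, b < e -> x ^ 2 = a * e + 4 -> m <= a * e }.

(** * Small step numbers are impossible *)

Section Cases.
Variables a b c s t : Z.
Hypotheses (Hab : 0 < a < b) (Hbc : b < c) (Hc5 : 5 <= c) (Hs0 : 0 < s) (Ht0 : 0 < t).
Hypotheses (Hs : s ^ 2 = a * c + 4) (Ht : t ^ 2 = b * c + 4).
Variables d z p xp ya q yq yb e1 e2 m n : Z.
Hypothesis H : meet a b c s t d z p xp ya q yq yb e1 e2 m n.
Variable r : Z.
Hypotheses (Hr0 : 0 < r) (Hr : r ^ 2 = a * b + 4).
Hypothesis HB : big a b c t m.

Lemma b_ge4 : 4 <= b.
Proof. eapply pair_ge4; eauto. Qed.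

Lemma s_big : 29 * b ^ 2 <= s.
Proof.
  pose proof (big_c _ _ _ _ _ HB) as B. pose proof b_ge4 as B4. apply sq_le_le; [lia|].
  replace ((29 * b ^ 2) ^ 2) with (841 * b ^ 4) by ring. rewrite Hs.
  assert (0 <= b ^ 4) by (apply Z.pow_nonneg; lia).
  assert (1 * c <= a * c) by (apply Z.mul_le_mono_nonneg_r; lia). lia.
Qed.

Lemma s_lt_t : s < t.
Proof.
  apply sq_lt_lt; [lia|]. rewrite Hs, Ht.
  assert (a * c < b * c) by (apply Z.mul_lt_mono_pos_r; lia). lia.
Qed.

Lemma r_le_b : r <= b.
Proof.
  pose proof b_ge4. apply sq_le_le; [lia|]. rewrite Hr.
  assert (a * b <= (b - 1) * b) by (apply Z.mul_le_mono_nonneg_r; lia). lia.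
Qed.

Lemma m_small_b : 29 * b ^ 3 * (m + 1) ^ 2 < 2 * c.
Proof.
  eapply Z.le_lt_trans; [|exact (big_alpha _ _ _ _ _ HB)].
  apply Z.mul_le_mono_nonneg_r; [apply Z.pow_even_nonneg; now exists 1|].
  replace (29 * b ^ 3) with (b * (29 * b ^ 2)) by ring. apply Z.mul_le_mono_nonneg_l; [lia|].
  pose proof s_big. pose proof s_lt_t. lia.
Qed.

Lemma m_small_s : b * (m + 1) ^ 2 < 2 * s.
Proof.
  apply (Z.mul_lt_mono_pos_r s); [lia|].
  apply Z.le_lt_trans with (b * t * (m + 1) ^ 2).
  - replace (b * (m + 1) ^ 2 * s) with (b * s * (m + 1) ^ 2) by ring.
    apply Z.mul_le_mono_nonneg_r; [apply Z.pow_even_nonneg; now exists 1|].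
    apply Z.mul_le_mono_nonneg_l; [lia|]. pose proof s_lt_t. lia.
  - eapply Z.lt_le_trans; [exact (big_alpha _ _ _ _ _ HB)|].
    assert (1 * c <= a * c) by (apply Z.mul_le_mono_nonneg_r; lia).
    replace (2 * s * s) with (2 * s ^ 2) by ring. rewrite Hs. lia.
Qed.

(** The threshold is that of [ratio_gap]. For [b = 4] the bound on [c] alone falls short, but
    [a = 1] is impossible there because [8] is no square. *)
Lemma ac_big : 354294 < a * c + 1.
Proof.
  pose proof (big_c _ _ _ _ _ HB) as B. pose proof b_ge4 as B4.
  destruct (Z.eq_dec b 4) as [E|E].
  - subst b. assert (2 <= a) by (destruct (Z.eq_dec a 1) as [->|]; [exfalso|lia];
      clear - Hr Hr0; assert (r < 3) by nia; assert (r = 1 \/ r = 2) as [-> | ->] by lia; lia).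
    assert (2 * c <= a * c) by (apply Z.mul_le_mono_nonneg_r; lia). lia.
  - assert (5 ^ 4 <= b ^ 4) by (apply Z.pow_le_mono_l; lia).
    assert (1 * c <= a * c) by (apply Z.mul_le_mono_nonneg_r; lia). lia.
Qed.

Lemma cases_n_le_m : n <= m.
Proof. exact (meet_n_le_m _ _ _ _ _ Hab Hbc Hc5 Hs0 Ht0 Hs _ _ _ _ _ _ _ _ _ _ _ _ H). Qed.

Lemma big_alpha_expanded : b * (t * (m * m + 2 * m + 1)) < 2 * c.
Proof. eapply Z.le_lt_trans; [|exact (big_alpha _ _ _ _ _ HB)]. apply Z.eq_le_incl. ring. Qed.

Lemma start_ratio : a ^ (n - 1) * (a * c + 1) ^ (m - n) * (p + c * ya) <= 3 * b ^ (n - 1) * (q + c * yb).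
Proof.
  apply (meet_ratio _ _ _ _ _ Hab Hbc Hc5 Hs0 Ht0 Hs Ht _ _ _ _ _ _ _ _ _ _ _ _ H).
  pose proof m_small_s as S. pose proof cases_n_le_m as L. pose proof (meet_n H). pose proof s_lt_t as T.
  assert (n <= (m + 1) ^ 2) by nia.
  assert (3 * a * n <= 3 * b * (m + 1) ^ 2) by (apply Z.mul_le_mono_nonneg; nia).
  assert (3 * b * (m + 1) ^ 2 < 6 * s) by lia.
  assert (1 * s <= a * s) by (apply Z.mul_le_mono_nonneg_r; lia).
  assert (s * s <= s * (s * 1)) by lia.
  assert (6 * s <= s * s) by (pose proof s_big; pose proof b_ge4; apply Z.mul_le_mono_nonneg_r; nia).
  assert (s * s <= a * c + 4) by lia.
  assert (4 * (a * c + 1) <= b * (a * c + 1)) by (pose proof b_ge4; pose proof ac_big; apply Z.mul_le_mono_nonneg_r; lia).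
  pose proof ac_big. lia.
Qed.

Lemma half_prod i : exists h, i * (i - 1) = 2 * h.
Proof.
  destruct (Z.Even_or_Odd i) as [[h ->]|[h ->]]; [exists (h * (2 * h - 1))|exists ((2 * h + 1) * h)]; ring.
Qed.

Lemma cong_of k : p - q = c * k ->
  (2 * c | 2 * k + (2 * m * ya + a * p * (m * (m - 1)) - 2 * n * yb - b * q * (n * (n - 1)))).
Proof.
  intros E. destruct (meet_cong H) as [u Hu]. exists u. apply (Z.mul_reg_l _ _ c); [lia|].
  rewrite E in Hu. clear - Hu. lia.
Qed.

Lemma steps_lt_s : 4 * m + 2 < s.
Proof.
  pose proof m_small_s as S. pose proof b_ge4 as B. pose proof (meet_m H) as M1.
  assert (4 * (m + 1) ^ 2 <= b * (m + 1) ^ 2) by (apply Z.mul_le_mono_nonneg_r; [apply Z.pow_even_nonneg; now exists 1|lia]).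
  clear - S M1 H0. nia.
Qed.

(* The size bounds of all the forms below reduce to [b t (m + 1)^2 < 2 c]. *)
Lemma term_le u v w i j : 0 <= u <= b -> 0 <= v <= t -> 0 <= i <= j -> w = u * v * i -> 0 <= w <= b * t * j.
Proof.
  intros Hu Hv Hi ->. split; [repeat apply Z.mul_nonneg_nonneg; lia|].
  apply Z.mul_le_mono_nonneg; [apply Z.mul_nonneg_nonneg; lia| |lia|lia].
  apply Z.mul_le_mono_nonneg; lia.
Qed.

Lemma step_products : 0 <= n * n <= m * m /\ 0 <= n * (n - 1) <= m * m /\ 0 <= m * (m - 1) <= m * m /\ n <= m /\ 1 <= n /\
  m * m + n <= (m + 1) * (m + 1) - m - 1.
Proof. pose proof cases_n_le_m. pose proof (meet_n H). nia. Qed.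

Lemma big_alpha_sum : b * t * (m * m) + 2 * (b * t * m) + b * t < 2 * c.
Proof. pose proof big_alpha_expanded. lia. Qed.

Lemma dvd_zero E F : (2 * c | F) -> (2 * c | E - F) -> - (2 * c) < E < 2 * c -> E = 0.
Proof.
  intros D1 D2 L. apply (dvd_small (2 * c)); [lia| |exact L].
  replace E with (F + (E - F)) by ring. now apply Z.divide_add_r.
Qed.

(** The equality [Z0] reads [s (b n (n + 1) - a m (m - 1)) + n (t r - b s) = 4 m - 2]. Growth makes
    the bracket positive, so the left side is at least [s], which exceeds [4 m - 2]. *)
Lemma case_2a_plus : p = s - c -> xp = s - a -> q = s -> e2 = a -> False.
Proof.
  intros P1 P2 P3 P4.
  destruct (meet_2a_plus _ _ _ _ _ Hs0 Ht0 Hs _ _ _ _ _ _ _ _ _ _ _ _ H _ Hr0 Hr P1 P2 P3 P4) as [Ya Yb].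
  pose proof (tr_gt _ _ _ _ _ Hab Hbc Hc5 Hs0 Ht0 Hs Ht _ Hr0 Hr) as G.
  pose proof (tr_sub_le _ _ _ _ _ Hab Hbc Hc5 Hs0 Ht0 Hs Ht _ Hr0 Hr) as G2.
  pose proof step_products as (N1 & N2 & N3 & N4 & N5 & N6). pose proof steps_lt_s as S1. pose proof s_lt_t as ST.
  pose proof r_le_b as RB. pose proof b_ge4 as B4. pose proof start_ratio as R. pose proof (meet_V1 H) as V.
  assert (Z0 : 4 * m - 2 + a * s * (m * (m - 1)) - b * s * (n * n) - r * t * n = 0).
  { eapply dvd_zero; [apply (cong_of (-1)); lia| |].
    - subst ya p q. destruct (half_prod m) as [h Eh].
      exists (a * h). rewrite Eh.
      replace (2 * n * yb) with (n * (2 * yb)) by ring. rewrite Yb. ring.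
    - pose proof big_alpha_sum as A2.
      pose proof (term_le a s (a * s * (m * (m - 1))) (m * (m - 1)) (m * m) ltac:(lia) ltac:(lia) N3 eq_refl) as T1.
      pose proof (term_le b s (b * s * (n * n)) (n * n) (m * m) ltac:(lia) ltac:(lia) N1 eq_refl) as T2.
      pose proof (term_le r t (r * t * n) n m ltac:(lia) ltac:(lia) ltac:(lia) eq_refl) as T3.
      assert (4 * t <= b * t) by (apply Z.mul_le_mono_nonneg_r; lia).
      assert (0 <= b * t * m) by (repeat apply Z.mul_nonneg_nonneg; lia).
      clear - A2 T1 T2 T3 H0 H1 S1 ST Hs0 Ht0 N4 N5. lia. }
  (* For [m - n <= 1] this follows from [a < b]. Otherwise [ratio_gap] applies to [m - n - 1]
     surplus steps, one step being spent on the sizes of the starting terms. *)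
  assert (K : a * (m * (m - 1)) < b * (n * (n + 1))).
  { destruct (Z_lt_le_dec (m - n) 2) as [J|J].
    - assert (m * (m - 1) <= n * (n + 1)) by (clear - J N4 N5; nia).
      assert (0 < n * (n + 1)) by (clear - N5; nia).
      apply Z.le_lt_trans with (a * (n * (n + 1))); [apply Z.mul_le_mono_nonneg_l; lia|apply Z.mul_lt_mono_pos_r; lia].
    - assert (W : q + c * yb <= 2 * (b * c * s)).
      { clear - P3 Yb G2 Hs0 Hs Hab Hc5 B4. subst q.
        assert (1 * c <= b * c) by (apply Z.mul_le_mono_nonneg_r; lia).
        assert (0 < b * c * s) by (repeat apply Z.mul_pos_pos; lia).
        assert (t * r - b * s <= 2 * c) by nia.
        assert (2 * (c * yb) = c * (b * s + t * r)) by (rewrite <- Yb; ring).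
        assert (c * (t * r - b * s) <= 2 * (c * s)).
        { apply (Z.mul_le_mono_pos_l _ _ s); [lia|].
          replace (s * (c * (t * r - b * s))) with (c * (s * (t * r - b * s))) by ring.
          replace (s * (2 * (c * s))) with (c * (2 * s ^ 2)) by ring.
          apply Z.mul_le_mono_nonneg_l; [lia|]. rewrite Hs.
          assert (1 * c <= a * c) by (apply Z.mul_le_mono_nonneg_r; lia). lia. }
        assert (4 * (c * s) <= b * (c * s)) by (apply Z.mul_le_mono_nonneg_r; [apply Z.mul_nonneg_nonneg|]; lia).
        assert (1 * s <= c * s) by (apply Z.mul_le_mono_nonneg_r; lia). lia. }
      assert (AS : a * s <= a * c + 1).
      { clear - Hs Hab Hc5 Hs0 Hbc. assert (s <= c) by nia. assert (a * s <= a * c) by (apply Z.mul_le_mono_nonneg_l; lia). lia. }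
      assert (Q : a ^ n * (a * c + 1) ^ (m - n - 1) <= 6 * b ^ n).
      { apply (Z.mul_le_mono_pos_r _ _ ((a * c + 1) * c)).
        { apply Z.mul_pos_pos; [pose proof ac_big; lia|lia]. }
        replace (a ^ n) with (a * a ^ (n - 1)) by (rewrite <- Z.pow_succ_r by lia; f_equal; lia).
        replace (b ^ n) with (b * b ^ (n - 1)) by (rewrite <- Z.pow_succ_r by lia; f_equal; lia).
        replace (m - n) with (Z.succ (m - n - 1)) in R by lia. rewrite Z.pow_succ_r in R by lia.
        assert (ap : 0 < a ^ (n - 1)) by (apply Z.pow_pos_nonneg; lia).
        assert (bp : 0 < b ^ (n - 1)) by (apply Z.pow_pos_nonneg; lia).
        pose proof ac_big as AC.
        assert (wp : 0 < (a * c + 1) ^ (m - n - 1)) by (apply Z.pow_pos_nonneg; lia).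
        set (A := a ^ (n - 1)) in *. set (B := b ^ (n - 1)) in *. set (w := (a * c + 1) ^ (m - n - 1)) in *.
        assert (L1 : A * ((a * c + 1) * w) * c <= A * ((a * c + 1) * w) * (p + c * ya)).
        { apply Z.mul_le_mono_nonneg_l; [repeat apply Z.mul_nonneg_nonneg; lia|lia]. }
        assert (L2 : 3 * B * (q + c * yb) <= 3 * B * (2 * (b * c * s))).
        { apply Z.mul_le_mono_nonneg_l; lia. }
        assert (L3 : a * (A * ((a * c + 1) * w) * c) <= a * (3 * B * (2 * (b * c * s)))).
        { apply Z.mul_le_mono_nonneg_l; lia. }
        assert (L4 : 6 * B * b * c * (a * s) <= 6 * B * b * c * (a * c + 1)).
        { apply Z.mul_le_mono_nonneg_l; [repeat apply Z.mul_nonneg_nonneg; lia|lia]. }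
        clear - L3 L4. lia. }
      pose proof (ratio_gap a b n (m - n - 1) (a * c + 1) ltac:(lia) ltac:(lia) ltac:(lia) ltac:(lia) ac_big Q) as L.
      clear - L J N5 Hab.
      assert (m * (m - 1) <= (n + 5 * (m - n - 1)) ^ 2) by nia.
      assert (a * (m * (m - 1)) <= a * (n + 5 * (m - n - 1)) ^ 2) by (apply Z.mul_le_mono_nonneg_l; lia).
      assert (0 <= b * n) by (apply Z.mul_nonneg_nonneg; lia). lia. }
  assert (0 <= n * (t * r - b * s)) by (apply Z.mul_nonneg_nonneg; lia).
  assert (s * 1 <= s * (b * (n * (n + 1)) - a * (m * (m - 1)))) by (apply Z.mul_le_mono_nonneg_l; lia).
  clear - H0 H1 Z0 S1. lia.
Qed.

(** As [case_2a_plus], with the roles of [s] and [t] exchanged: a positive multiple of [t] would be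
    at most [4 n + 2]. *)
Lemma case_2b_minus : p = - t -> e1 = b -> q = c - t -> yq = t - b -> False.
Proof.
  intros P1 P2 P3 P4.
  destruct (meet_2b_minus _ _ _ _ _ Hs0 Ht0 Ht _ _ _ _ _ _ _ _ _ _ _ _ H _ Hr0 Hr P1 P2 P3 P4) as [Ya Yb].
  pose proof (sr_gt _ _ _ _ _ Hab Hc5 Hs0 Ht0 Hs Ht _ Hr0 Hr) as G.
  pose proof step_products as (N1 & N2 & N3 & N4 & N5 & N6). pose proof steps_lt_s as S1. pose proof s_lt_t as ST.
  pose proof r_le_b as RB. pose proof b_ge4 as B4. pose proof start_ratio as R. pose proof (meet_V1 H) as V.
  pose proof (W1_le _ _ _ _ _ Hab Hbc Hc5 Hs0 Ht0 Hs Ht _ _ _ _ _ _ _ _ _ _ _ _ H) as W.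
  assert (Z0 : - 2 + r * s * m - a * t * (m * m) - 4 * n + b * t * (n * (n + 1)) = 0).
  { eapply dvd_zero; [apply (cong_of (-1)); lia| |].
    - subst yb p q. destruct (half_prod n) as [h Eh].
      exists (n * b + b * h). rewrite Eh.
      replace (2 * m * ya) with (m * (2 * ya)) by ring. rewrite Ya.
      replace (n * (n + 1)) with (n * (n - 1) + 2 * n) by ring. rewrite Eh. ring.
    - pose proof big_alpha_sum as A2.
      pose proof (term_le a t (a * t * (m * m)) (m * m) (m * m) ltac:(lia) ltac:(lia) ltac:(lia) eq_refl) as T1.
      pose proof (term_le b t (b * t * (n * n)) (n * n) (m * m) ltac:(lia) ltac:(lia) N1 eq_refl) as T2.
      pose proof (term_le b t (b * t * n) n m ltac:(lia) ltac:(lia) ltac:(lia) eq_refl) as T4.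
      pose proof (term_le r s (r * s * m) m m ltac:(lia) ltac:(lia) ltac:(lia) eq_refl) as T3.
      assert (4 * t <= b * t) by (apply Z.mul_le_mono_nonneg_r; lia).
      assert (0 <= b * t * m) by (repeat apply Z.mul_nonneg_nonneg; lia).
      clear - A2 T1 T2 T3 T4 H0 H1 S1 ST Hs0 Ht0 N4 N5. lia. }
  assert (K : a * (m * (m - 1)) < b * (n * (n + 1))).
  { destruct (Z_lt_le_dec (m - n) 2) as [J|J].
    - assert (m * (m - 1) <= n * (n + 1)) by (clear - J N4 N5; nia).
      assert (0 < n * (n + 1)) by (clear - N5; nia).
      apply Z.le_lt_trans with (a * (n * (n + 1))); [apply Z.mul_le_mono_nonneg_l; lia|apply Z.mul_lt_mono_pos_r; lia].
    - assert (Q : a ^ n * (a * c + 1) ^ (m - n - 1) <= 6 * b ^ n).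
      { apply (Z.mul_le_mono_pos_r _ _ ((a * c + 1) * c)).
        { apply Z.mul_pos_pos; [pose proof ac_big; lia|lia]. }
        replace (a ^ n) with (a * a ^ (n - 1)) by (rewrite <- Z.pow_succ_r by lia; f_equal; lia).
        replace (b ^ n) with (b * b ^ (n - 1)) by (rewrite <- Z.pow_succ_r by lia; f_equal; lia).
        replace (m - n) with (Z.succ (m - n - 1)) in R by lia. rewrite Z.pow_succ_r in R by lia.
        assert (ap : 0 < a ^ (n - 1)) by (apply Z.pow_pos_nonneg; lia).
        assert (bp : 0 < b ^ (n - 1)) by (apply Z.pow_pos_nonneg; lia).
        pose proof ac_big as AC.
        assert (wp : 0 < (a * c + 1) ^ (m - n - 1)) by (apply Z.pow_pos_nonneg; lia).
        set (A := a ^ (n - 1)) in *. set (B := b ^ (n - 1)) in *. set (w := (a * c + 1) ^ (m - n - 1)) in *.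
        assert (L1 : A * ((a * c + 1) * w) * c <= A * ((a * c + 1) * w) * (p + c * ya)).
        { apply Z.mul_le_mono_nonneg_l; [repeat apply Z.mul_nonneg_nonneg; lia|lia]. }
        assert (L2 : 3 * B * (q + c * yb) <= 3 * B * (c * (b * c + 3))).
        { apply Z.mul_le_mono_nonneg_l; lia. }
        assert (L3 : a * (A * ((a * c + 1) * w) * c) <= a * (3 * B * (c * (b * c + 3)))).
        { apply Z.mul_le_mono_nonneg_l; lia. }
        assert (L4 : 3 * B * c * (a * (b * c + 3)) <= 3 * B * c * (2 * b * (a * c + 1))).
        { apply Z.mul_le_mono_nonneg_l; [repeat apply Z.mul_nonneg_nonneg; lia|].
          assert (b * 3 <= b * (a * c)) by (apply Z.mul_le_mono_nonneg_l; lia). lia. }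
        clear - L3 L4. lia. }
      pose proof (ratio_gap a b n (m - n - 1) (a * c + 1) ltac:(lia) ltac:(lia) ltac:(lia) ltac:(lia) ac_big Q) as L.
      clear - L J N5 Hab.
      assert (m * (m - 1) <= (n + 5 * (m - n - 1)) ^ 2) by nia.
      assert (a * (m * (m - 1)) <= a * (n + 5 * (m - n - 1)) ^ 2) by (apply Z.mul_le_mono_nonneg_l; lia).
      assert (0 <= b * n) by (apply Z.mul_nonneg_nonneg; lia). lia. }
  assert (0 <= m * (s * r - a * t)) by (apply Z.mul_nonneg_nonneg; lia).
  assert (t * 1 <= t * (b * (n * (n + 1)) - a * (m * (m - 1)))) by (apply Z.mul_le_mono_nonneg_l; lia).
  clear - H0 H1 Z0 S1 ST N4. lia.
Qed.

Lemma b_small : 4 * b + 16 <= c.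
Proof.
  pose proof (big_c _ _ _ _ _ HB) as BC. pose proof b_ge4 as B4. clear - BC B4.
  assert (b * 64 <= b * b ^ 3).
  { apply Z.mul_le_mono_nonneg_l; [lia|]. change 64 with (4 ^ 3). apply Z.pow_le_mono_l; lia. }
  replace (b ^ 4) with (b * b ^ 3) in BC by ring. lia.
Qed.

Lemma s_small : 2 * s <= c.
Proof.
  pose proof b_small as B. apply sq_le_le; [lia|]. replace ((2 * s) ^ 2) with (4 * s ^ 2) by ring. rewrite Hs.
  assert ((4 * b + 16) * c <= c * c) by (apply Z.mul_le_mono_nonneg_r; lia).
  assert (a * c <= b * c) by (apply Z.mul_le_mono_nonneg_r; lia). lia.
Qed.

(** In the two remaining cases a positive bracket is not enough, it must reach [2 n]. The first term
    of the chain for [a] is larger by a factor of order [u], which [ratio_gap_strong] turns into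
    this surplus. *)
Lemma start_gap u : s <= u -> a ^ n * (a * c + 1) ^ (m - n) * u <= 6 * b ^ (n - 1) ->
  a * (m * (m + 1)) + 2 * n <= b * (n * (n - 1)).
Proof.
  intros Hu Q. pose proof step_products as (N1 & N2 & N3 & N4 & N5 & N6). pose proof s_big as SB. pose proof b_ge4 as B4.
  pose proof ac_big as AC.
  assert (U : 29 * (4 * 4) <= 29 * b ^ 2) by (clear - B4; nia).
  assert (ap : 0 < a ^ n) by (apply Z.pow_pos_nonneg; lia).
  assert (wp : 0 < (a * c + 1) ^ (m - n)) by (apply Z.pow_pos_nonneg; lia).
  assert (w1 : 1 * 1 <= a ^ n * (a * c + 1) ^ (m - n)) by (apply Z.mul_le_mono_nonneg; lia).
  destruct (Z_lt_le_dec n 2) as [J|J].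
  - exfalso. assert (E : n = 1) by lia. rewrite E, Z.sub_diag, Z.pow_0_r in Q. rewrite E in w1, wp, ap.
    assert (1 * 1 * u <= a ^ 1 * (a * c + 1) ^ (m - 1) * u) by (apply Z.mul_le_mono_nonneg_r; lia). lia.
  - assert (SB2 : 486 < u).
    { clear - AC Hs Hu Hs0. nia. }
    assert (L : a * ((n - 1) + ((m - n) + 2)) ^ 2 < b * (n - 1) ^ 2).
    { apply (ratio_gap_strong a b (n - 1) (m - n) (a * c + 1) u); try lia.
      eapply Z.le_trans; [|exact Q].
      apply Z.mul_le_mono_nonneg_r; [lia|]. apply Z.mul_le_mono_nonneg_r; [lia|].
      apply Z.pow_le_mono_r; lia. }
    replace (n - 1 + (m - n + 2)) with (m + 1) in L by lia.
    clear - L J B4 Hab N4.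
    assert (0 <= a * m) by (apply Z.mul_nonneg_nonneg; lia).
    assert (4 * (n - 1) <= b * (n - 1)) by (apply Z.mul_le_mono_nonneg_r; lia). lia.
Qed.

(** [Z0] balances [s (b n (n - 1) - a m (m + 1))] against [n (t r - b s)], which is at most
    [2 c n / s]. As the bracket is at least [2 n], this gives [s^2 < c], contrary to
    [s^2 = a c + 4]. *)
Lemma case_2a_minus : p = c - s -> xp = s - a -> q = - s -> e2 = a -> False.
Proof.
  intros P1 P2 P3 P4.
  destruct (meet_2a_minus _ _ _ _ _ Hs0 Ht0 Hs _ _ _ _ _ _ _ _ _ _ _ _ H _ Hr0 Hr P1 P2 P3 P4) as [Ya Yb].
  pose proof (tr_gt _ _ _ _ _ Hab Hbc Hc5 Hs0 Ht0 Hs Ht _ Hr0 Hr) as G.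
  pose proof (tr_sub_le _ _ _ _ _ Hab Hbc Hc5 Hs0 Ht0 Hs Ht _ Hr0 Hr) as G2.
  pose proof step_products as (N1 & N2 & N3 & N4 & N5 & N6). pose proof steps_lt_s as S1. pose proof s_lt_t as ST.
  pose proof r_le_b as RB. pose proof b_ge4 as B4. pose proof start_ratio as R. pose proof (meet_V1 H) as V.
  assert (Z0 : 2 + 4 * m - a * s * (m * (m + 1)) - r * t * n + b * s * (n * n) = 0).
  { eapply dvd_zero; [apply (cong_of 1); lia| |].
    - subst ya p q. destruct (half_prod m) as [h Eh].
      exists (- (m * a) - a * h). rewrite Eh.
      replace (2 * n * yb) with (n * (2 * yb)) by ring. rewrite Yb.
      replace (m * (m + 1)) with (m * (m - 1) + 2 * m) by ring. rewrite Eh. ring.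
    - pose proof big_alpha_sum as A2.
      pose proof (term_le a s (a * s * (m * m)) (m * m) (m * m) ltac:(lia) ltac:(lia) ltac:(lia) eq_refl) as T1.
      pose proof (term_le a s (a * s * m) m m ltac:(lia) ltac:(lia) ltac:(lia) eq_refl) as T4.
      pose proof (term_le b s (b * s * (n * n)) (n * n) (m * m) ltac:(lia) ltac:(lia) N1 eq_refl) as T2.
      pose proof (term_le r t (r * t * n) n m ltac:(lia) ltac:(lia) ltac:(lia) eq_refl) as T3.
      assert (4 * t <= b * t) by (apply Z.mul_le_mono_nonneg_r; lia).
      assert (0 <= b * t * m) by (repeat apply Z.mul_nonneg_nonneg; lia).
      clear - A2 T1 T2 T3 T4 H0 H1 S1 ST Hs0 Ht0 N4 N5. lia. }
  assert (K : a * (m * (m + 1)) + 2 * n <= b * (n * (n - 1))).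
  { apply (start_gap s); [lia|].
    assert (SA : 2 * a <= s) by (pose proof s_big; clear - H0 Hab B4; nia).
    assert (V2 : c * (a * c + 1) <= 2 * (p + c * ya)).
    { subst p ya. pose proof s_small as SC. clear - SA SC Hs Hc5 Hab Hs0 Hbc.
      assert (s * (2 * a) <= s * s) by (apply Z.mul_le_mono_nonneg_l; lia).
      assert (c * (2 * (a * s)) <= c * (a * c + 4)) by (apply Z.mul_le_mono_nonneg_l; lia).
      lia. }
    assert (W2 : s * (q + c * yb) <= c * c).
    { subst q. rewrite <- Yb in G2. assert (c * (s * yb) <= c * c) by (apply Z.mul_le_mono_nonneg_l; lia).
      assert (0 <= s * s) by (apply Z.mul_nonneg_nonneg; lia). lia. }
    replace (a ^ n) with (a * a ^ (n - 1)) by (rewrite <- Z.pow_succ_r by lia; f_equal; lia).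
    assert (ap : 0 < a ^ (n - 1)) by (apply Z.pow_pos_nonneg; lia).
    assert (bp : 0 < b ^ (n - 1)) by (apply Z.pow_pos_nonneg; lia).
    pose proof ac_big as AC.
    assert (wp : 0 < (a * c + 1) ^ (m - n)) by (apply Z.pow_pos_nonneg; lia).
    set (A := a ^ (n - 1)) in *. set (B := b ^ (n - 1)) in *. set (w := (a * c + 1) ^ (m - n)) in *.
    apply (Z.mul_le_mono_pos_r _ _ (c * c)); [apply Z.mul_pos_pos; lia|].
    assert (L1 : A * w * (c * (a * c + 1)) <= A * w * (2 * (p + c * ya))).
    { apply Z.mul_le_mono_nonneg_l; [repeat apply Z.mul_nonneg_nonneg; lia|lia]. }
    assert (L2 : s * (A * w * (c * (a * c + 1))) <= s * (6 * B * (q + c * yb))).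
    { apply Z.mul_le_mono_nonneg_l; lia. }
    assert (L3 : 6 * B * (s * (q + c * yb)) <= 6 * B * (c * c)).
    { apply Z.mul_le_mono_nonneg_l; lia. }
    assert (0 <= s * (A * w * c)) by (repeat apply Z.mul_nonneg_nonneg; lia).
    clear - L2 L3 H0. lia. }
  assert (X1 : s * (2 * n) <= s * (b * (n * (n - 1)) - a * (m * (m + 1)))) by (apply Z.mul_le_mono_nonneg_l; lia).
  assert (X2 : s * (2 * n) < n * (t * r - b * s)) by (clear - X1 Z0 N4 N5; lia).
  assert (X3 : s * (s * (2 * n)) < s * (n * (t * r - b * s))) by (apply Z.mul_lt_mono_pos_l; lia).
  assert (X4 : n * (s * (t * r - b * s)) <= n * (2 * c)) by (apply Z.mul_le_mono_nonneg_l; lia).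
  assert (X5 : s * (2 * n * s) < 2 * n * c) by (clear - X3 X4; lia).
  replace (s * (2 * n * s)) with (2 * n * s ^ 2) in X5 by ring.
  apply Z.mul_lt_mono_pos_l in X5; [|lia]. rewrite Hs in X5.
  clear - X5 Hab Hc5. assert (1 * c <= a * c) by (apply Z.mul_le_mono_nonneg_r; lia). lia.
Qed.

Lemma sr_sub_le : t * (s * r - a * t) <= 2 * c + 2 * b + 8.
Proof.
  pose proof (sr_gt _ _ _ _ _ Hab Hc5 Hs0 Ht0 Hs Ht _ Hr0 Hr) as G.
  apply (Z.mul_le_mono_pos_l _ _ (2 * a)); [lia|].
  apply Z.le_trans with ((s * r + a * t) * (s * r - a * t)).
  - replace (2 * a * (t * (s * r - a * t))) with ((a * t + a * t) * (s * r - a * t)) by ring.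
    apply Z.mul_le_mono_nonneg_r; lia.
  - replace ((s * r + a * t) * (s * r - a * t)) with (s ^ 2 * r ^ 2 - a ^ 2 * t ^ 2) by ring. rewrite Hs, Ht, Hr.
    assert (0 <= a * a) by (apply Z.mul_nonneg_nonneg; lia). lia.
Qed.

(** Here the term to be balanced is [m (s r - a t)], about [2 c m / t] at most; with [m <= 3 n] this
    leaves [t^2 <= 3 (c + b + 4)], too small for [t^2 = b c + 4] and [b >= 4]. *)
Lemma case_2b_plus : p = t -> e1 = b -> q = t - c -> yq = t - b -> False.
Proof.
  intros P1 P2 P3 P4.
  destruct (meet_2b_plus _ _ _ _ _ Hs0 Ht0 Ht _ _ _ _ _ _ _ _ _ _ _ _ H _ Hr0 Hr P1 P2 P3 P4) as [Ya Yb].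
  pose proof (sr_gt _ _ _ _ _ Hab Hc5 Hs0 Ht0 Hs Ht _ Hr0 Hr) as G. pose proof sr_sub_le as G2.
  pose proof step_products as (N1 & N2 & N3 & N4 & N5 & N6). pose proof steps_lt_s as S1. pose proof s_lt_t as ST.
  pose proof r_le_b as RB. pose proof b_ge4 as B4. pose proof start_ratio as R. pose proof (meet_V1 H) as V.
  assert (Z0 : 2 + r * s * m + a * t * (m * m) - 4 * n - b * t * (n * (n - 1)) = 0).
  { eapply dvd_zero; [apply (cong_of 1); lia| |].
    - subst yb p q. destruct (half_prod n) as [h Eh].
      exists (- (b * h)). rewrite Eh.
      replace (2 * m * ya) with (m * (2 * ya)) by ring. rewrite Ya. ring.
    - pose proof big_alpha_sum as A2.
      pose proof (term_le a t (a * t * (m * m)) (m * m) (m * m) ltac:(lia) ltac:(lia) ltac:(lia) eq_refl) as T1.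
      pose proof (term_le b t (b * t * (n * (n - 1))) (n * (n - 1)) (m * m) ltac:(lia) ltac:(lia) N2 eq_refl) as T2.
      pose proof (term_le r s (r * s * m) m m ltac:(lia) ltac:(lia) ltac:(lia) eq_refl) as T3.
      assert (4 * t <= b * t) by (apply Z.mul_le_mono_nonneg_r; lia).
      assert (0 <= b * t * m) by (repeat apply Z.mul_nonneg_nonneg; lia).
      clear - A2 T1 T2 T3 H0 H1 S1 ST Hs0 Ht0 N4 N5. lia. }
  assert (K : a * (m * (m + 1)) + 2 * n <= b * (n * (n - 1))).
  { apply (start_gap t); [lia|].
    assert (V2 : c * (a * t) <= p + c * ya).
    { subst p. assert (c * (2 * (a * t)) <= c * (2 * ya)) by (apply Z.mul_le_mono_nonneg_l; lia). lia. }
    assert (TC : t <= c).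
    { apply sq_le_le; [lia|]. rewrite Ht. assert (b * c <= (c - 1) * c) by (apply Z.mul_le_mono_nonneg_r; lia). lia. }
    assert (W2 : q + c * yb <= 2 * c) by (subst q yb; lia).
    replace (a ^ n) with (a * a ^ (n - 1)) by (rewrite <- Z.pow_succ_r by lia; f_equal; lia).
    assert (ap : 0 < a ^ (n - 1)) by (apply Z.pow_pos_nonneg; lia).
    assert (bp : 0 < b ^ (n - 1)) by (apply Z.pow_pos_nonneg; lia).
    pose proof ac_big as AC.
    assert (wp : 0 < (a * c + 1) ^ (m - n)) by (apply Z.pow_pos_nonneg; lia).
    set (A := a ^ (n - 1)) in *. set (B := b ^ (n - 1)) in *. set (w := (a * c + 1) ^ (m - n)) in *.
    apply (Z.mul_le_mono_pos_r _ _ c); [lia|].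
    assert (L1 : A * w * (c * (a * t)) <= A * w * (p + c * ya)).
    { apply Z.mul_le_mono_nonneg_l; [repeat apply Z.mul_nonneg_nonneg; lia|lia]. }
    assert (L3 : 3 * B * (q + c * yb) <= 3 * B * (2 * c)).
    { apply Z.mul_le_mono_nonneg_l; lia. }
    clear - L1 L3 R. lia. }
  assert (X1 : t * (2 * n) <= t * (b * (n * (n - 1)) - a * (m * (m + 1)))) by (apply Z.mul_le_mono_nonneg_l; lia).
  assert (X2 : t * (2 * n) <= m * (s * r - a * t)) by (clear - X1 Z0 N4 N5; lia).
  assert (X3 : t * (t * (2 * n)) <= t * (m * (s * r - a * t))) by (apply Z.mul_le_mono_nonneg_l; lia).
  assert (X4 : m * (t * (s * r - a * t)) <= m * (2 * c + 2 * b + 8)) by (apply Z.mul_le_mono_nonneg_l; lia).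
  pose proof (meet_m_le_3n _ _ _ _ _ Hab Hbc Hc5 Hs0 Ht0 Hs Ht _ _ _ _ _ _ _ _ _ _ _ _ H) as M3.
  assert (X6 : m * (2 * c + 2 * b + 8) <= 3 * n * (2 * c + 2 * b + 8)) by (apply Z.mul_le_mono_nonneg_r; lia).
  assert (X5 : 2 * n * t ^ 2 <= 2 * n * (3 * (c + b + 4))) by (clear - X3 X4 X6; lia).
  apply Z.mul_le_mono_pos_l in X5; [|lia]. rewrite Ht in X5.
  pose proof b_small as BS. clear - X5 BS B4 Hc5.
  assert (4 * c <= b * c) by (apply Z.mul_le_mono_nonneg_r; lia). lia.
Qed.

Hypothesis Hreg : ~ regular a b c d.

(* Here both chains start from the same extension [e1 < c] of [{a, b, c}]. *)
Section Diag.
Hypotheses (Epq : p = q) (Ee : e1 = e2).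

Lemma diag_ext : 0 < xp /\ 0 < yq /\ p ^ 2 = c * e1 + 4 /\ xp ^ 2 = a * e1 + 4 /\ yq ^ 2 = b * e1 + 4 /\ 0 <= e1 < c.
Proof.
  pose proof (ext_nonneg _ Hc5 _ _ _ _ (meet_ext1 H)) as He.
  pose proof (meet_p H) as P. destruct (meet_ext1 H) as [Hx [Hp Hxp]].
  assert (L : e1 < c) by (clear - P Hp Hc5; nia). destruct (meet_ext2 H) as [Hy [_ Hyq]].
  rewrite <- Ee in Hyq. repeat split; auto; lia.
Qed.

Lemma diag_cong : (2 * c | p * (a * (m * m) - b * (n * n)) + s * xp * m - t * yq * n).
Proof.
  destruct (cong_of 0) as [u Hu]; [lia|]. exists u. rewrite <- Hu, <- Epq.
  replace (2 * m * ya) with (m * (2 * ya)) by ring. replace (2 * n * yb) with (n * (2 * yb)) by ring.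
  rewrite (meet_ya H), (meet_yb H), <- Epq. ring.
Qed.

Lemma diag_nontrivial : ~ (m = 1 /\ n = 1).
Proof.
  intros [M N]. apply Hreg.
  exact (meet_regular _ _ _ _ _ Hab Hc5 Hs0 Ht0 Hs Ht _ _ _ _ _ _ _ _ _ _ _ _ H M N Epq Ee).
Qed.

Lemma diag_ratio : a ^ n * (a * c + 1) ^ (m - n) <= 6 * b ^ n.
Proof.
  pose proof start_ratio as R. pose proof (meet_V1 H) as V. pose proof (meet_n H) as N1. pose proof cases_n_le_m as NM.
  pose proof (aW1_le _ _ _ _ _ Hab Hbc Hc5 Hs0 Ht0 Hs Ht _ _ _ _ _ _ _ _ _ _ _ _ H Epq Ee) as W.
  apply (Z.mul_le_mono_pos_r _ _ (p + c * ya)); [lia|].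
  replace (a ^ n) with (a * a ^ (n - 1)) by (rewrite <- Z.pow_succ_r by lia; f_equal; lia).
  replace (b ^ n) with (b * b ^ (n - 1)) by (rewrite <- Z.pow_succ_r by lia; f_equal; lia).
  assert (bp : 0 < b ^ (n - 1)) by (apply Z.pow_pos_nonneg; lia).
  set (A := a ^ (n - 1)) in *. set (B := b ^ (n - 1)) in *. set (w := (a * c + 1) ^ (m - n)) in *.
  assert (L1 : a * (A * w * (p + c * ya)) <= a * (3 * B * (q + c * yb))) by (apply Z.mul_le_mono_nonneg_l; lia).
  assert (L2 : 3 * B * (a * (q + c * yb)) <= 3 * B * (2 * b * (p + c * ya))) by (apply Z.mul_le_mono_nonneg_l; lia).
  clear - L1 L2. lia.
Qed.

(** [a c + 1 >= 6 b^4], so each surplus step outweighs four factors [b]. *)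
Lemma diag_step_gap : 4 * (m - n) <= n.
Proof.
  pose proof diag_ratio as R. pose proof (meet_n H) as N1. pose proof cases_n_le_m as NM. pose proof b_ge4 as B4.
  destruct (Z.eq_dec m n) as [E|E]; [lia|].
  assert (W : 6 * b ^ 4 <= a * c + 1).
  { pose proof (big_c _ _ _ _ _ HB). assert (1 * c <= a * c) by (apply Z.mul_le_mono_nonneg_r; lia).
    assert (0 < b ^ 4) by (apply Z.pow_pos_nonneg; lia). lia. }
  assert (ap : 0 < a ^ n) by (apply Z.pow_pos_nonneg; lia).
  assert (W2 : (6 * b ^ 4) ^ (m - n) <= (a * c + 1) ^ (m - n)).
  { apply Z.pow_le_mono_l. split; [|exact W]. assert (0 < b ^ 4) by (apply Z.pow_pos_nonneg; lia). lia. }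
  assert (W3 : 1 * (a * c + 1) ^ (m - n) <= a ^ n * (a * c + 1) ^ (m - n)).
  { apply Z.mul_le_mono_nonneg_r; [|lia]. apply Z.pow_nonneg. pose proof ac_big. lia. }
  assert (S : 6 <= 6 ^ (m - n)) by (rewrite <- (Z.pow_1_r 6) at 1; apply Z.pow_le_mono_r; lia).
  rewrite Z.pow_mul_l, <- Z.pow_mul_r in W2 by lia.
  assert (bp : 0 < b ^ (4 * (m - n))) by (apply Z.pow_pos_nonneg; lia).
  assert (S2 : 6 * b ^ (4 * (m - n)) <= 6 ^ (m - n) * b ^ (4 * (m - n))) by (apply Z.mul_le_mono_nonneg_r; lia).
  apply (Z.pow_le_mono_r_iff b); lia.
Qed.

Lemma diag_X_neg : a * (m * m) < b * (n * n).
Proof.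
  pose proof diag_ratio as R. pose proof step_products as (N1 & N2 & N3 & N4 & N5 & N6).
  destruct (Z.eq_dec m n) as [E|E].
  - rewrite E. apply Z.mul_lt_mono_pos_r; [apply Z.mul_pos_pos; lia|lia].
  - pose proof (ratio_gap a b n (m - n) (a * c + 1) ltac:(lia) ltac:(lia) ltac:(lia) ltac:(lia) ac_big R) as L.
    assert (m * m <= (n + 5 * (m - n)) * (n + 5 * (m - n))) by (apply Z.mul_le_mono_nonneg; lia).
    assert (a * (m * m) <= a * ((n + 5 * (m - n)) * (n + 5 * (m - n)))) by (apply Z.mul_le_mono_nonneg_l; lia).
    replace (n * n) with (n ^ 2) by ring. replace ((n + 5 * (m - n)) ^ 2) with ((n + 5 * (m - n)) * (n + 5 * (m - n))) in L by ring. lia.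
Qed.

Lemma diag_bracket : a + 3 <= b -> a * (m * (m - 1)) + 3 * n <= b * (n * (n - 1)).
Proof.
  intros Hg. pose proof diag_step_gap as SG. pose proof diag_nontrivial as NT. pose proof diag_ratio as R.
  pose proof step_products as (N1 & N2 & N3 & N4 & N5 & N6).
  assert (n2 : 2 <= n) by lia.
  destruct (Z.eq_dec m n) as [E|E].
  - rewrite E. assert ((a + 3) * (n * (n - 1)) <= b * (n * (n - 1))) by (apply Z.mul_le_mono_nonneg_r; lia).
    assert (n * 1 <= n * (n - 1)) by (apply Z.mul_le_mono_nonneg_l; lia). lia.
  - pose proof (ratio_gap a b n (m - n) (a * c + 1) ltac:(lia) ltac:(lia) ltac:(lia) ltac:(lia) ac_big R) as L.
    apply (Z.mul_le_mono_pos_l _ _ n); [lia|].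
    set (j := m - n) in *. replace m with (n + j) by (unfold j; lia). assert (j1 : 1 <= j) by (unfold j; lia).
    assert (C : n * ((n + j) * (n + j - 1)) + 3 * (n * n) <= (n - 1) * (n + 5 * j) ^ 2).
    { clear - n2 j1. assert (n * n * 1 <= n * n * j) by (apply Z.mul_le_mono_nonneg_l; nia).
      assert (n * j * 2 <= n * j * n) by (apply Z.mul_le_mono_nonneg_l; nia).
      assert (j * j * 2 <= j * j * n) by (apply Z.mul_le_mono_nonneg_l; nia). nia. }
    assert (C2 : a * (n * ((n + j) * (n + j - 1)) + 3 * (n * n)) <= a * ((n - 1) * (n + 5 * j) ^ 2)) by (apply Z.mul_le_mono_nonneg_l; lia).
    assert (C3 : (n - 1) * (a * (n + 5 * j) ^ 2) <= (n - 1) * (b * n ^ 2)) by (apply Z.mul_le_mono_nonneg_l; lia).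
    assert (1 * (3 * (n * n)) <= a * (3 * (n * n))) by (apply Z.mul_le_mono_nonneg_r; [clear - n2; nia|lia]).
    clear - C2 C3 H0. lia.
Qed.

(** Now [p] is [2] or [-2], and with [X = a m^2 - b n^2] the congruence becomes [t n - s m = X] or
    [- X]. Multiplied by [w = t n + s m] it says that [X (c + w)] or [X (c - w)] is
    [- 4 (m^2 - n^2)], too small for a nonzero integer [X]. *)
Lemma diag_zero : e1 <> 0.
Proof.
  intros E0. destruct diag_ext as (Hx & Hy & Hp & Hxp & Hyq & He). rewrite E0 in Hp, Hxp, Hyq.
  pose proof step_products as (N1 & N2 & N3 & N4 & N5 & N6). pose proof s_lt_t as ST. pose proof b_ge4 as B4.
  pose proof big_alpha_sum as A2. pose proof s_big as SB. pose proof diag_X_neg as XN.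
  assert (X2 : xp = 2) by (clear - Hx Hxp; nia). assert (Y2 : yq = 2) by (clear - Hy Hyq; nia).
  assert (m0 : 0 <= m) by (clear - N4 N5; lia).
  assert (T3 : 0 <= s * m <= t * m) by (clear - Hs0 Ht0 m0 ST; split; [apply Z.mul_nonneg_nonneg|apply Z.mul_le_mono_nonneg_r]; lia).
  assert (T4 : 0 <= t * n <= t * m) by (clear - Ht0 m0 N4 N5; split; [apply Z.mul_nonneg_nonneg|apply Z.mul_le_mono_nonneg_l]; lia).
  assert (TM : 4 * (t * m) <= b * (t * m)) by (clear - T3 B4; apply Z.mul_le_mono_nonneg_r; lia).
  assert (T400 : 464 <= t) by (clear - SB B4 ST; nia).
  assert (MM : 0 <= m * m) by (clear; nia).
  assert (BM : 0 <= b * (m * m)) by (clear - MM B4; apply Z.mul_nonneg_nonneg; lia).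
  assert (T5 : 464 * (b * (m * m)) <= t * (b * (m * m))) by (clear - BM T400; apply Z.mul_le_mono_nonneg_r; lia).
  assert (T6 : 4 * (m * m) <= b * (m * m)) by (clear - MM B4; apply Z.mul_le_mono_nonneg_r; lia).
  assert (BT : 0 <= b * t) by (clear - Ht0 B4; apply Z.mul_nonneg_nonneg; lia).
  assert (T7 : 0 <= a * (m * m) <= b * (m * m)) by (clear - Hab MM; split; [apply Z.mul_nonneg_nonneg|apply Z.mul_le_mono_nonneg_r]; lia).
  assert (T8 : 0 <= b * (n * n) <= b * (m * m)) by (clear - N1 B4; split; [apply Z.mul_nonneg_nonneg|apply Z.mul_le_mono_nonneg_l]; lia).
  assert (NM : 0 <= m * m - n * n <= m * m) by (clear - N1; lia).
  assert (Sm : 4 * (m * m) + 4 * (b * (m * m)) + 4 * (t * m) < 2 * c) by (clear - A2 T3 T4 T5 T6 TM BT T400 MM; lia).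
  assert (P2 : p = 2 \/ p = -2) by (clear - Hp; nia).
  pose proof diag_cong as [u Hu]. rewrite X2, Y2 in Hu.
  clear Hp Hxp Hyq X2 Y2 N1 N2 N3 N6 SB A2 T5 HB H Hr.
  set (X := a * (m * m) - b * (n * n)) in *.
  assert (Xb : - (b * (m * m)) <= X <= b * (m * m)) by (unfold X; clear - T7 T8; lia).
  assert (Id : (t * n - s * m) * (t * n + s * m) = - c * X - 4 * (m * m - n * n)).
  { unfold X. replace ((t * n - s * m) * (t * n + s * m)) with (t ^ 2 * (n * n) - s ^ 2 * (m * m)) by ring.
    rewrite Hs, Ht. ring. }
  assert (Xneg : X < 0) by (unfold X; clear - XN; lia).
  clearbody X. clear Hs Ht XN.
  set (w := t * n + s * m) in *.
  assert (Ww : 0 <= w <= 2 * (t * m)) by (unfold w; clear - T3 T4; lia).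
  clearbody w.
  destruct P2 as [P2|P2]; rewrite P2 in Hu.
  - assert (Z0 : X + s * m - t * n = 0).
    { apply (dvd_small c); [clear - Hc5; lia|exists u; clear - Hu; lia|]. clear - Sm T3 T4 Xb Xneg MM. lia. }
    replace (t * n - s * m) with X in Id by (clear - Z0; lia).
    assert (Q1 : X * (c + w) = - (4 * (m * m - n * n))) by (clear - Id; lia).
    assert (Q2 : X * (c + w) <= -1 * (c + w)) by (clear - Ww Xneg Hc5; apply Z.mul_le_mono_nonneg_r; lia). clear - Q1 Q2 NM Sm Xneg Ww T3 T7 MM T6. lia.
  - assert (Z0 : - X + s * m - t * n = 0).
    { apply (dvd_small c); [clear - Hc5; lia|exists u; clear - Hu; lia|]. clear - Sm T3 T4 Xb Xneg MM. lia. }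
    replace (t * n - s * m) with (- X) in Id by (clear - Z0; lia).
    assert (Q1 : X * (c - w) = - (4 * (m * m - n * n))) by (clear - Id; lia).
    assert (Q2 : X * (c - w) <= -1 * (c - w)).
    { apply Z.mul_le_mono_nonneg_r; [clear - Sm Ww T3 T7 MM T6|clear - Xneg]; lia. }
    clear - Q1 Q2 NM Sm Xneg Ww T3 T7 MM T6. lia.
Qed.

Lemma diag_ne_a : e1 <> a.
Proof.
  intros E. destruct diag_ext as (Hx & _ & _ & Hxp & _). rewrite E in Hxp.
  apply (no_sq_add4 a xp); auto; lia.
Qed.

Lemma diag_ne_b : e1 <> b.
Proof.
  intros E. destruct diag_ext as (_ & Hy & _ & _ & Hyq & _). rewrite E in Hyq.
  apply (no_sq_add4 b yq); auto; lia.
Qed.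

(** By [pair_gap] only the pair [{3, 4}] is in question, and neither [1] nor [2] extends it. *)
Lemma diag_small_gap : 0 < e1 < b -> a + 3 <= b.
Proof.
  intros He. destruct (pair_gap a b r Hab Hr0 Hr) as [G|[A B]]; [exact G|exfalso].
  destruct diag_ext as (_ & Hy & _ & Hxp & Hyq & _). rewrite A in Hxp. rewrite B in Hyq.
  pose proof diag_ne_a as NA. assert (E : e1 = 1 \/ e1 = 2) by lia. clear - E Hy Hyq.
  assert (E3 : e1 <= 3) by lia. assert (yq < 5) by (clear - Hyq E3; nia).
  assert (Y : yq = 1 \/ yq = 2 \/ yq = 3 \/ yq = 4) by lia.
  destruct E as [-> | ->]; destruct Y as [-> | [-> | [-> | ->]]]; lia.
Qed.

Lemma diag_small_eq : 0 < e1 < b -> p * (a * (m * m) - b * (n * n)) + s * xp * m - t * yq * n = 0.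
Proof.
  intros He. destruct diag_ext as (Hx & Hy & Hp & Hxp & Hyq & _).
  pose proof step_products as (N1 & N2 & N3 & N4 & N5 & N6). pose proof s_lt_t as ST. pose proof b_ge4 as B4.
  pose proof big_alpha_sum as A2.
  assert (E : b * e1 <= b * (b - 1)) by (clear - He; apply Z.mul_le_mono_nonneg_l; lia).
  assert (Yb : yq <= b) by (apply sq_le_le; [lia|]; rewrite Hyq; clear - E B4; lia).
  assert (Xb : xp <= b).
  { apply sq_le_le; [lia|]. rewrite Hxp. assert (a * e1 <= b * e1) by (apply Z.mul_le_mono_nonneg_r; lia).
    clear - E B4 H0; lia. }
  assert (Pt : Z.abs p <= t).
  { apply sq_le_le; [lia|]. replace (Z.abs p ^ 2) with (p ^ 2) by (clear; lia). rewrite Hp, Ht.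
    assert (c * e1 <= c * b) by (apply Z.mul_le_mono_nonneg_l; lia). lia. }
  apply (dvd_small (2 * c)); [lia|exact diag_cong|].
  pose proof (term_le a (Z.abs p) (a * Z.abs p * (m * m)) (m * m) (m * m) ltac:(lia) ltac:(lia) ltac:(lia) eq_refl) as T1.
  pose proof (term_le b (Z.abs p) (b * Z.abs p * (n * n)) (n * n) (m * m) ltac:(lia) ltac:(lia) N1 eq_refl) as T2.
  pose proof (term_le xp s (xp * s * m) m m ltac:(lia) ltac:(lia) ltac:(lia) eq_refl) as T3.
  pose proof (term_le yq t (yq * t * n) n m ltac:(lia) ltac:(lia) ltac:(lia) eq_refl) as T4.
  assert (BT : 0 <= b * t) by (clear - Ht0 B4; apply Z.mul_nonneg_nonneg; lia).
  assert (BTm : 0 <= b * t * m) by (apply Z.mul_nonneg_nonneg; lia).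
  assert (bt0 : 0 < b * t) by (apply Z.mul_pos_pos; lia).
  clear - A2 T1 T2 T3 T4 BTm bt0.
  destruct (Z.abs_spec p) as [[_ E]|[_ E]]; rewrite E in T1, T2; lia.
Qed.

Lemma s_xp_gt : 0 < e1 -> a * Z.abs p < s * xp.
Proof.
  intros He. destruct diag_ext as (Hx & Hy & Hp & Hxp & Hyq & _).
  apply sq_lt_lt; [apply Z.mul_nonneg_nonneg; lia|].
  replace ((s * xp) ^ 2) with (s ^ 2 * xp ^ 2) by ring.
  replace ((a * Z.abs p) ^ 2) with (a ^ 2 * Z.abs p ^ 2) by ring.
  replace (Z.abs p ^ 2) with (p ^ 2) by (clear; lia). rewrite Hs, Hxp, Hp.
  assert (a * a <= a * c) by (apply Z.mul_le_mono_nonneg_l; lia).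
  assert (0 < a * e1) by (apply Z.mul_pos_pos; lia). clear - H0 H1. lia.
Qed.

Lemma t_yq_le : 0 < e1 -> Z.abs p * (t * yq - b * Z.abs p) <= 2 * (c + e1).
Proof.
  intros He. destruct diag_ext as (Hx & Hy & Hp & Hxp & Hyq & _). pose proof b_ge4 as B4.
  assert (A : Z.abs p ^ 2 = c * e1 + 4) by (rewrite <- Hp; clear; lia).
  set (P := Z.abs p) in *. assert (P0 : 0 <= P) by (unfold P; lia). clearbody P.
  assert (Q : (t * yq) ^ 2 - (b * P) ^ 2 = 4 * b * (c + e1) + 16 - 4 * b * b).
  { replace ((t * yq) ^ 2) with (t ^ 2 * yq ^ 2) by ring. replace ((b * P) ^ 2) with (b * b * P ^ 2) by ring.
    rewrite Ht, Hyq, A. ring. }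
  assert (bb : b * 4 <= b * b) by (apply Z.mul_le_mono_nonneg_l; lia).
  destruct (Z_lt_le_dec (t * yq) (b * P)) as [L|L].
  - assert (P * (t * yq - b * P) <= P * 0) by (apply Z.mul_le_mono_nonneg_l; lia). lia.
  - apply (Z.mul_le_mono_pos_l _ _ (2 * b)); [lia|].
    apply Z.le_trans with ((t * yq + b * P) * (t * yq - b * P)).
    + replace (2 * b * (P * (t * yq - b * P))) with ((b * P + b * P) * (t * yq - b * P)) by ring.
      apply Z.mul_le_mono_nonneg_r; lia.
    + transitivity ((t * yq) ^ 2 - (b * P) ^ 2); [apply Z.eq_le_incl; ring|]. clear - Q bb B4. lia.
Qed.

(** For [p < 0], multiplying the equality by [|p|] bounds [p^2 (b n (n - 1) - a m (m - 1))] by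
    [2 n (c + e1)], while [p^2 = c e1 + 4] and the bracket is at least [3 n]. For [p > 0] the
    equality forces [t yq n < s xp m], and squaring contradicts [a m^2 < b n^2]. *)
Lemma diag_small : ~ (0 < e1 < b).
Proof.
  intros He. pose proof (diag_bracket (diag_small_gap He)) as Br. pose proof (diag_small_eq He) as E.
  pose proof (s_xp_gt (proj1 He)) as SX. pose proof (t_yq_le (proj1 He)) as TY.
  pose proof diag_X_neg as XN. pose proof step_products as (N1 & N2 & N3 & N4 & N5 & N6).
  destruct diag_ext as (Hx & Hy & Hp & Hxp & Hyq & _).
  assert (CE : c * 1 <= c * e1) by (apply Z.mul_le_mono_nonneg_l; lia).
  destruct (Z_lt_le_dec p 0) as [P|P].
  - rewrite Z.abs_neq in SX, TY by lia. set (P' := - p) in *. replace p with (- P') in * by (unfold P'; ring).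
    clearbody P'. assert (P0 : 0 < P') by lia.
    assert (I1 : P' * (a * P' * m) <= P' * (s * xp * m)).
    { apply Z.mul_le_mono_nonneg_l; [lia|]. apply Z.mul_le_mono_nonneg_r; lia. }
    assert (I2 : n * (P' * (t * yq - b * P')) <= n * (2 * (c + e1))) by (apply Z.mul_le_mono_nonneg_l; lia).
    assert (E2 : P' * (- P' * (a * (m * m) - b * (n * n)) + s * xp * m - t * yq * n) = 0) by (rewrite E; ring).
    assert (I3 : P' * P' * (b * (n * (n - 1)) - a * (m * (m - 1))) <= n * (2 * (c + e1))) by (clear - I1 I2 E2; lia).
    assert (I4 : P' * P' * (3 * n) <= P' * P' * (b * (n * (n - 1)) - a * (m * (m - 1)))).
    { apply Z.mul_le_mono_nonneg_l; [apply Z.mul_nonneg_nonneg; lia|lia]. }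
    replace ((- P') ^ 2) with (P' * P') in Hp by ring. rewrite Hp in I3, I4.
    assert (I5 : n * (3 * (c * e1 + 4)) <= n * (2 * (c + e1))) by (clear - I3 I4; lia).
    apply Z.mul_le_mono_pos_l in I5; [|lia].
    assert (5 * e1 <= c * e1) by (apply Z.mul_le_mono_nonneg_r; lia). lia.
  - assert (p0 : 0 < p) by (clear - Hp P CE Hc5; nia).
    assert (L : t * yq * n < s * xp * m).
    { assert (0 < p * (b * (n * n) - a * (m * m))) by (apply Z.mul_pos_pos; lia). clear - E H0. lia. }
    assert (L2 : (t * yq * n) * (t * yq * n) <= (s * xp * m) * (s * xp * m)).
    { apply Z.mul_le_mono_nonneg; try lia; repeat apply Z.mul_nonneg_nonneg; lia. }
    replace (t * yq * n * (t * yq * n)) with (t ^ 2 * yq ^ 2 * (n * n)) in L2 by ring.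
    replace (s * xp * m * (s * xp * m)) with (s ^ 2 * xp ^ 2 * (m * m)) in L2 by ring.
    rewrite Hs, Ht, Hxp, Hyq in L2.
    assert (J1 : a * (a * (m * m)) <= a * (b * (n * n))) by (apply Z.mul_le_mono_nonneg_l; lia).
    assert (J2 : 0 <= (c + e1) * (b * (n * n) - a * (m * m))) by (apply Z.mul_nonneg_nonneg; lia).
    assert (J3 : 1 * (m * m) <= a * (m * m)) by (apply Z.mul_le_mono_nonneg_r; lia).
    assert (J4 : b * (1 * (n * n)) <= b * ((b - a) * (n * n))).
    { apply Z.mul_le_mono_nonneg_l; [lia|]. apply Z.mul_le_mono_nonneg_r; lia. }
    assert (J5 : m * m < b * b * (n * n) - a * a * (m * m)) by (clear - J1 J3 J4 XN; lia).
    assert (C16 : 16 <= c) by (pose proof b_small; pose proof b_ge4; lia).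
    assert (J6 : c * e1 * (m * m) <= c * e1 * (b * b * (n * n) - a * a * (m * m))) by (apply Z.mul_le_mono_nonneg_l; lia).
    assert (J7 : 16 * (m * m) <= c * e1 * (m * m)) by (apply Z.mul_le_mono_nonneg_r; lia).
    assert (n2 : 0 < n * n) by (apply Z.mul_pos_pos; lia).
    clear - L2 J2 J6 J7 n2. lia.
Qed.

Lemma half_prod_sign eps i : eps = 1 \/ eps = -1 -> exists h, i * (i + eps) = 2 * h.
Proof.
  intros [-> | ->]; destruct (half_prod i) as [h E]; [exists (h + i)|exists h]; lia.
Qed.

(** For [e1 > b] the terms of [diag_cong] can be too large for the modulus. So it is multiplied by
    [p], whose sign is [eps]: [p^2 = c e1 + 4], and the products [s xp |p|] and [t yq |p|] are
    expressed by the smaller extensions [fa] of [{a, c, e1}] and [fb] of [{b, c, e1}], of size about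
    [c / (a e1)] and [c / (b e1)]. *)
Lemma diag_conj : 0 < e1 -> exists eps fa fb, (eps = 1 \/ eps = -1) /\
  2 * fa <= a * c * e1 + 2 * (a + c + e1) /\ 2 * fb <= b * c * e1 + 2 * (b + c + e1) /\
  fa * (a * c * e1 + 2 * (a + c + e1) - fa) = (c - a - e1) ^ 2 - 4 * (a * e1 + 4) /\
  fb * (b * c * e1 + 2 * (b + c + e1) - fb) = (c - b - e1) ^ 2 - 4 * (b * e1 + 4) /\
  (c | 2 * (a * (m * m) - b * (n * n)) + eps * ((a + e1 - fa) * m - (b + e1 - fb) * n)).
Proof.
  intros He. destruct diag_ext as (Hx & Hy & Hp & Hxp & Hyq & _).
  assert (A : Z.abs p ^ 2 = c * e1 + 4) by (rewrite <- Hp; clear; lia).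
  destruct (conj_exists a c e1 s xp (Z.abs p) Hs Hxp A) as (fa & F1 & F2).
  destruct (conj_exists b c e1 t yq (Z.abs p) Ht Hyq A) as (fb & G1 & G2).
  assert (E : exists eps, (eps = 1 \/ eps = -1) /\ p = eps * Z.abs p).
  { clear; destruct (Z.abs_spec p) as [[_ E]|[_ E]]; [exists 1|exists (-1)]; lia. }
  assert (P0 : 0 <= Z.abs p) by apply Z.abs_nonneg.
  destruct E as (eps & E1 & E2). exists eps, fa, fb.
  assert (S1 : 0 <= s * xp * Z.abs p) by (clear - Hs0 Hx P0; repeat apply Z.mul_nonneg_nonneg; lia).
  assert (T1 : 0 <= t * yq * Z.abs p) by (clear - Ht0 Hy P0; repeat apply Z.mul_nonneg_nonneg; lia).
  split; [exact E1|]. split; [clear - F1 S1; lia|]. split; [clear - G1 T1; lia|]. split; [exact F2|]. split; [exact G2|].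
  destruct diag_cong as [u Hu].
  destruct (half_prod_sign eps m E1) as [h1 Eh1]. destruct (half_prod_sign eps n E1) as [h2 Eh2].
  set (P := Z.abs p) in *. clearbody P.
  exists (u * p - eps * (m - n) - e1 * (a * h1 - b * h2)).
  assert (EE : eps * eps = 1) by (destruct E1; subst; reflexivity).
  apply (Z.mul_reg_l _ _ 2); [lia|].
  transitivity (4 * (a * (m * m) - b * (n * n)) + eps * ((2 * a + 2 * e1 - 2 * fa) * m - (2 * b + 2 * e1 - 2 * fb) * n)); [ring|].
  rewrite F1, G1.
  transitivity (4 * (a * (m * m) - b * (n * n)) + (eps * P) * (s * xp * m - t * yq * n)
    - eps * c * e1 * (a * m - b * n) - 2 * eps * c * (m - n)); [ring|].
  rewrite <- E2. replace (s * xp * m - t * yq * n) with (u * (2 * c) - p * (a * (m * m) - b * (n * n))) by (clear - Hu; lia).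
  transitivity (2 * c * (u * p - eps * (m - n)) + (4 - p ^ 2) * (a * (m * m) - b * (n * n)) - eps * c * e1 * (a * m - b * n)); [ring|].
  rewrite Hp.
  transitivity (2 * c * (u * p - eps * (m - n)) - c * e1 * (a * (m * (m + eps)) - b * (n * (n + eps)))); [ring|].
  rewrite Eh1, Eh2. ring.
Qed.

Lemma m_small_b_expanded : 29 * (b * b * b * ((m + 1) * (m + 1))) < 2 * c.
Proof. pose proof m_small_b as L. replace (29 * b ^ 3 * (m + 1) ^ 2) with (29 * (b * b * b * ((m + 1) * (m + 1)))) in L by ring. exact L. Qed.

(** If [e1] is regular, then [fa = b] and [fb = a], and the congruence becomes an equality between
    [2 X] and [e1 (m - n) - (b - a) (m + n)] up to sign. As [e1] is about [c / (a b)], one surplus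
    step outweighs the rest; [m = n] leaves only the excluded [m = n = 1]. *)
Lemma diag_regular_ext : 0 < e1 -> ~ regular a b c e1.
Proof.
  intros He R. destruct (diag_conj He) as (eps & fa & fb & Eps & F1 & G1 & F2 & G2 & D).
  destruct diag_ext as (_ & _ & _ & _ & _ & Hec).
  pose proof m_small_b_expanded as MC. pose proof b_ge4 as B4. pose proof step_products as (N1 & N2 & N3 & N4 & N5 & N6).
  pose proof b_small as BS.
  assert (ace : 0 < a * c * e1) by (repeat apply Z.mul_pos_pos; lia).
  assert (bce : 0 < b * c * e1) by (repeat apply Z.mul_pos_pos; lia).
  assert (FA : fa = b).
  { apply (f_unique (a * c * e1 + 2 * (a + c + e1))); [exact F1|clear - ace Hab Hbc He; lia|]. rewrite F2.
    unfold regular in R. clear - R. lia. }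
  assert (FB : fb = a).
  { apply (f_unique (b * c * e1 + 2 * (b + c + e1))); [exact G1|clear - bce Hab Hbc He; lia|]. rewrite G2.
    unfold regular in R. clear - R. lia. }
  subst fa fb. set (X := a * (m * m) - b * (n * n)) in *.
  assert (ab0 : 0 < a * b) by (apply Z.mul_pos_pos; lia).
  assert (Q : e1 * (a * b * c + 2 * (a + c + b) - e1) = (c - a - b) ^ 2 - 4 * (a * b + 4)) by (unfold regular in R; clear - R; lia).
  assert (Hace : a + b < c) by (clear - BS Hab; lia).
  assert (Hle : 2 * e1 <= a * b * c + 2 * (a + c + b)).
  { assert (1 * c <= a * b * c) by (apply Z.mul_le_mono_nonneg_r; clear - ab0 Hc5; lia). clear - H0 Hec Hab; lia. }
  replace (a * b * c) with (a * c * b) in Q, Hle by ring.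
  assert (U : e1 * (a * b + 1) <= c - a - b).
  { apply (f_upper a c b e1); auto; clear - Hab; lia. }
  assert (L : c - 2 * a - 2 * b - 4 <= e1 * (a * b + 2)).
  { apply (f_lower a c b e1); auto; clear - Hab He BS; lia. }
  assert (Xb : - (b * (m * m)) <= X <= b * (m * m)).
  { assert (0 <= a * (m * m) <= b * (m * m)) by (clear - Hab; split; [apply Z.mul_nonneg_nonneg|apply Z.mul_le_mono_nonneg_r]; nia).
    assert (0 <= b * (n * n) <= b * (m * m)) by (clear - N1 B4; split; [apply Z.mul_nonneg_nonneg|apply Z.mul_le_mono_nonneg_l]; lia).
    unfold X. clear - H0 H1. lia. }
  assert (EL : 2 * (b * (m * m)) + 2 * (b * m) < e1).
  { destruct (Z_lt_le_dec (2 * (b * (m * m)) + 2 * (b * m)) e1) as [G|G]; [exact G|exfalso].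
    assert (AB : a * b + 2 <= b * b).
    { assert (a * b <= (b - 1) * b) by (clear - Hab; apply Z.mul_le_mono_nonneg_r; lia). clear - H0 B4. lia. }
    assert (E2 : e1 * (a * b + 2) <= (2 * (b * (m * m)) + 2 * (b * m)) * (b * b)) by (clear - He G AB ab0; apply Z.mul_le_mono_nonneg; lia).
    assert (m1 : 1 <= m) by (clear - N4 N5; lia).
    assert (b3 : 0 < b * b * b) by (repeat apply Z.mul_pos_pos; clear - B4; lia).
    assert (B3 : b * 16 <= b * (b * b)) by (clear - B4; apply Z.mul_le_mono_nonneg_l; nia).
    assert (M4 : b * b * b * 4 <= b * b * b * ((m + 1) * (m + 1))) by (clear - m1 b3; apply Z.mul_le_mono_nonneg_l; nia).
    assert (Mm : 0 <= b * b * b * m) by (clear - m1 b3; apply Z.mul_nonneg_nonneg; lia).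
    clear - E2 L MC B3 M4 Mm Hab b3 B4. lia. }
  assert (J : m - n <= a * b).
  { pose proof diag_step_gap as SG. pose proof (big_ab _ _ _ _ _ HB) as AB. clear - SG AB N4. lia. }
  assert (EJ : 0 <= e1 * (m - n) <= e1 * (a * b)) by (clear - He J N4; split; [apply Z.mul_nonneg_nonneg|apply Z.mul_le_mono_nonneg_l]; lia).
  assert (DM : 0 <= (b - a) * (m + n) <= b * (2 * m)).
  { clear - Hab N4 N5. split; [apply Z.mul_nonneg_nonneg|apply Z.mul_le_mono_nonneg]; lia. }
  replace ((a + e1 - b) * m - (b + e1 - a) * n) with (e1 * (m - n) - (b - a) * (m + n)) in D by ring.
  assert (Z0 : 2 * X + eps * (e1 * (m - n) - (b - a) * (m + n)) = 0).
  { apply (dvd_small c); [clear - Hc5; lia|exact D|]. clear - Eps Xb EJ DM EL U Hab. destruct Eps; subst; lia. }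
  destruct (Z.eq_dec m n) as [E|E].
  - apply diag_nontrivial. unfold X in Z0. rewrite E in Z0. clear - Z0 Eps E N5 Hab.
    assert (F : (b - a) * n * (n + eps) = 0) by lia.
    apply Z.mul_eq_0 in F. destruct F as [F|F]; [apply Z.mul_eq_0 in F; lia|lia].
  - assert (e1 * 1 <= e1 * (m - n)) by (clear - He E N4; apply Z.mul_le_mono_nonneg_l; lia).
    clear - Z0 H0 EL DM Xb Eps. destruct Eps; subst; lia.
Qed.

Lemma m_small_c : b * b * b * (((m + 1) * (m + 1)) * ((m + 1) * (m + 1))) < 4 * c.
Proof.
  pose proof (big_alpha _ _ _ _ _ HB) as A. set (u := (m + 1) ^ 2) in *.
  replace ((m + 1) * (m + 1)) with u by (unfold u; ring).
  assert (u0 : 0 <= u) by (unfold u; apply Z.pow_even_nonneg; now exists 1).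
  clearbody u. assert (b0 : 0 <= b * t * u) by (repeat apply Z.mul_nonneg_nonneg; lia).
  assert (A2 : (b * t * u) * (b * t * u) < (2 * c) * (2 * c)).
  { apply Z.mul_lt_mono_nonneg; auto. }
  replace (b * t * u * (b * t * u)) with (t ^ 2 * (b * b * (u * u))) in A2 by ring. rewrite Ht in A2.
  assert (0 <= b * b * (u * u)) by (repeat apply Z.mul_nonneg_nonneg; lia).
  apply (Z.mul_lt_mono_pos_l c); [lia|]. clear - A2 H0. lia.
Qed.

(** For [e1 > 4 b] the gap principle is applied to the triple [{a, b, e1}] with [c] as fourth
    element. *)
Lemma diag_exc_size : b < e1 -> ~ regular a b c e1 ->
  20 * ((m + 1) * (b * b * e1)) <= c /\ 2 * (b * b * e1 * ((m + 1) * (m + 1))) < c /\ 4 * (b * (e1 * e1)) <= c.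
Proof.
  intros He NR. pose proof b_ge4 as B4. pose proof (meet_m H) as M1.
  apply size_bounds; auto; try lia; [exact (big_c _ _ _ _ _ HB)|exact m_small_b_expanded|exact m_small_c|].
  destruct (Z_lt_le_dec (4 * b) e1) as [G|G]; [right|left; exact G].
  destruct diag_ext as (Hx & Hy & Hp & Hxp & Hyq & Hec).
  assert (A : Z.abs p ^ 2 = e1 * c + 4) by (rewrite (Z.mul_comm e1), <- Hp; clear; lia).
  assert (P0 : 0 < Z.abs p).
  { assert (0 < e1 * c) by (apply Z.mul_pos_pos; lia). clear - A H0. pose proof (Z.abs_nonneg p). nia. }
  destruct (meet_exists a b e1 xp yq Hab He ltac:(lia) Hx Hy Hxp Hyq c (Z.abs p) s t P0 ltac:(lia))
    as (p' & xp' & ya' & q' & yq' & yb' & e1' & e2' & m' & n' & H'); [repeat split; auto..|].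
  refine (gap a b e1 xp yq Hab He ltac:(lia) Hx Hy Hxp Hyq _ _ _ _ _ _ _ _ _ _ _ _ H' _ Hr0 Hr G _).
  intros R. apply NR. unfold regular in *. clear - R. replace (a + b - c - e1) with (a + b - e1 - c) by ring.
  rewrite R. ring.
Qed.

(** [fa] and [fb] are near [c / (a e)] and [c / (b e)], so [fa m - fb n] dominates the quadratic
    term [2 X] and still stays below the modulus; [K1] to [K4] make this precise. The equality
    [2 X = eps Y] then contradicts [Y > 2 |X|]. *)
Lemma diag_exc : b < e1 -> regular a b c e1.
Proof.
  intros He. destruct (Z.eq_dec ((a + b - c - e1) ^ 2) ((a * b + 4) * (c * e1 + 4))) as [R|R]; [exact R|exfalso].
  destruct (diag_exc_size He R) as (S1 & S2 & S3). clear R.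
  destruct (diag_conj ltac:(lia)) as (eps & fa & fb & Eps & F1 & G1 & F2 & G2 & D).
  destruct diag_ext as (_ & _ & _ & Hxp & _ & _).
  pose proof (big_ext _ _ _ _ _ HB e1 xp He Hxp) as Me. clear Hxp.
  pose proof b_ge4 as B4. pose proof step_products as (N1 & _ & _ & N4 & N5 & _).
  set (e := e1) in *. clearbody e. clear Epq Ee H HB Hreg Hr Hs Ht.
  assert (m1 : 1 <= m) by (clear - N4 N5; lia).
  assert (be0 : 16 <= b * e) by (clear - B4 He; nia).
  assert (bbe : 4 * (b * e) <= b * b * e) by (clear - B4 be0; nia).
  assert (mbe : b * b * e * 4 <= b * b * e * ((m + 1) * (m + 1))) by (clear - bbe be0 m1; apply Z.mul_le_mono_nonneg_l; nia).
  assert (e4 : 4 * e <= b * e) by (clear - B4 He; apply Z.mul_le_mono_nonneg_r; lia).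
  assert (b5 : 5 * b <= b * e) by (clear - B4 He; rewrite (Z.mul_comm 5); apply Z.mul_le_mono_nonneg_l; lia).
  assert (ae0 : 0 <= a * e) by (clear - Hab He; apply Z.mul_nonneg_nonneg; lia).
  assert (aebe : a * e + e <= b * e).
  { replace (a * e + e) with ((a + 1) * e) by ring. clear - Hab He; apply Z.mul_le_mono_nonneg_r; lia. }
  assert (Sa : 0 <= a * c * e) by (clear - Hab He Hc5; repeat apply Z.mul_nonneg_nonneg; lia).
  assert (Sb : 0 <= b * c * e) by (clear - Hab He Hc5; repeat apply Z.mul_nonneg_nonneg; lia).
  assert (cbig : 8 * (b * b * e) < c) by (clear - S2 mbe; lia).
  assert (fa0 : 0 <= fa).
  { destruct (Z_lt_le_dec fa 0) as [L|L]; [exfalso|exact L].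
    assert (fa * (a * c * e + 2 * (a + c + e) - fa) <= 0) by (clear - L Sa Hab He Hc5; apply Z.mul_nonpos_nonneg; lia).
    assert ((a * e + 4) * 5 <= (c - a - e) * (c - a - e)).
    { clear - ae0 aebe bbe cbig e4 b5 be0 Hab He; apply Z.mul_le_mono_nonneg; lia. }
    clear - F2 H H0 ae0. lia. }
  assert (fb0 : 0 <= fb).
  { destruct (Z_lt_le_dec fb 0) as [L|L]; [exfalso|exact L].
    assert (fb * (b * c * e + 2 * (b + c + e) - fb) <= 0) by (clear - L Sb Hab He Hc5; apply Z.mul_nonpos_nonneg; lia).
    assert ((b * e + 4) * 5 <= (c - b - e) * (c - b - e)).
    { clear - ae0 aebe bbe cbig e4 b5 be0 Hab He; apply Z.mul_le_mono_nonneg; lia. }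
    clear - G2 H H0 be0. lia. }
  assert (Ua : fa * (a * e + 1) <= c - a - e).
  { apply f_upper; auto; clear - Hab He bbe cbig e4 b5; lia. }
  assert (La : c - 2 * a - 2 * e - 4 <= fa * (a * e + 2)).
  { apply f_lower; auto; clear - Hab He bbe cbig e4 b5 be0; lia. }
  assert (Ub : fb * (b * e + 1) <= c - b - e).
  { apply f_upper; auto; clear - Hab He bbe cbig e4 b5; lia. }
  assert (Lb : c - 2 * b - 2 * e - 4 <= fb * (b * e + 2)).
  { apply f_lower; auto; clear - Hab He bbe cbig e4 b5 be0; lia. }
  clear F1 F2 G1 G2 Sa Sb.
  assert (K1 : b + 2 * (b * (m * m)) <= fb).
  { destruct (Z_lt_le_dec fb (b + 2 * (b * (m * m)))) as [L|L]; [exfalso|exact L].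
    assert (L2 : fb * (b * e + 2) <= (b + 2 * (b * (m * m)) - 1) * (b * e + 2)) by (clear - L be0; apply Z.mul_le_mono_nonneg_r; lia).
    assert (Mm : b * (m * m) <= b * (m * (a * e))) by (clear - Me m1 B4; apply Z.mul_le_mono_nonneg_l; [lia|]; apply Z.mul_le_mono_nonneg_l; lia).
    assert (Mm2 : b * m * (a * e + e) <= b * m * (b * e)) by (clear - aebe m1 B4; apply Z.mul_le_mono_nonneg_l; [apply Z.mul_nonneg_nonneg|]; lia).
    assert (0 <= b * m * e) by (clear - m1 B4 He; repeat apply Z.mul_nonneg_nonneg; lia).
    clear - L2 Mm Mm2 H Lb S2 be0 bbe e4 b5. lia. }
  assert (K2 : fa * m < c).
  { assert (fa * m <= fa * (a * e)) by (clear - fa0 Me; apply Z.mul_le_mono_nonneg_l; lia). clear - H Ua fa0 Hab He. lia. }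
  assert (K3 : 2 * ((b - a) * n) <= fa - fb).
  { destruct (Z_lt_le_dec (fa - fb) (2 * ((b - a) * n))) as [L|L]; [exfalso|exact L].
    set (A := a * e + 2) in *. set (B := b * e + 1) in *.
    assert (A0 : 0 <= A <= b * e) by (unfold A; clear - ae0 aebe He B4; lia).
    assert (B0 : 0 <= B <= 2 * (b * e)) by (unfold B; clear - be0; lia).
    assert (AB : 0 <= A * B <= b * e * (2 * (b * e))).
    { split; [apply Z.mul_nonneg_nonneg|apply Z.mul_le_mono_nonneg]; clear - A0 B0; lia. }
    assert (C1 : B * (c - 2 * a - 2 * e - 4) <= B * (fa * A)) by (apply Z.mul_le_mono_nonneg_l; clear - B0 La; lia).
    assert (C2 : A * (fb * B) <= A * (c - b - e)) by (apply Z.mul_le_mono_nonneg_l; clear - A0 Ub; lia).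
    assert (C3 : (fa - fb) * (A * B) <= 2 * ((b - a) * n) * (A * B)) by (apply Z.mul_le_mono_nonneg_r; clear - AB L; lia).
    assert (Dn : 0 <= (b - a) * n <= (b - a) * m) by (clear - Hab N4 N5; split; [apply Z.mul_nonneg_nonneg|apply Z.mul_le_mono_nonneg_l]; lia).
    assert (C4 : 2 * ((b - a) * n) * (A * B) <= 2 * ((b - a) * m) * (b * e * (2 * (b * e)))) by (apply Z.mul_le_mono_nonneg; clear - Dn AB; lia).
    assert (C5 : B * (2 * a + 2 * e + 4) <= 2 * (b * e) * (5 * e)) by (apply Z.mul_le_mono_nonneg; clear - B0 Hab He B4; lia).
    assert (C6 : 0 <= A * (b + e)) by (apply Z.mul_nonneg_nonneg; clear - A0 Hab He; lia).
    assert (De : 1 * e <= (b - a) * e) by (apply Z.mul_le_mono_nonneg_r; clear - Hab He; lia).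
    assert (C7 : c * (b * e - a * e) <= 2 * (c * (B - A))).
    { replace (2 * (c * (B - A))) with (c * (2 * (B - A))) by ring.
      apply Z.mul_le_mono_nonneg_l; unfold A, B; clear - De He B4 Hc5; lia. }
    assert (C8 : 20 * ((m + 1) * (b * b * e)) * ((b - a) * e) <= c * ((b - a) * e)) by (apply Z.mul_le_mono_nonneg_r; clear - De He B4 S1; lia).
    set (g := b * b * (e * e)).
    assert (g0 : 0 < g) by (unfold g; repeat apply Z.mul_pos_pos; clear - He B4; lia).
    assert (C9 : 4 * (b * (e * e)) <= g).
    { unfold g. replace (b * b * (e * e)) with (b * (b * (e * e))) by ring. apply Z.mul_le_mono_nonneg_r; [repeat apply Z.mul_nonneg_nonneg|]; clear - He B4; lia. }
    assert (C10 : 1 * g <= (b - a) * g) by (apply Z.mul_le_mono_nonneg_r; clear - Hab g0; lia).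
    assert (C11 : (b - a) * g * 1 <= (b - a) * g * m) by (apply Z.mul_le_mono_nonneg_l; clear - C10 g0 m1; lia).
    replace (20 * ((m + 1) * (b * b * e)) * ((b - a) * e)) with (20 * ((b - a) * g * m) + 20 * ((b - a) * g)) in C8 by (unfold g; ring).
    replace (2 * ((b - a) * m) * (b * e * (2 * (b * e)))) with (4 * ((b - a) * g * m)) in C4 by (unfold g; ring).
    replace (2 * (b * e) * (5 * e)) with (10 * (b * (e * e))) in C5 by ring.
    clear - C1 C2 C3 C4 C5 C6 C7 C8 C9 C10 C11 g0. lia. }
  assert (K4 : e + a + 4 * (a * m) <= fa).
  { destruct (Z_lt_le_dec fa (e + a + 4 * (a * m))) as [L|L]; [exfalso|exact L].
    assert (L2 : fa * (a * e + 2) <= (e + a + 4 * (a * m)) * (a * e + 2)) by (apply Z.mul_le_mono_nonneg_r; clear - L ae0; lia).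
    assert (Q1 : a * (e * e) <= b * (e * e)) by (apply Z.mul_le_mono_nonneg_r; clear - Hab He; nia).
    assert (Q2 : a * a * e <= b * b * e) by (apply Z.mul_le_mono_nonneg_r; [clear - He B4; lia|apply Z.mul_le_mono_nonneg; clear - Hab; lia]).
    assert (Q3 : m * (a * a * e) <= m * (b * b * e)) by (apply Z.mul_le_mono_nonneg_l; clear - Q2 m1; lia).
    assert (Q4 : a * m * 4 <= a * m * (a * e + e)).
    { apply Z.mul_le_mono_nonneg_l; [apply Z.mul_nonneg_nonneg; clear - Hab m1; lia|clear - ae0 He B4; lia]. }
    assert (Q5 : m * (a * e) <= m * (b * b * e)) by (apply Z.mul_le_mono_nonneg_l; clear - aebe bbe be0 He m1 B4; lia).
    clear - L2 La Q1 Q2 Q3 Q4 Q5 S1 S3 bbe e4 b5 be0 Hab cbig. lia. }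
  set (j := m - n). assert (Em : m = n + j) by (unfold j; ring). assert (j0 : 0 <= j) by (unfold j; clear - N4; lia). clearbody j.
  set (X := a * (m * m) - b * (n * n)) in *.
  assert (Bn : b * (n * n) <= b * (m * m)) by (apply Z.mul_le_mono_nonneg_l; clear - B4 N1; lia).
  assert (An : a * (m * m) <= b * (m * m)) by (apply Z.mul_le_mono_nonneg_r; [clear - N1; lia|clear - Hab; lia]).
  assert (An0 : 0 <= a * (m * m)) by (apply Z.mul_nonneg_nonneg; [clear - Hab; lia|clear - N1; lia]).
  assert (Bn0 : 0 <= b * (n * n)) by (apply Z.mul_nonneg_nonneg; [clear - Hab; lia|clear - N1; lia]).
  assert (Xb : - (b * (m * m)) <= X <= b * (m * m)) by (unfold X; clear - Bn An An0 Bn0; lia).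
  set (Y := fa * m - fb * n - e * (m - n) - a * m + b * n).
  assert (ED : 2 * X + eps * ((a + e - fa) * m - (b + e - fb) * n) = 2 * X - eps * Y) by (unfold Y; ring).
  rewrite ED in D.
  assert (Up : Y + 2 * (b * (m * m)) < c).
  { assert (P1 : (b + 2 * (b * (m * m))) * n <= fb * n) by (apply Z.mul_le_mono_nonneg_r; clear - N5 K1; lia).
    assert (P2 : 2 * (b * (m * m)) * 1 <= 2 * (b * (m * m)) * n) by (apply Z.mul_le_mono_nonneg_l; clear - N5 An An0; lia).
    assert (P3 : 0 <= e * (m - n)) by (apply Z.mul_nonneg_nonneg; clear - N4 He B4; lia).
    assert (P4 : 0 <= a * m) by (apply Z.mul_nonneg_nonneg; clear - m1 Hab; lia).
    unfold Y. clear - P1 P2 P3 P4 K2. lia. }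
  assert (W : 0 <= a * j * n) by (repeat apply Z.mul_nonneg_nonneg; clear - Hab j0 N5; lia).
  assert (W2 : 0 <= a * j * j) by (repeat apply Z.mul_nonneg_nonneg; clear - Hab j0 N5; lia).
  assert (W3 : 0 < (b - a) * n) by (apply Z.mul_pos_pos; clear - Hab N5; lia).
  assert (W4 : 0 <= (b - a) * n * n) by (apply Z.mul_nonneg_nonneg; clear - W3 N5; lia).
  assert (P1 : 2 * ((b - a) * n) * n <= (fa - fb) * n) by (apply Z.mul_le_mono_nonneg_r; clear - N5 K3; lia).
  assert (P2 : (e + a + 4 * (a * m)) * j <= fa * j) by (apply Z.mul_le_mono_nonneg_r; clear - j0 K4; lia).
  assert (Lo1 : 2 * X < Y) by (unfold X, Y; rewrite Em in *; clear - P1 P2 W W2 W3 W4; lia).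
  assert (Lo2 : - (2 * X) < Y) by (unfold X, Y; rewrite Em in *; clear - P1 P2 W W2 W3 W4; lia).
  assert (Z0 : 2 * X - eps * Y = 0).
  { apply (dvd_small c); [clear - Hc5; lia|exact D|]. clear - Eps Xb Up Lo1 Lo2. destruct Eps; subst; lia. }
  clear - Z0 Eps Lo1 Lo2. destruct Eps; subst; lia.
Qed.

Lemma diag_false : False.
Proof.
  destruct diag_ext as (_ & _ & _ & _ & _ & He).
  pose proof diag_zero. pose proof diag_ne_b. pose proof diag_small.
  assert (L : b < e1) by lia.
  apply (diag_regular_ext ltac:(lia)). exact (diag_exc L).
Qed.
End Diag.

Lemma meet_false : False.
Proof.
  destruct (meet_classify _ _ _ _ _ Hab Hbc Hc5 Hs0 Ht0 Hs Ht _ _ _ _ _ _ _ _ _ _ _ _ H)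
    as [[E1 E2]|(eps & [-> | ->] & [(E1 & E2 & E3 & E4)|(E1 & E2 & E3 & E4)])].
  - exact (diag_false E1 E2).
  - apply case_2a_plus; auto; lia.
  - apply case_2b_plus; auto; lia.
  - apply case_2a_minus; auto; lia.
  - apply case_2b_minus; auto; lia.
Qed.
End Cases.

Lemma big_le a b c t m M : 0 < a -> 0 < b -> 0 < t -> 0 <= m <= M -> big a b c t M -> big a b c t m.
Proof.
  intros Ha Hb Ht Hm [B1 B2 B3 B4]. constructor; auto.
  - eapply Z.le_lt_trans; [|exact B2].
    apply Z.mul_le_mono_nonneg_l; [apply Z.mul_nonneg_nonneg; lia|]. apply Z.pow_le_mono_l. lia.
  - lia.
  - intros e x He Hx. pose proof (B4 e x He Hx). lia.
Qed.

(** With at most [M] steps in the chain for [a], [meet_false] would apply. So there are at least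
    [M + 1] steps, and the first one already reaches [c]. *)
Lemma z_lower a b c d r s t x y z M : 0 < a < b -> b < c < d -> 0 < r -> 0 < s -> 0 < t -> 0 < x -> 0 < y -> 0 < z ->
  r ^ 2 = a * b + 4 -> s ^ 2 = a * c + 4 -> t ^ 2 = b * c + 4 ->
  x ^ 2 = a * d + 4 -> y ^ 2 = b * d + 4 -> z ^ 2 = c * d + 4 ->
  0 <= M -> big a b c t M -> ~ regular a b c d -> c * (a * c + 1) ^ M <= z.
Proof.
  intros Hab Hbc Hr0 Hs0 Ht0 Hx0 Hy0 Hz0 Hr Hs Ht Hx Hy Hz HM HB Hreg.
  assert (Hc5 : 5 <= c) by (pose proof (pair_ge4 a b s t Hab Hs0 Ht0 r Hr0 Hr); lia).
  destruct (meet_exists a b c s t Hab ltac:(lia) Hc5 Hs0 Ht0 Hs Ht d z x y Hz0 ltac:(lia))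
    as (p & xp & ya & q & yq & yb & e1 & e2 & m & n & H); [repeat split; auto..|].
  pose proof (meet_m H) as M1. pose proof (meet_V1 H) as V. pose proof (meet_zV H) as ZV.
  destruct (Z_le_gt_dec m M) as [L|L].
  - exfalso. refine (meet_false a b c s t Hab ltac:(lia) Hc5 Hs0 Ht0 Hs Ht _ _ _ _ _ _ _ _ _ _ _ _ H r Hr0 Hr _ Hreg).
    apply (big_le a b c t m M); auto; lia.
  - eapply Z.le_trans; [|exact ZV].
    assert (0 < a * c) by (apply Z.mul_pos_pos; lia).
    apply Z.mul_le_mono_nonneg; [lia|exact V|apply Z.pow_nonneg; lia|]. apply Z.pow_le_mono_r; lia.
Qed.

(** * Contradiction from the two bounds *)

Section CriterionScope.
Local Open Scope R_scope.

Lemma pade_Z (a b c s t x y z : Z) (k : nat) (rho : R) :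
  (0 < a < b)%Z -> (b < c)%Z -> (0 < k)%nat -> (0 < s)%Z -> (0 < t)%Z -> (0 < x)%Z -> (0 < y)%Z -> (0 < z)%Z ->
  (s ^ 2 = a * c + 4)%Z -> (t ^ 2 = b * c + 4)%Z ->
  (a * z ^ 2 + 4 * c = c * x ^ 2 + 4 * a)%Z -> (b * z ^ 2 + 4 * c = c * y ^ 2 + 4 * b)%Z ->
  0 < rho -> 2 * rho <= IZR a -> 2 * rho <= IZR b - IZR a ->
  1 <= IZR z * (27 / 64) * (256 / 27 * (IZR b - IZR a) ^ 2 / (IZR a * IZR b * IZR c ^ 2)) ^ k +
    (2 * IZR c / (IZR b * IZR z) + 2 * IZR c / (IZR a * IZR z)) * (1 + 4 / (IZR a * IZR c)) ^ (2 * k + 2) *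
    ((IZR a * IZR b) ^ 2 * IZR c * (IZR b - IZR a) ^ 2 / (rho ^ 2 * (IZR b - rho))) ^ k.
Proof.
  intros Hab Hbc Hk Hs0 Ht0 Hx0 Hy0 Hz0 Hs Ht Hx Hy r0 r1 r2.
  assert (C : forall u, (0 < u)%Z -> INR (Z.to_nat u) = IZR u).
  { intros u Hu. rewrite INR_IZR_INZ, Z2Nat.id by lia. reflexivity. }
  pose proof (PadeReal.pade_real (Z.to_nat a) (Z.to_nat b) (Z.to_nat c) (Z.to_nat s) (Z.to_nat t)
    (Z.to_nat x) (Z.to_nat y) (Z.to_nat z) k rho) as L.
  rewrite !C in L by lia. apply L; auto; try lia; apply Nat2Z.inj;
    rewrite ?Nat2Z.inj_add, ?Nat2Z.inj_mul, ?Z2Nat.id by lia; lia.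
Qed.

Lemma bernoulli_upper (u : R) (n : nat) : 0 <= u -> (1 + u) ^ n * (1 - INR n * u) <= 1.
Proof.
  intros Hu. induction n as [|n IH]; [simpl; lra|].
  rewrite S_INR. simpl. pose proof (pow_le (1 + u) n ltac:(lra)). pose proof (pos_INR n).
  apply Rle_trans with ((1 + u) ^ n * (1 - INR n * u)); [|exact IH].
  replace ((1 + u) * (1 + u) ^ n * (1 - (INR n + 1) * u)) with ((1 + u) ^ n * ((1 + u) * (1 - (INR n + 1) * u))) by ring.
  apply Rmult_le_compat_l; [exact H|].
  assert (0 <= (INR n + 1) * (u * u)) by (apply Rmult_le_pos; [lra|nra]). lra.
Qed.

Section Criterion.
Variables a b c s t x y z : Z.
Variables (K' M : nat) (rho P B W : R).
Let K := (K' + 2)%nat.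
Let A' := IZR a. Let B' := IZR b. Let c' := IZR c. Let z' := IZR z.
Let q := (A' * B') ^ 2 * (B' - A') ^ 2 / (rho ^ 2 * (B' - rho)).
Let E := 256 / 27 * (B' - A') ^ 2 / (A' * B').
Hypotheses (Hab : (0 < a < b)%Z) (Hbc : (b < c)%Z).
Hypotheses (Hs0 : (0 < s)%Z) (Ht0 : (0 < t)%Z) (Hx0 : (0 < x)%Z) (Hy0 : (0 < y)%Z) (Hz0 : (0 < z)%Z).
Hypotheses (Hs : (s ^ 2 = a * c + 4)%Z) (Ht : (t ^ 2 = b * c + 4)%Z).
Hypotheses (Hx : (a * z ^ 2 + 4 * c = c * x ^ 2 + 4 * a)%Z) (Hy : (b * z ^ 2 + 4 * c = c * y ^ 2 + 4 * b)%Z).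
Hypotheses (r0 : 0 < rho) (r1 : 2 * rho <= A') (r2 : 2 * rho <= B' - A').
Hypotheses (HP : (A' + B') / (A' * B') * q <= P) (HB : q <= B) (HW : q * E <= W).
(** [297 / 80] is [22 / 5] times [27 / 32]: the first collects two factors [2] and the bound
    [11 / 10] for powers of [phi], the second is twice the [27 / 64] of the Padé bound. *)
Hypothesis N1 : 297 / 80 * P * W ^ K <= c' ^ K'.
Hypothesis N2 : 22 / 5 * P * B ^ (K - 1) * c' ^ K <= (A' * c') ^ M.
Hypothesis N3 : 11 / 10 * W <= c'.
Hypothesis N4 : 44 * INR (2 * K + 4) <= A' * c'.
Hypothesis N5 : 20 <= c'.
Hypothesis HZ : (c * (a * c + 1) ^ Z.of_nat M <= z)%Z.

Let phi := 1 + 4 / (A' * c').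
Let X := 256 / 27 * (B' - A') ^ 2 / (A' * B' * c' ^ 2).
Let Q := q * c'.
Let C0 := 2 * c' * (A' + B') / (A' * B').

Lemma crit_pos : 1 <= A' /\ A' + 1 <= B' /\ B' < c' /\ 0 < z' /\ 0 < q /\ 0 < E /\ 0 < X /\ 0 < C0 /\ 1 <= phi.
Proof.
  assert (1 <= A') by (apply IZR_le; lia).
  assert (A' + 1 <= B') by (unfold A', B'; rewrite <- plus_IZR; apply IZR_le; lia).
  assert (B' < c') by (apply IZR_lt; lia).
  assert (0 < z') by (apply IZR_lt; lia).
  assert (AB : 0 < A' * B') by (apply Rmult_lt_0_compat; lra).
  assert (D : 0 < (B' - A') ^ 2) by (apply pow_lt; lra).
  assert (cc : 0 < c' ^ 2) by (apply pow_lt; lra).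
  repeat split; auto.
  - apply Rdiv_lt_0_compat; [apply Rmult_lt_0_compat; [apply pow_lt; exact AB|exact D]|].
    apply Rmult_lt_0_compat; [apply pow_lt; lra|lra].
  - apply Rdiv_lt_0_compat; [lra|exact AB].
  - apply Rdiv_lt_0_compat; [lra|apply Rmult_lt_0_compat; lra].
  - apply Rdiv_lt_0_compat; [apply Rmult_lt_0_compat; lra|exact AB].
  - unfold phi. assert (0 < 4 / (A' * c')) by (apply Rdiv_lt_0_compat; [lra|apply Rmult_lt_0_compat; lra]). lra.
Qed.

(** [N4] makes [n] times [4 / (a c)] at most [1 / 11], and Bernoulli's inequality turns this into
    [11 / 10]. *)
Lemma crit_phi n : (n <= 2 * K + 4)%nat -> phi ^ n <= 11 / 10.
Proof.
  intros Hn. destruct crit_pos as (H1 & H2 & H3 & _).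
  assert (AC : 0 < A' * c') by (apply Rmult_lt_0_compat; lra).
  set (u := 4 / (A' * c')). assert (u0 : 0 < u) by (apply Rdiv_lt_0_compat; lra).
  pose proof (bernoulli_upper u n ltac:(lra)) as L. fold u in phi.
  assert (V : INR n * u <= 1 / 11).
  { unfold u. apply Rmult_le_reg_r with (A' * c'); [exact AC|].
    replace (INR n * (4 / (A' * c')) * (A' * c')) with (4 * INR n) by (field; lra).
    apply le_INR in Hn. lra. }
  change (1 + u) with phi in L. pose proof (pow_lt phi n ltac:(unfold phi; fold u; lra)). nra.
Qed.

Lemma crit_pade k : (0 < k)%nat -> z' <= 2 * (27 / 64 * z' * X ^ k * z') \/ z' < 2 * (C0 * phi ^ (2 * k + 2) * Q ^ k).
Proof.
  intros Hk. destruct crit_pos as (H1 & H2 & H3 & H4 & _).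
  pose proof (pade_Z a b c s t x y z k rho Hab Hbc Hk Hs0 Ht0 Hx0 Hy0 Hz0 Hs Ht Hx Hy r0 r1 r2) as L.
  fold A' B' c' z' in L. fold X in L. fold phi in L.
  replace ((A' * B') ^ 2 * c' * (B' - A') ^ 2 / (rho ^ 2 * (B' - rho))) with Q in L
    by (unfold Q, q, Rdiv; ring).
  replace (2 * c' / (B' * z') + 2 * c' / (A' * z')) with (C0 / z') in L by (unfold C0; field; lra).
  set (u := X ^ k) in *. set (v := phi ^ (2 * k + 2)) in *. set (w := Q ^ k) in *. clearbody u v w.
  assert (L2 : z' <= 27 / 64 * z' * u * z' + C0 * v * w).
  { apply (Rmult_le_compat_l z') in L; [|lra].
    replace (z' * (z' * (27 / 64) * u + C0 / z' * v * w)) with (27 / 64 * z' * u * z' + C0 * v * w) in L by (field; lra). lra. }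
  destruct (Rle_dec z' (2 * (27 / 64 * z' * u * z'))) as [G|G]; [left; exact G|right; lra].
Qed.

Lemma crit_start : 11 / 5 * (C0 * Q ^ K) <= z'.
Proof.
  destruct crit_pos as (H1 & H2 & H3 & H4 & H5 & H6 & H7 & H8 & H9).
  assert (Z1 : c' * (A' * c' + 1) ^ M <= z').
  { unfold c', A', z'. rewrite <- mult_IZR, <- plus_IZR, pow_IZR, <- mult_IZR. apply IZR_le. exact HZ. }
  assert (AC : 0 < A' * c') by (apply Rmult_lt_0_compat; lra).
  assert (Z2 : (A' * c') ^ M <= (A' * c' + 1) ^ M) by (apply pow_incr; lra).
  assert (S0 : 0 < (A' + B') / (A' * B')) by (apply Rdiv_lt_0_compat; [|apply Rmult_lt_0_compat]; lra).
  set (g := (A' + B') / (A' * B')) in *.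
  assert (cK : 0 < c' ^ K) by (apply pow_lt; lra).
  assert (qK : q ^ (K - 1) <= B ^ (K - 1)) by (apply pow_incr; lra).
  assert (qK0 : 0 < q ^ (K - 1)) by (apply pow_lt; lra).
  assert (Sq : 0 < g * q) by (apply Rmult_lt_0_compat; lra).
  assert (T1 : g * q * q ^ (K - 1) <= P * B ^ (K - 1)) by (apply Rmult_le_compat; lra).
  assert (T2 : g * q * q ^ (K - 1) * c' ^ K <= P * B ^ (K - 1) * c' ^ K) by (apply Rmult_le_compat_r; lra).
  assert (T0 : 0 < g * q * q ^ (K - 1) * c' ^ K) by (apply Rmult_lt_0_compat; [apply Rmult_lt_0_compat|]; lra).
  assert (E1 : C0 * Q ^ K = 2 * c' * (g * q * q ^ (K - 1) * c' ^ K)).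
  { unfold Q. rewrite Rpow_mult_distr. replace (q ^ K) with (q * q ^ (K - 1)).
    - unfold C0, g, Rdiv. ring.
    - unfold K. replace (K' + 2 - 1)%nat with (K' + 1)%nat by lia. replace (K' + 2)%nat with (S (K' + 1)) by lia. reflexivity. }
  assert (T3 : 22 / 5 * (g * q * q ^ (K - 1) * c' ^ K) <= (A' * c') ^ M) by lra.
  assert (T4 : c' * (22 / 5 * (g * q * q ^ (K - 1) * c' ^ K)) <= c' * (A' * c') ^ M) by (apply Rmult_le_compat_l; lra).
  assert (Z3 : c' * (A' * c') ^ M <= c' * (A' * c' + 1) ^ M) by (apply Rmult_le_compat_l; lra).
  rewrite E1. lra.
Qed.

(** The excluded ranges of [z] for the exponents [K + i] and [K + i + 1] overlap. As
    [Q X = q E / c], hypothesis [N1] gives the first overlap and [N3] the step to the next one. *)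
Lemma crit_decay i : 2 * C0 * phi ^ (2 * (K + i) + 4) * Q * (Q * X) ^ (K + i) <= 32 / 27.
Proof.
  destruct crit_pos as (H1 & H2 & H3 & H4 & H5 & H6 & H7 & H8 & H9).
  assert (QX : Q * X = q * E / c') by (unfold Q, X, E; field; lra).
  assert (qE : 0 < q * E) by (apply Rmult_lt_0_compat; lra).
  assert (QX0 : 0 < Q * X) by (rewrite QX; apply Rdiv_lt_0_compat; lra).
  assert (QXW : Q * X <= W / c') by (rewrite QX; apply Rmult_le_compat_r; [left; apply Rinv_0_lt_compat; lra|exact HW]).
  assert (Q0 : 0 < Q) by (unfold Q; apply Rmult_lt_0_compat; lra).
  induction i as [|i IH].
  - rewrite Nat.add_0_r.
    assert (Ph : phi ^ (2 * K + 4) <= 11 / 10) by (apply crit_phi; lia).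
    assert (Ph0 : 0 < phi ^ (2 * K + 4)) by (apply pow_lt; lra).
    set (g := (A' + B') / (A' * B')) in *.
    assert (g0 : 0 < g) by (apply Rdiv_lt_0_compat; [|apply Rmult_lt_0_compat]; lra).
    assert (E0 : C0 * Q = 2 * c' ^ 2 * (g * q)) by (unfold C0, Q, g, Rdiv; ring).
    assert (gq : 0 < g * q) by (apply Rmult_lt_0_compat; lra).
    assert (cc : 0 < c' ^ 2) by (apply pow_lt; lra).
    assert (Wk : (Q * X) ^ K <= (W / c') ^ K) by (apply pow_incr; lra).
    assert (Wk0 : 0 < (Q * X) ^ K) by (apply pow_lt; lra).
    assert (T1 : 2 * C0 * phi ^ (2 * K + 4) * Q * (Q * X) ^ K <= 2 * (2 * c' ^ 2 * P) * (11 / 10) * (W / c') ^ K).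
    { replace (2 * C0 * phi ^ (2 * K + 4) * Q) with (2 * (C0 * Q) * phi ^ (2 * K + 4)) by ring. rewrite E0.
      assert (0 <= c' ^ 2 * (g * q) <= c' ^ 2 * P).
      { split; [apply Rmult_le_pos; lra|apply Rmult_le_compat_l; lra]. }
      apply Rmult_le_compat; [apply Rmult_le_pos; lra|lra| |exact Wk].
      apply Rmult_le_compat; lra. }
    eapply Rle_trans; [exact T1|].
    assert (cK : 0 < c' ^ K') by (apply pow_lt; lra).
    replace (2 * (2 * c' ^ 2 * P) * (11 / 10) * (W / c') ^ K) with (22 / 5 * (P * W ^ K) / c' ^ K').
    + apply Rmult_le_reg_r with (c' ^ K'); [exact cK|].
      unfold Rdiv at 1. rewrite Rmult_assoc, Rinv_l by lra. lra.
    + unfold Rdiv at 4. rewrite Rpow_mult_distr, pow_inv. unfold K at 3. rewrite pow_add. field. split; lra.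
  - assert (St : phi ^ 2 * (Q * X) <= 1).
    { assert (phi ^ 2 <= 11 / 10) by (apply crit_phi; lia). assert (0 < phi ^ 2) by (apply pow_lt; lra).
      assert (0 < W / c') by lra.
      apply Rle_trans with (11 / 10 * (W / c')); [apply Rmult_le_compat; lra|].
      apply Rmult_le_reg_r with c'; [lra|]. unfold Rdiv at 2. rewrite !Rmult_assoc, Rinv_l by lra. lra. }
    replace (2 * (K + Datatypes.S i) + 4)%nat with ((2 * (K + i) + 4) + 2)%nat by lia.
    replace (K + Datatypes.S i)%nat with ((K + i) + 1)%nat by lia.
    rewrite !pow_add, pow_1.
    set (v := 2 * C0 * phi ^ (2 * (K + i) + 4) * Q * (Q * X) ^ (K + i)) in *.
    assert (v0 : 0 <= v).
    { unfold v. apply Rmult_le_pos; [|apply pow_le; lra]. apply Rmult_le_pos; [|lra]. apply Rmult_le_pos; [lra|apply pow_le; lra]. }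
    assert (F : 2 * C0 * (phi ^ (2 * (K + i) + 4) * phi ^ 2) * Q * ((Q * X) ^ (K + i) * (Q * X)) = v * (phi ^ 2 * (Q * X)))
      by (unfold v; ring).
    rewrite !pow_add in F. rewrite F. rewrite <- (Rmult_1_r (32 / 27)).
    assert (0 < phi ^ 2 * (Q * X)) by (apply Rmult_lt_0_compat; [apply pow_lt|]; lra).
    apply Rmult_le_compat; lra.
Qed.

(* Starting from [k = K], the second term of the bound for [k] is too small for that
   bound to hold unless the first one is large, which makes the second term for [k + 1] small again. *)
Lemma crit_invariant i : 2 * (C0 * phi ^ (2 * (K + i) + 2) * Q ^ (K + i)) <= z' /\ 32 / 27 <= z' * X ^ (K + i).
Proof.
  destruct crit_pos as (H1 & H2 & H3 & H4 & H5 & H6 & H7 & H8 & H9).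
  assert (Q0 : 0 < Q) by (unfold Q; apply Rmult_lt_0_compat; lra).
  assert (second : forall k, (0 < k)%nat -> 2 * (C0 * phi ^ (2 * k + 2) * Q ^ k) <= z' -> 32 / 27 <= z' * X ^ k).
  { intros k Hk L. destruct (crit_pade k Hk) as [G|G]; [|lra].
    apply Rmult_le_reg_r with (27 / 32 * z'); [lra|].
    replace (32 / 27 * (27 / 32 * z')) with z' by field. lra. }
  induction i as [|i [IH1 IH2]].
  - rewrite Nat.add_0_r.
    assert (L : 2 * (C0 * phi ^ (2 * K + 2) * Q ^ K) <= z').
    { eapply Rle_trans; [|exact crit_start].
      assert (Ph : phi ^ (2 * K + 2) <= 11 / 10) by (apply crit_phi; lia).
      assert (CQ : 0 < C0 * Q ^ K) by (apply Rmult_lt_0_compat; [lra|apply pow_lt; lra]).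
      replace (C0 * phi ^ (2 * K + 2) * Q ^ K) with (C0 * Q ^ K * phi ^ (2 * K + 2)) by ring.
      assert (C0 * Q ^ K * phi ^ (2 * K + 2) <= C0 * Q ^ K * (11 / 10)) by (apply Rmult_le_compat_l; lra). lra. }
    split; [exact L|]. apply second; [unfold K; lia|exact L].
  - assert (L : 2 * (C0 * phi ^ (2 * (K + Datatypes.S i) + 2) * Q ^ (K + Datatypes.S i)) <= z').
    { replace (2 * (K + Datatypes.S i) + 2)%nat with (2 * (K + i) + 4)%nat by lia.
      replace (K + Datatypes.S i)%nat with (Datatypes.S (K + i)) by lia. simpl (Q ^ Datatypes.S (K + i)).
      pose proof (crit_decay i) as D. rewrite Rpow_mult_distr in D.
      assert (Xk : 0 < X ^ (K + i)) by (apply pow_lt; lra).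
      apply Rmult_le_reg_r with (X ^ (K + i)); [exact Xk|].
      eapply Rle_trans; [|exact IH2]. eapply Rle_trans; [|exact D]. apply Req_le. ring. }
    split; [exact L|]. apply second; [unfold K; lia|exact L].
Qed.

Theorem criterion : False.
Proof.
  destruct crit_pos as (H1 & H2 & H3 & H4 & H5 & H6 & H7 & H8 & H9).
  assert (X2 : X <= 1 / 2).
  { assert (AB : 0 < A' * B') by (apply Rmult_lt_0_compat; lra).
    assert (cc : 0 < c' ^ 2) by (apply pow_lt; lra).
    unfold X. apply Rmult_le_reg_r with (A' * B' * c' ^ 2); [apply Rmult_lt_0_compat; lra|].
    unfold Rdiv at 1. rewrite Rmult_assoc, Rinv_l by (apply Rgt_not_eq, Rmult_lt_0_compat; lra).
    assert ((B' - A') ^ 2 <= B' * B') by (simpl; nra).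
    assert (B' * B' <= B' * c') by (apply Rmult_le_compat_l; lra).
    assert (Bc : 20 * (B' * c') <= c' * (B' * c')) by (apply Rmult_le_compat_r; [apply Rmult_le_pos|]; lra).
    assert (Bcc : 1 * (c' * (B' * c')) <= A' * (c' * (B' * c'))).
    { apply Rmult_le_compat_r; [apply Rmult_le_pos; [lra|apply Rmult_le_pos; lra]|lra]. }
    assert (0 <= B' * B') by (apply Rmult_le_pos; lra).
    replace (A' * B' * c' ^ 2) with (A' * (c' * (B' * c'))) by ring. lra. }
  (* As [X <= 1 / 2], the exponent [K + z] makes [z X^k] at most one, below the [32 / 27] of
     [crit_invariant]. *)
  set (i := Z.to_nat z). destruct (crit_invariant i) as [_ L].
  set (k := (K + i)%nat) in *.
  assert (Xk : X ^ k <= (1 / 2) ^ k) by (apply pow_incr; lra).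
  assert (B2 : forall n, INR n + 1 <= 2 ^ n).
  { induction n as [|n IH]; [simpl; lra|]. rewrite S_INR. simpl. pose proof (pos_INR n). lra. }
  assert (zk : z' <= INR k).
  { apply Rle_trans with (INR i); [|apply le_INR; unfold k; lia].
    unfold i, z'. rewrite INR_IZR_INZ, Z2Nat.id by lia. lra. }
  assert (P2 : z' * (1 / 2) ^ k <= 1).
  { pose proof (B2 k) as Bk. unfold Rdiv. rewrite Rmult_1_l, pow_inv.
    assert (0 < 2 ^ k) by (apply pow_lt; lra).
    apply Rmult_le_reg_r with (2 ^ k); [assumption|]. rewrite Rmult_assoc, Rinv_l by lra. lra. }
  assert (z' * X ^ k <= z' * (1 / 2) ^ k) by (apply Rmult_le_compat_l; lra). lra.
Qed.
End Criterion.
End CriterionScope.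

(** For [b c > 400], [t^2 = b c + 4] exceeds [b c] by less than one percent: hence [101] against
    [4 * 100]. *)
Lemma alpha_of b c t u : 0 < b -> 0 < t -> 400 < b * c -> t ^ 2 = b * c + 4 -> 0 < u -> 101 * (b ^ 3 * u ^ 2) <= 400 * c ->
  b * t * u < 2 * c.
Proof.
  intros Hb Ht0 Hbc Ht Hu L. assert (c0 : 0 < c) by nia.
  apply sq_lt_lt; [lia|].
  replace ((b * t * u) ^ 2) with (t ^ 2 * (b ^ 2 * u ^ 2)) by ring. rewrite Ht.
  assert (W : 0 < b ^ 2 * u ^ 2) by (apply Z.mul_pos_pos; apply Z.pow_pos_nonneg; lia).
  assert (L2 : c * (101 * (b ^ 3 * u ^ 2)) <= c * (400 * c)) by (apply Z.mul_le_mono_nonneg_l; lia).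
  assert (L3 : 400 * (b ^ 2 * u ^ 2) < b * c * (b ^ 2 * u ^ 2)) by (apply Z.mul_lt_mono_pos_r; lia).
  replace (b * c * (b ^ 2 * u ^ 2)) with (c * (b ^ 3 * u ^ 2)) in L3 by ring.
  set (w := b ^ 2 * u ^ 2) in *. set (v := b ^ 3 * u ^ 2) in *.
  assert (E : b * c * w = c * v) by (unfold w, v; ring). clearbody w v.
  replace ((2 * c) ^ 2) with (4 * (c * c)) by ring. clear - L2 L3 E. lia.
Qed.

(** * Finite checks by computation *)

Definition all_below (n : nat) (P : Z -> bool) : bool := forallb (fun i => P (Z.of_nat i)) (seq 0 n).

Lemma all_belowP n P u : all_below n P = true -> 0 <= u < Z.of_nat n -> P u = true.
Proof.
  intros H Hu. unfold all_below in H. rewrite forallb_forall in H.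
  rewrite <- (Z2Nat.id u) by lia. apply H. apply in_seq. lia.
Qed.

Definition mid_pairs : list (Z * Z) :=
  (1, 5) :: (2, 6) :: (3, 7) :: (4, 8) :: (1, 12) :: (5, 12) :: (3, 15) :: (4, 15) :: (2, 16) :: (6, 16) :: nil.

Lemma mid_pairsP a b r : 0 < a -> 0 < r -> r ^ 2 = a * b + 4 -> 2 * a <= b <= 12 * a -> b <= 16 -> In (a, b) mid_pairs.
Proof.
  intros Ha Hr0 Hr Hb Hb16.
  assert (H : all_below 9 (fun a => all_below 17 (fun b => all_below 12 (fun r =>
    negb ((0 <? a) && (2 * a <=? b) && (b <=? 12 * a) && (r * r =? a * b + 4)) ||
    existsb (fun p => (fst p =? a) && (snd p =? b)) mid_pairs))) = true) by (vm_compute; reflexivity).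
  apply all_belowP with (u := a) in H; [|lia]. apply all_belowP with (u := b) in H; [|lia].
  assert (ab : a * b <= 8 * 16) by (apply Z.mul_le_mono_nonneg; lia).
  apply all_belowP with (u := r) in H; [|split; [lia|clear - Hr Hr0 ab; nia]].
  apply orb_true_iff in H. destruct H as [H|H].
  - exfalso. apply negb_true_iff in H. rewrite !andb_false_iff in H.
    rewrite Z.ltb_ge, !Z.leb_gt, Z.eqb_neq in H. lia.
  - apply existsb_exists in H. destruct H as ([u v] & H1 & H2). simpl in H2.
    apply andb_true_iff in H2. rewrite !Z.eqb_eq in H2. destruct H2; subst. exact H1.
Qed.

(* The third elements [c] of the triples [{1, 12, c}] skip the range where the estimates fail. *)
Lemma gap_1_12 c s t : 0 < s -> 0 < t -> s ^ 2 = c + 4 -> t ^ 2 = 12 * c + 4 -> 1613 * 12 ^ 4 <= c -> 51000000 <= c.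
Proof.
  intros Hs0 Ht0 Hs Ht Hc. destruct (Z_lt_le_dec c 51000000) as [L|L]; [exfalso|exact L].
  (* Eliminating [c] gives [t^2 = 12 s^2 - 44], and the range of [c] leaves [5783 <= s < 7142]. *)
  assert (H : all_below 1359 (fun i => let u := 12 * (i + 5783) * (i + 5783) - 44 in negb (Z.sqrt u ^ 2 =? u)) = true)
    by (vm_compute; reflexivity).
  apply all_belowP with (u := s - 5783) in H.
  - cbv zeta in H. apply negb_true_iff, Z.eqb_neq in H. apply H.
    replace (12 * (s - 5783 + 5783) * (s - 5783 + 5783) - 44) with (t * t) by lia. rewrite Z.sqrt_square by lia. ring.
  - assert (5782 < s) by (apply sq_lt_lt; lia). assert (s < 7142) by (apply sq_lt_lt; lia). lia.
Qed.

(** For the range [b > 12 a], where [l] is the binary logarithm of [b] rounded down and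
    [M = 4 l + 4]. *)
Lemma log2_bounds (l : nat) : (4 <= l)%nat ->
  (4 * Z.of_nat l + 5) ^ 4 <= 100000 * 2 ^ Z.of_nat l /\ (5 <= Z.of_nat l -> 4 * Z.of_nat l + 4 <= 2 ^ Z.of_nat l).
Proof.
  intros Hl. destruct (Nat.eq_dec l 4) as [->|Hne]; [simpl; lia|].
  replace l with (5 + (l - 5))%nat by lia. generalize (l - 5)%nat. clear l Hl Hne. intros i.
  induction i as [|i [IH1 IH2]]; [simpl; lia|].
  rewrite Nat.add_succ_r, Nat2Z.inj_succ, Z.pow_succ_r by lia.
  set (u := Z.of_nat (5 + i)) in *. assert (U : 5 <= u) by (unfold u; lia). clearbody u.
  split; [|lia].
  apply Z.le_trans with (2 * (4 * u + 5) ^ 4); [|lia].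
  replace u with (5 + (u - 5)) by ring. assert (V : 0 <= u - 5) by lia. generalize dependent (u - 5).
  intros v V. assert (0 <= v * v) by nia. assert (0 <= v * v * v) by (apply Z.mul_nonneg_nonneg; lia).
  assert (0 <= v * v * v * v) by (apply Z.mul_nonneg_nonneg; lia). unfold Z.succ. lia.
Qed.

Lemma next_sq_le u k : 0 <= k -> k ^ 2 < u ^ 2 -> (k + 1) ^ 2 <= u ^ 2.
Proof.
  intros Hk L. replace (u ^ 2) with (Z.abs u ^ 2) in * by (destruct (Z.abs_spec u) as [[_ ->]|[_ ->]]; ring).
  apply sq_lt_lt in L; [|lia]. apply Z.pow_le_mono_l. lia.
Qed.

(** * The three ranges of [b / a] *)

Section Impossible.
Variables a b c d r s t x y z : Z.
Hypotheses (Hab : 0 < a < b) (Hbc : b < c < d).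
Hypotheses (Hr0 : 0 < r) (Hs0 : 0 < s) (Ht0 : 0 < t) (Hx0 : 0 < x) (Hy0 : 0 < y) (Hz0 : 0 < z).
Hypotheses (Hr : r ^ 2 = a * b + 4) (Hs : s ^ 2 = a * c + 4) (Ht : t ^ 2 = b * c + 4).
Hypotheses (Hx : x ^ 2 = a * d + 4) (Hy : y ^ 2 = b * d + 4) (Hz : z ^ 2 = c * d + 4).
Hypothesis Hreg : ~ regular a b c d.
Hypothesis Hc : 890 * b ^ 4 <= c.

(* [P], [B] and [W] bound [(1/a + 1/b) q], [q] and [q E], with [q] and [E] as in the section [Criterion].
   The condition on [B] makes the second term of the bound of [pade_Z] small for [k = K' + 2], and the
   one on [W ^ (K' + 2)] propagates this to all larger [k]. *)
Lemma impossible (K' M : nat) (rho P B W c0 : R) :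
  (101 * (b ^ 3 * ((Z.of_nat M + 1) ^ 2) ^ 2) <= 400 * c)%Z ->
  (Z.of_nat M <= 4 * (a * b))%Z ->
  (forall e u, b < e -> u ^ 2 = a * e + 4 -> Z.of_nat M <= a * e)%Z ->
  (K' + 2 <= M)%nat ->
  (0 < c0 -> c0 <= IZR c ->
  0 < rho -> 2 * rho <= IZR a -> 2 * rho <= IZR b - IZR a ->
  (IZR a + IZR b) / (IZR a * IZR b) * ((IZR a * IZR b) ^ 2 * (IZR b - IZR a) ^ 2 / (rho ^ 2 * (IZR b - rho))) <= P ->
  (IZR a * IZR b) ^ 2 * (IZR b - IZR a) ^ 2 / (rho ^ 2 * (IZR b - rho)) <= B ->
  (IZR a * IZR b) ^ 2 * (IZR b - IZR a) ^ 2 / (rho ^ 2 * (IZR b - rho)) * (256 / 27 * (IZR b - IZR a) ^ 2 / (IZR a * IZR b)) <= W ->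
  297 / 80 * P * W ^ (K' + 2) <= c0 ^ K' ->
  22 / 5 * P * B ^ (K' + 1) <= IZR a ^ M * c0 ^ (M - (K' + 2)) ->
  11 / 10 * W <= c0 -> 44 * INR (2 * (K' + 2) + 4) <= c0 -> False)%R.
Proof.
  intros G1 G2 G3 HKM c00 Hc0 r0 r1 r2 HP HB HW N1 N2 N3 N4.
  pose proof (pair_ge4 a b s t Hab Hs0 Ht0 r Hr0 Hr) as B4.
  assert (BC : 400 < b * c).
  { assert (4 * c <= b * c) by (apply Z.mul_le_mono_nonneg_r; lia).
    assert (0 < b ^ 4) by (apply Z.pow_pos_nonneg; lia). lia. }
  assert (HBig : big a b c t (Z.of_nat M)).
  { constructor; auto. apply alpha_of; auto; try lia. }
  pose proof (z_lower a b c d r s t x y z (Z.of_nat M) Hab Hbc Hr0 Hs0 Ht0 Hx0 Hy0 Hz0 Hr Hs Ht Hx Hy Hz ltac:(lia) HBig Hreg) as ZL.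
  assert (A1 : (1 <= IZR a)%R) by (apply IZR_le; lia).
  assert (P0 : (0 <= P)%R).
  { eapply Rle_trans; [|exact HP].
    assert (0 < IZR a * IZR b)%R by (apply Rmult_lt_0_compat; apply IZR_lt; lia).
    assert (IZR a < IZR b)%R by (apply IZR_lt; lia).
    apply Rmult_le_pos; apply Rlt_le; apply Rdiv_lt_0_compat; try lra;
      repeat apply Rmult_lt_0_compat; try apply pow_lt; lra. }
  apply (criterion a b c s t x y z K' M rho P B W); auto; try (clear - Hbc; lia).
  - rewrite Hz, Hx. ring.
  - rewrite Hz, Hy. ring.
  - eapply Rle_trans; [exact N1|]. apply pow_incr; lra.
  - replace (K' + 2 - 1)%nat with (K' + 1)%nat by lia.
    rewrite Rpow_mult_distr. replace M with ((M - (K' + 2)) + (K' + 2))%nat at 2 by lia.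
    rewrite (pow_add (IZR c) (M - (K' + 2)) (K' + 2)).
    assert (c0 ^ (M - (K' + 2)) <= IZR c ^ (M - (K' + 2)))%R by (apply pow_incr; lra).
    assert (0 < IZR a ^ M)%R by (apply pow_lt; lra).
    rewrite <- Rmult_assoc. apply Rmult_le_compat_r; [apply pow_le; lra|].
    eapply Rle_trans; [exact N2|]. apply Rmult_le_compat_l; lra.
  - lra.
  - assert (1 * IZR c <= IZR a * IZR c)%R by (apply Rmult_le_compat_r; lra). lra.
  - rewrite plus_INR, mult_INR, plus_INR in N4. pose proof (pos_INR K'). simpl in N4. lra.
Qed.

Lemma ext_simple M : M <= a * (b + 1) -> forall e u, b < e -> u ^ 2 = a * e + 4 -> M <= a * e.
Proof.
  intros HM e u He _. assert (a * (b + 1) <= a * e) by (apply Z.mul_le_mono_nonneg_l; lia). lia.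
Qed.

Lemma c0_le k : k * b ^ 4 <= c -> (IZR k * IZR b ^ 4 <= IZR c)%R.
Proof. intros L. rewrite (pow_IZR b 4), <- mult_IZR. apply IZR_le. exact L. Qed.

Section Real.
Variables A B : R.
Local Open Scope R_scope.
Hypotheses (HA : 1 <= A) (HAB : A + 1 <= B).

(** The choice [rho = (b - a) / 2], the largest one allowed for [b <= 2 a]. *)
Lemma q_near : (A * B) ^ 2 * (B - A) ^ 2 / (((B - A) / 2) ^ 2 * (B - (B - A) / 2)) = 8 * (A * B) ^ 2 / (A + B).
Proof. field. lra. Qed.

(** The choice [rho = a / 2], the largest one allowed for [b >= 2 a]. *)
Lemma q_far : (A * B) ^ 2 * (B - A) ^ 2 / ((A / 2) ^ 2 * (B - A / 2)) = 8 * B ^ 2 * (B - A) ^ 2 / (2 * B - A).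
Proof. field. lra. Qed.

Lemma near_P : (A + B) / (A * B) * (8 * (A * B) ^ 2 / (A + B)) <= 8 * B ^ 2.
Proof.
  replace ((A + B) / (A * B) * (8 * (A * B) ^ 2 / (A + B))) with (8 * (A * B)) by (field; lra).
  assert (A * B <= B * B) by (apply Rmult_le_compat_r; lra). lra.
Qed.

Lemma near_B : 8 * (A * B) ^ 2 / (A + B) <= 4 * B ^ 3.
Proof.
  apply Rmult_le_reg_r with (A + B); [lra|]. unfold Rdiv. rewrite Rmult_assoc, Rinv_l, Rmult_1_r by lra.
  assert (H1 : A * A <= A * B) by (apply Rmult_le_compat_l; lra).
  assert (H2 : A * B <= B * B) by (apply Rmult_le_compat_r; lra).
  assert (0 <= B * B) by (apply Rmult_le_pos; lra).
  assert (B * B * (A * A) <= B * B * (A * B)) by (apply Rmult_le_compat_l; lra).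
  assert (B * B * (A * B) <= B * B * (B * B)) by (apply Rmult_le_compat_l; lra). lra.
Qed.

(** [12 A (B - A)^2 <= B^2 (A + B)], sharp at [B = 2 A], is the source of [512 / 81]. *)
Lemma near_W : B <= 2 * A -> 8 * (A * B) ^ 2 / (A + B) * (256 / 27 * (B - A) ^ 2 / (A * B)) <= 512 / 81 * B ^ 3.
Proof.
  intros H.
  replace (8 * (A * B) ^ 2 / (A + B) * (256 / 27 * (B - A) ^ 2 / (A * B))) with (2048 / 27 * (A * B * (B - A) ^ 2) / (A + B)) by (field; lra).
  apply Rmult_le_reg_r with (A + B); [lra|]. unfold Rdiv at 1. rewrite Rmult_assoc, Rinv_l, Rmult_1_r by lra.
  assert (G : 12 * (A * (B - A) ^ 2) <= B ^ 2 * (A + B)).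
  { set (Y := B - A). replace A with (B - Y) by (unfold Y; ring). assert (Y0 : 0 < Y) by (unfold Y; lra).
    assert (Y1 : 2 * Y <= B) by (unfold Y; lra). clearbody Y.
    assert (0 <= (B - 2 * Y) * (2 * (B * B) + 3 * (B * Y) - 6 * (Y * Y))).
    { apply Rmult_le_pos; [lra|]. assert (2 * Y * Y <= B * Y) by (apply Rmult_le_compat_r; lra).
      assert (0 <= B * B) by (apply Rmult_le_pos; lra). lra. }
    lra. }
  assert (B * (12 * (A * (B - A) ^ 2)) <= B * (B ^ 2 * (A + B))) by (apply Rmult_le_compat_l; lra). lra.
Qed.

Lemma far_den : 8 * B ^ 2 * (B - A) ^ 2 / (2 * B - A) * (2 * B - A) = 8 * B ^ 2 * (B - A) ^ 2.
Proof. field. lra. Qed.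

Lemma far_pos : 0 < 8 * B ^ 2 * (B - A) ^ 2 / (2 * B - A).
Proof. apply Rdiv_lt_0_compat; [|lra]. apply Rmult_lt_0_compat; [apply Rmult_lt_0_compat; [lra|]|]; apply pow_lt; lra. Qed.

Lemma far_B : 8 * B ^ 2 * (B - A) ^ 2 / (2 * B - A) <= 4 * B ^ 3.
Proof.
  apply Rmult_le_reg_r with (2 * B - A); [lra|]. rewrite far_den.
  assert (0 <= B * B) by (apply Rmult_le_pos; lra).
  assert (H1 : 0 <= (B - A) * A) by (apply Rmult_le_pos; lra).
  assert (B * B * (2 * ((B - A) * (B - A))) <= B * B * (B * (2 * B - A))).
  { apply Rmult_le_compat_l; [lra|]. assert (0 <= B * A) by (apply Rmult_le_pos; lra). lra. }
  lra.
Qed.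

(** When [a] may be as small as one, the second factor is bounded only by a multiple of [b], which
    raises the order to [b^4]. *)
Lemma far_W : 8 * B ^ 2 * (B - A) ^ 2 / (2 * B - A) * (256 / 27 * (B - A) ^ 2 / (A * B)) <= 1024 / 27 * B ^ 4.
Proof.
  pose proof far_B as L. pose proof far_pos as L0.
  assert (E : 256 / 27 * (B - A) ^ 2 / (A * B) <= 256 / 27 * B).
  { assert (AB : 0 < A * B) by (apply Rmult_lt_0_compat; lra).
    apply Rmult_le_reg_r with (A * B); [exact AB|]. unfold Rdiv at 1. rewrite Rmult_assoc, Rinv_l, Rmult_1_r by lra.
    assert ((B - A) * (B - A) <= B * B) by (apply Rmult_le_compat; lra).
    assert (1 * (B * B) <= A * (B * B)) by (apply Rmult_le_compat_r; [apply Rmult_le_pos|]; lra). lra. }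
  assert (0 <= 256 / 27 * (B - A) ^ 2 / (A * B)).
  { apply Rlt_le, Rdiv_lt_0_compat; [|apply Rmult_lt_0_compat; lra]. apply Rmult_lt_0_compat; [lra|apply pow_lt; lra]. }
  apply Rle_trans with (4 * B ^ 3 * (256 / 27 * B)); [apply Rmult_le_compat; lra|]. lra.
Qed.

Lemma far_P : 12 * A <= B -> (A + B) / (A * B) * (8 * B ^ 2 * (B - A) ^ 2 / (2 * B - A)) <= 13 / 3 * B ^ 3.
Proof.
  intros H. pose proof far_B as L. pose proof far_pos as L0.
  assert (E : (A + B) / (A * B) <= 13 / 12).
  { assert (AB : 0 < A * B) by (apply Rmult_lt_0_compat; lra).
    apply Rmult_le_reg_r with (A * B); [exact AB|]. unfold Rdiv at 1. rewrite Rmult_assoc, Rinv_l, Rmult_1_r by lra.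
    assert (1 * B <= A * B) by (apply Rmult_le_compat_r; lra). lra. }
  assert (0 <= (A + B) / (A * B)) by (apply Rlt_le, Rdiv_lt_0_compat; [|apply Rmult_lt_0_compat]; lra).
  apply Rle_trans with (13 / 12 * (4 * B ^ 3)); [apply Rmult_le_compat; lra|]. lra.
Qed.

(** The constants here and in [mid_E] are the values at the end [B = 12 A]. *)
Lemma mid_B : B <= 12 * A -> 2 * A <= B -> 8 * B ^ 2 * (B - A) ^ 2 / (2 * B - A) <= 11616 / 3312 * B ^ 3.
Proof.
  intros H1 H2. apply Rmult_le_reg_r with (2 * B - A); [lra|]. rewrite far_den.
  set (Y := B - A). replace (2 * B - A) with (B + Y) by (unfold Y; ring).
  assert (Y0 : 0 < Y) by (unfold Y; lra). assert (Y1 : 12 * Y <= 11 * B) by (unfold Y; lra). clearbody Y.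
  assert (0 <= B * B) by (apply Rmult_le_pos; lra).
  assert (0 <= (11 * B - 12 * Y) * (11 * B + 23 * Y)) by (apply Rmult_le_pos; lra).
  assert (0 <= B * B * ((11 * B - 12 * Y) * (11 * B + 23 * Y))) by (apply Rmult_le_pos; lra). lra.
Qed.

Lemma mid_E : B <= 12 * A -> 2 * A <= B -> 0 <= 256 / 27 * (B - A) ^ 2 / (A * B) <= 7744 / 81.
Proof.
  intros H1 H2. assert (AB : 0 < A * B) by (apply Rmult_lt_0_compat; lra). split.
  - apply Rlt_le, Rdiv_lt_0_compat; [|exact AB]. apply Rmult_lt_0_compat; [lra|apply pow_lt; lra].
  - apply Rmult_le_reg_r with (A * B); [exact AB|]. unfold Rdiv at 1. rewrite Rmult_assoc, Rinv_l, Rmult_1_r by lra.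
    assert (0 <= (12 * A - B) * (12 * B - A)) by (apply Rmult_le_pos; lra). lra.
Qed.

Lemma mid_W : B <= 12 * A -> 2 * A <= B ->
  8 * B ^ 2 * (B - A) ^ 2 / (2 * B - A) * (256 / 27 * (B - A) ^ 2 / (A * B)) <= 3354 / 10 * B ^ 3.
Proof.
  intros H1 H2. pose proof (mid_B H1 H2) as L. pose proof far_pos as L0. pose proof (mid_E H1 H2) as [E0 E1].
  assert (0 < B ^ 3) by (apply pow_lt; lra).
  apply Rle_trans with (11616 / 3312 * B ^ 3 * (7744 / 81)); [apply Rmult_le_compat; lra|]. lra.
Qed.

Lemma mid_P : B <= 12 * A -> 2 * A <= B ->
  (A + B) / (A * B) * (8 * B ^ 2 * (B - A) ^ 2 / (2 * B - A)) <= 456 / 10 * B ^ 2.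
Proof.
  intros H1 H2. pose proof (mid_B H1 H2) as L. pose proof far_pos as L0.
  assert (E : (A + B) / (A * B) <= 13 / B).
  { apply Rmult_le_reg_r with (A * B); [apply Rmult_lt_0_compat; lra|].
    replace ((A + B) / (A * B) * (A * B)) with (A + B) by (field; lra).
    replace (13 / B * (A * B)) with (13 * A) by (field; lra). lra. }
  assert (0 <= (A + B) / (A * B)) by (apply Rlt_le, Rdiv_lt_0_compat; [|apply Rmult_lt_0_compat]; lra).
  assert (0 < B ^ 2) by (apply pow_lt; lra).
  apply Rle_trans with (13 / B * (11616 / 3312 * B ^ 3)); [apply Rmult_le_compat; lra|].
  replace (13 / B * (11616 / 3312 * B ^ 3)) with (13 * (11616 / 3312) * B ^ 2) by (field; lra). lra.
Qed.
End Real.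

Lemma ab_real : (1 <= IZR a /\ IZR a + 1 <= IZR b)%R.
Proof. rewrite <- plus_IZR. split; apply IZR_le; lia. Qed.

Lemma four_le_b : 4 <= b.
Proof. exact (pair_ge4 a b s t Hab Hs0 Ht0 r Hr0 Hr). Qed.

(** For [b = 4] and [c] near [890 b^4], the condition on the step numbers allows no [M] beyond [9].
    With [K' = 4], [b^20] stands against [b^16] in the overlap condition, and the constants absorb
    the excess [b^4] up to [b = 23]. *)
Lemma case_near_small : b < 2 * a -> b < 24 -> False.
Proof.
  intros Hn Hb. pose proof four_le_b as B4. destruct ab_real as [A1 A2].
  assert (Hn' : (IZR b <= 2 * IZR a)%R) by (rewrite <- mult_IZR; apply IZR_le; lia).
  assert (Hb' : (4 <= IZR b <= 23)%R) by (split; apply IZR_le; lia).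
  apply (impossible 4 9 ((IZR b - IZR a) / 2) (8 * IZR b ^ 2) (4 * IZR b ^ 3) (512 / 81 * IZR b ^ 3) (890 * IZR b ^ 4)).
  - change ((Z.of_nat 9 + 1) ^ 2) with 100. replace (b ^ 4) with (b ^ 3 * b) in Hc by ring.
    assert (b ^ 3 * 4 <= b ^ 3 * b) by (apply Z.mul_le_mono_nonneg_l; [apply Z.pow_nonneg|]; lia). lia.
  - clear - Hn B4. simpl Z.of_nat. nia.
  - apply ext_simple. clear - Hn B4. simpl Z.of_nat. nia.
  - lia.
  - assert (0 < IZR b ^ 4)%R by (apply pow_lt; lra). lra.
  - apply c0_le. exact Hc.
  - lra.
  - lra.
  - lra.
  - rewrite q_near by lra. apply near_P; lra.
  - rewrite q_near by lra. apply near_B; lra.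
  - rewrite q_near by lra. apply near_W; lra.
  - set (B := IZR b) in *. simpl Nat.add.
    replace (297 / 80 * (8 * B ^ 2) * (512 / 81 * B ^ 3) ^ 6)%R with (297 / 10 * (512 / 81) ^ 6 * B ^ 16 * B ^ 4)%R by field.
    replace ((890 * B ^ 4) ^ 4)%R with (890 ^ 4 * B ^ 16)%R by ring.
    assert (0 <= B ^ 16)%R by (apply pow_le; lra).
    assert (B ^ 4 <= 23 ^ 4)%R by (apply pow_incr; lra).
    assert (B ^ 16 * B ^ 4 <= B ^ 16 * 23 ^ 4)%R by (apply Rmult_le_compat_l; lra). lra.
  - set (B := IZR b) in *. simpl Nat.add. simpl Nat.sub.
    assert (A9 : ((B / 2) ^ 9 <= IZR a ^ 9)%R) by (apply pow_incr; lra).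
    apply Rle_trans with ((B / 2) ^ 9 * (890 * B ^ 4) ^ 3)%R.
    + replace (22 / 5 * (8 * B ^ 2) * (4 * B ^ 3) ^ 5)%R with (22 / 5 * 8 * 4 ^ 5 * B ^ 17 * 1)%R by ring.
      replace ((B / 2) ^ 9 * (890 * B ^ 4) ^ 3)%R with (890 ^ 3 / 512 * B ^ 17 * B ^ 4)%R by field.
      assert (1 <= B ^ 4)%R by (apply pow_R1_Rle; lra).
      assert (0 <= B ^ 17)%R by (apply pow_le; lra).
      apply Rmult_le_compat; lra.
    + apply Rmult_le_compat_r; [apply pow_le; assert (0 <= B ^ 4)%R by (apply pow_le; lra); lra|exact A9].
  - set (B := IZR b) in *. assert (B ^ 3 * 4 <= B ^ 3 * B)%R by (apply Rmult_le_compat_l; [apply pow_le|]; lra).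
    assert (0 <= B ^ 3)%R by (apply pow_le; lra). simpl pow in *. lra.
  - assert (4 ^ 4 <= IZR b ^ 4)%R by (apply pow_incr; lra). simpl Nat.add. rewrite INR_IZR_INZ. simpl. lra.
Qed.

(** A larger [b] admits [M = 14] and with it [K' = 8], where the powers of [b] in the overlap
    condition balance exactly. *)
Lemma case_near_large : b < 2 * a -> 24 <= b -> False.
Proof.
  intros Hn Hb. destruct ab_real as [A1 A2].
  assert (Hn' : (IZR b <= 2 * IZR a)%R) by (rewrite <- mult_IZR; apply IZR_le; lia).
  assert (Hb' : (24 <= IZR b)%R) by (apply IZR_le; lia).
  apply (impossible 8 14 ((IZR b - IZR a) / 2) (8 * IZR b ^ 2) (4 * IZR b ^ 3) (512 / 81 * IZR b ^ 3) (890 * IZR b ^ 4)).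
  - change (((Z.of_nat 14 + 1) ^ 2) ^ 2) with 50625. replace (b ^ 4) with (b ^ 3 * b) in Hc by ring.
    assert (b ^ 3 * 24 <= b ^ 3 * b) by (apply Z.mul_le_mono_nonneg_l; [apply Z.pow_nonneg|]; lia). lia.
  - clear - Hn Hb. simpl Z.of_nat. nia.
  - apply ext_simple. clear - Hn Hb. simpl Z.of_nat. nia.
  - lia.
  - assert (0 < IZR b ^ 4)%R by (apply pow_lt; lra). lra.
  - apply c0_le. exact Hc.
  - lra.
  - lra.
  - lra.
  - rewrite q_near by lra. apply near_P; lra.
  - rewrite q_near by lra. apply near_B; lra.
  - rewrite q_near by lra. apply near_W; lra.
  - set (B := IZR b) in *. simpl Nat.add.
    replace (297 / 80 * (8 * B ^ 2) * (512 / 81 * B ^ 3) ^ 10)%R with (297 / 10 * (512 / 81) ^ 10 * B ^ 32)%R by field.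
    replace ((890 * B ^ 4) ^ 8)%R with (890 ^ 8 * B ^ 32)%R by ring.
    assert (0 <= B ^ 32)%R by (apply pow_le; lra). lra.
  - set (B := IZR b) in *. simpl Nat.add. simpl Nat.sub.
    assert (A9 : ((B / 2) ^ 14 <= IZR a ^ 14)%R) by (apply pow_incr; lra).
    apply Rle_trans with ((B / 2) ^ 14 * (890 * B ^ 4) ^ 4)%R.
    + replace (22 / 5 * (8 * B ^ 2) * (4 * B ^ 3) ^ 9)%R with (22 / 5 * 8 * 4 ^ 9 * B ^ 29 * 1)%R by ring.
      replace ((B / 2) ^ 14 * (890 * B ^ 4) ^ 4)%R with (890 ^ 4 / 2 ^ 14 * B ^ 29 * B)%R by field.
      assert (0 <= B ^ 29)%R by (apply pow_le; lra).
      apply Rmult_le_compat; lra.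
    + apply Rmult_le_compat_r; [apply pow_le; assert (0 <= B ^ 4)%R by (apply pow_le; lra); lra|exact A9].
  - set (B := IZR b) in *. assert (B ^ 3 * 4 <= B ^ 3 * B)%R by (apply Rmult_le_compat_l; [apply pow_le|]; lra).
    assert (0 <= B ^ 3)%R by (apply pow_le; lra). simpl pow in *. lra.
  - assert (24 ^ 4 <= IZR b ^ 4)%R by (apply pow_incr; lra). simpl Nat.add. rewrite INR_IZR_INZ. simpl. lra.
Qed.

(** The bound on [c] admits [M = 17] from [b = 17] on, whence the separate list of small pairs. With
    [K' = 9] the overlap condition has one power of [b] to spare. *)
Lemma case_mid_large : 1613 * b ^ 4 <= c -> 2 * a <= b <= 12 * a -> 17 <= b -> False.
Proof.
  intros Hc2 Hn Hb. destruct ab_real as [A1 A2].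
  assert (Hn1 : (IZR b <= 12 * IZR a)%R) by (rewrite <- mult_IZR; apply IZR_le; lia).
  assert (Hn2 : (2 * IZR a <= IZR b)%R) by (rewrite <- mult_IZR; apply IZR_le; lia).
  assert (Hb' : (17 <= IZR b)%R) by (apply IZR_le; lia).
  apply (impossible 9 17 (IZR a / 2) (456 / 10 * IZR b ^ 2) (351 / 100 * IZR b ^ 3) (3354 / 10 * IZR b ^ 3) (1613 * IZR b ^ 4)).
  - change (((Z.of_nat 17 + 1) ^ 2) ^ 2) with 104976. replace (b ^ 4) with (b ^ 3 * b) in Hc2 by ring.
    assert (b ^ 3 * 17 <= b ^ 3 * b) by (apply Z.mul_le_mono_nonneg_l; [apply Z.pow_nonneg|]; lia). clear - H Hc2 Hb. lia.
  - clear - Hn Hb. simpl Z.of_nat. nia.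
  - apply ext_simple. clear - Hn Hb. simpl Z.of_nat. nia.
  - lia.
  - assert (0 < IZR b ^ 4)%R by (apply pow_lt; lra). lra.
  - apply c0_le. exact Hc2.
  - lra.
  - lra.
  - lra.
  - rewrite q_far by lra. apply mid_P; lra.
  - rewrite q_far by lra. assert (0 < IZR b ^ 3)%R by (apply pow_lt; lra).
    eapply Rle_trans; [apply mid_B; lra|lra].
  - rewrite q_far by lra. apply mid_W; lra.
  - set (B := IZR b) in *. simpl Nat.add.
    replace (297 / 80 * (456 / 10 * B ^ 2) * (3354 / 10 * B ^ 3) ^ 11)%R with (297 / 80 * (456 / 10) * (3354 / 10) ^ 11 * B ^ 35)%R by field.
    replace ((1613 * B ^ 4) ^ 9)%R with (1613 ^ 9 * (B ^ 35 * B))%R by ring.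
    assert (0 <= B ^ 35)%R by (apply pow_le; lra).
    assert (B ^ 35 * 17 <= B ^ 35 * B)%R by (apply Rmult_le_compat_l; lra). lra.
  - set (B := IZR b) in *. simpl Nat.add. simpl Nat.sub.
    assert (A9 : ((B / 12) ^ 17 <= IZR a ^ 17)%R) by (apply pow_incr; lra).
    apply Rle_trans with ((B / 12) ^ 17 * (1613 * B ^ 4) ^ 6)%R.
    + replace (22 / 5 * (456 / 10 * B ^ 2) * (351 / 100 * B ^ 3) ^ 10)%R with (22 / 5 * (456 / 10) * (351 / 100) ^ 10 * B ^ 32)%R by field.
      replace ((B / 12) ^ 17 * (1613 * B ^ 4) ^ 6)%R with (1613 ^ 6 / 12 ^ 17 * (B ^ 32 * B ^ 9))%R by field.
      assert (0 <= B ^ 32)%R by (apply pow_le; lra).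
      assert (17 ^ 9 <= B ^ 9)%R by (apply pow_incr; lra).
      assert (B ^ 32 * 17 ^ 9 <= B ^ 32 * B ^ 9)%R by (apply Rmult_le_compat_l; lra). lra.
    + apply Rmult_le_compat_r; [apply pow_le; assert (0 <= B ^ 4)%R by (apply pow_le; lra); lra|exact A9].
  - set (B := IZR b) in *. assert (B ^ 3 * 4 <= B ^ 3 * B)%R by (apply Rmult_le_compat_l; [apply pow_le|]; lra).
    assert (0 <= B ^ 3)%R by (apply pow_le; lra). simpl pow in *. lra.
  - assert (17 ^ 4 <= IZR b ^ 4)%R by (apply pow_incr; lra). simpl Nat.add. rewrite INR_IZR_INZ. simpl. lra.
Qed.

(** For a single pair the exact values of the parameters are used instead of bounds by powers of
    [b]. *)
Lemma mid_pair (K' M : nat) (c0 : Z) : 2 * a <= b ->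
  101 * (b ^ 3 * ((Z.of_nat M + 1) ^ 2) ^ 2) <= 400 * c0 -> c0 <= c -> 0 < c0 -> Z.of_nat M <= 4 * (a * b) ->
  (forall e u, b < e -> u ^ 2 = a * e + 4 -> Z.of_nat M <= a * e) -> (K' + 2 <= M)%nat ->
  (let A := IZR a in let B := IZR b in
  let q := 8 * B ^ 2 * (B - A) ^ 2 / (2 * B - A) in let W := q * (256 / 27 * (B - A) ^ 2 / (A * B)) in
  297 / 80 * ((A + B) / (A * B) * q) * W ^ (K' + 2) <= IZR c0 ^ K' ->
  22 / 5 * ((A + B) / (A * B) * q) * q ^ (K' + 1) <= A ^ M * IZR c0 ^ (M - (K' + 2)) ->
  11 / 10 * W <= IZR c0 -> 44 * INR (2 * (K' + 2) + 4) <= IZR c0 -> False)%R.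
Proof.
  intros Hb G1 Hc0 c00 G2 G3 HKM A B q W N1 N2 N3 N4. destruct ab_real as [A1 A2].
  assert (Hn : (2 * IZR a <= IZR b)%R) by (rewrite <- mult_IZR; apply IZR_le; lia).
  apply (impossible K' M (IZR a / 2) ((A + B) / (A * B) * q) q W (IZR c0)); auto.
  - clear - G1 Hc0. lia.
  - apply IZR_lt. exact c00.
  - apply IZR_le. exact Hc0.
  - lra.
  - lra.
  - lra.
  - rewrite q_far by lra. apply Rle_refl.
  - rewrite q_far by lra. apply Rle_refl.
  - rewrite q_far by lra. apply Rle_refl.
Qed.

Ltac check_pair Ea Eb := cbv zeta; repeat split; try (intros e u); rewrite <- ?Ea, <- ?Eb;
  first [lia | rewrite ?INR_IZR_INZ; simpl; lra | idtac].

Lemma case_mid_small : 1613 * b ^ 4 <= c -> 2 * a <= b <= 12 * a -> b <= 16 -> False.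
Proof.
  intros Hc2 Hn Hb. pose proof (mid_pairsP a b r (proj1 Hab) Hr0 Hr Hn Hb) as I.
  assert (go : forall K' M c0, c0 <= c -> Z.of_nat M <= a * (b + 1) ->
    (let A := IZR a in let B := IZR b in
     let q := 8 * B ^ 2 * (B - A) ^ 2 / (2 * B - A) in let W := q * (256 / 27 * (B - A) ^ 2 / (A * B)) in
     (101 * (b ^ 3 * ((Z.of_nat M + 1) ^ 2) ^ 2) <= 400 * c0 /\ 0 < c0 /\ Z.of_nat M <= 4 * (a * b))%Z /\ (K' + 2 <= M)%nat /\
     297 / 80 * ((A + B) / (A * B) * q) * W ^ (K' + 2) <= IZR c0 ^ K' /\
     22 / 5 * ((A + B) / (A * B) * q) * q ^ (K' + 1) <= A ^ M * IZR c0 ^ (M - (K' + 2)) /\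
     11 / 10 * W <= IZR c0 /\ 44 * INR (2 * (K' + 2) + 4) <= IZR c0)%R -> False).
  { intros K' M c0 H1 H2 HH. cbv zeta in HH. destruct HH as ((H3 & H4 & H5) & H6 & H7 & H8 & H9 & H10).
    apply (mid_pair K' M c0); cbv zeta; auto; try lia. apply ext_simple. exact H2. }
  pose proof Hc2 as Hc3. pose proof Hs as Hs3. pose proof Ht as Ht3.
  destruct I as [I|[I|[I|[I|[I|[I|[I|[I|[I|[I|[]]]]]]]]]]]; injection I as Ea Eb; rewrite <- Eb in Hc3.
  (* [M = 12] is beyond the reach of [ext_simple]; but [e > 5] with [e + 4] a square implies
     [e + 4 >= 16]. *)
  - apply (mid_pair 6 12 (1613 * 5 ^ 4)); check_pair Ea Eb.
    intros He Hu. pose proof (next_sq_le u 3 ltac:(lia) ltac:(lia)). simpl Z.of_nat. lia.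
  - apply (go 5%nat 12%nat (1613 * 6 ^ 4)); check_pair Ea Eb.
  - apply (go 5%nat 12%nat (1613 * 7 ^ 4)); check_pair Ea Eb.
  - apply (go 5%nat 12%nat (1613 * 8 ^ 4)); check_pair Ea Eb.
  (* For [{1, 12}] the bound [1613 b^4] is too weak for [M = 17], and [gap_1_12] supplies a better
     one; [e > 12] implies [e + 4 >= 25]. *)
  - apply (mid_pair 9 17 51000000); check_pair Ea Eb.
    + apply (gap_1_12 c s t); rewrite <- ?Ea, <- ?Eb in Hs3, Ht3; lia.
    + intros He Hu. pose proof (next_sq_le u 4 ltac:(lia) ltac:(lia)). simpl Z.of_nat. lia.
  - apply (go 7%nat 15%nat (1613 * 12 ^ 4)); check_pair Ea Eb.
  - apply (go 7%nat 14%nat (1613 * 15 ^ 4)); check_pair Ea Eb.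
  - apply (go 6%nat 13%nat (1613 * 15 ^ 4)); check_pair Ea Eb.
  - apply (go 8%nat 15%nat (1613 * 16 ^ 4)); check_pair Ea Eb.
  - apply (go 5%nat 12%nat (1613 * 16 ^ 4)); check_pair Ea Eb.
Qed.

(** For [a = 1], [b + 4] is a square above [16]. *)
Lemma far_b_ge : 12 * a < b -> 21 <= b.
Proof.
  intros Hb. destruct (Z_lt_le_dec a 2) as [A|A]; [|lia].
  assert (Ea : a = 1) by lia. rewrite Ea in Hr, Hb. clear - Hr Hr0 Hb.
  assert (4 < r) by (apply sq_lt_lt; lia). assert (5 ^ 2 <= r ^ 2) by (apply Z.pow_le_mono_l; lia). lia.
Qed.

(** The bounds for [W] and [c] are both multiples of [b^4], with quotient above [1024 = 2^10]. The
    power [K'] of this quotient must pay for [P W^2], of order [b^11]; as [b < 2^(l + 1)], the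
    choice [K' = 2 l] does it. *)
Lemma case_far : 39247 * b ^ 4 <= c -> 12 * a < b -> False.
Proof.
  intros Hc2 Hb. pose proof (far_b_ge Hb) as B21. destruct ab_real as [A1 A2].
  assert (Hn : (12 * IZR a <= IZR b)%R) by (rewrite <- mult_IZR; apply IZR_le; lia).
  assert (Hb' : (21 <= IZR b)%R) by (apply IZR_le; lia).
  destruct (Z.log2_spec b ltac:(lia)) as [L1 L2].
  assert (L4 : 4 <= Z.log2 b) by (change 4 with (Z.log2 16); apply Z.log2_le_mono; lia).
  rewrite <- (Z2Nat.id (Z.log2 b)) in L1, L2, L4 by lia. set (l := Z.to_nat (Z.log2 b)) in *. clearbody l.
  destruct (log2_bounds l ltac:(lia)) as [D1 D2].
  assert (D3 : 4 * Z.of_nat l + 4 <= b) by (destruct (Z.eq_dec (Z.of_nat l) 4); lia).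
  apply (impossible (2 * l) (4 * l + 4) (IZR a / 2) (13 / 3 * IZR b ^ 3) (4 * IZR b ^ 3) (1024 / 27 * IZR b ^ 4) (39247 * IZR b ^ 4)).
  - replace (Z.of_nat (4 * l + 4) + 1) with (4 * Z.of_nat l + 5) by lia.
    replace (((4 * Z.of_nat l + 5) ^ 2) ^ 2) with ((4 * Z.of_nat l + 5) ^ 4) by ring.
    assert (b3 : 0 < b ^ 3) by (apply Z.pow_pos_nonneg; lia).
    assert (b ^ 3 * (4 * Z.of_nat l + 5) ^ 4 <= b ^ 3 * (100000 * b)) by (apply Z.mul_le_mono_nonneg_l; lia).
    replace (b ^ 4) with (b ^ 3 * b) in Hc2 by ring.
    assert (0 <= b ^ 3 * b) by (apply Z.mul_nonneg_nonneg; lia). clear - Hc2 H H0. lia.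
  - assert (1 * b <= a * b) by (apply Z.mul_le_mono_nonneg_r; lia). lia.
  - apply ext_simple. assert (1 * (b + 1) <= a * (b + 1)) by (apply Z.mul_le_mono_nonneg_r; lia).
    lia.
  - lia.
  - assert (0 < IZR b ^ 4)%R by (apply pow_lt; lra). lra.
  - apply c0_le. exact Hc2.
  - lra.
  - lra.
  - lra.
  - rewrite q_far by lra. apply far_P; lra.
  - rewrite q_far by lra. apply far_B; lra.
  - rewrite q_far by lra. apply far_W; lra.
  - set (B := IZR b) in *.
    assert (Bp : (B <= 2 * 2 ^ l)%R).
    { replace (2 * 2 ^ l)%R with (2 ^ S l)%R by reflexivity. rewrite pow_IZR. apply IZR_le.
      rewrite Nat2Z.inj_succ. lia. }
    assert (Bl : (0 < B ^ 4)%R) by (apply pow_lt; lra).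
    assert (B11 : (B ^ 11 <= 2 ^ (11 * l) * 2048)%R).
    { replace (2 ^ (11 * l) * 2048)%R with ((2 * 2 ^ l) ^ 11)%R.
      - apply pow_incr. lra.
      - rewrite Rpow_mult_distr, <- pow_mult, (Nat.mul_comm l). ring. }
    rewrite pow_add. rewrite !Rpow_mult_distr.
    assert (Bm : (0 < (B ^ 4) ^ (2 * l))%R) by (apply pow_lt; exact Bl).
    apply Rle_trans with (297 / 80 * (13 / 3) * (1024 / 27) ^ 2 * B ^ 11 * ((1024 / 27) ^ (2 * l) * (B ^ 4) ^ (2 * l)))%R.
    { apply Req_le. ring. }
    rewrite <- Rmult_assoc. apply Rmult_le_compat_r; [lra|].
    assert (k0 : (0 < (1024 / 27) ^ (2 * l))%R) by (apply pow_lt; lra).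
    apply Rle_trans with ((1024 * (1024 / 27)) ^ (2 * l))%R; [|apply pow_incr; lra].
    rewrite (Rpow_mult_distr 1024). apply Rmult_le_compat_r; [lra|].
    apply Rle_trans with (297 / 80 * (13 / 3) * (1024 / 27) ^ 2 * 2048 * 2 ^ (11 * l))%R; [lra|].
    replace (1024 ^ (2 * l))%R with (2 ^ (9 * l) * 2 ^ (11 * l))%R.
    + apply Rmult_le_compat_r; [apply pow_le; lra|].
      apply Rle_trans with (2 ^ 36)%R; [lra|]. apply Rle_pow; [lra|lia].
    + rewrite <- pow_add. replace 1024%R with (2 ^ 10)%R by lra. rewrite <- pow_mult. f_equal. lia.
  - set (B := IZR b) in *.
    replace (4 * l + 4 - (2 * l + 2))%nat with (S (2 * l + 1))%nat by lia.
    assert (B3 : (0 < B ^ 3)%R) by (apply pow_lt; lra).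
    assert (B4 : (B ^ 3 * 21 <= B ^ 4)%R) by (replace (B ^ 4)%R with (B ^ 3 * B)%R by ring; apply Rmult_le_compat_l; lra).
    apply Rle_trans with (1 * (39247 * B ^ 4) ^ S (2 * l + 1))%R.
    + rewrite Rmult_1_l. simpl (_ ^ S _)%R. apply Rmult_le_compat; [lra|apply pow_le; lra|lra|apply pow_incr; lra].
    + apply Rmult_le_compat_r; [apply pow_le; lra|]. apply pow_R1_Rle. lra.
  - set (B := IZR b) in *. assert (0 < B ^ 4)%R by (apply pow_lt; lra). lra.
  - rewrite INR_IZR_INZ. apply Rle_trans with (44 * IZR (4 * b))%R.
    + apply Rmult_le_compat_l; [lra|]. apply IZR_le. lia.
    + rewrite mult_IZR. set (B := IZR b) in *.
      assert (B * 1 <= B * B ^ 3)%R by (apply Rmult_le_compat_l; [lra|apply pow_R1_Rle; lra]).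
      replace (B ^ 4)%R with (B * B ^ 3)%R by ring. lra.
Qed.
End Impossible.

(** * From the quadratic equation to the quadruple *)

Import ListNotations.

Lemma positive_root n : 0 < n -> perfect_square n -> exists k, 0 < k /\ k ^ 2 = n.
Proof.
  intros Hn [k Hk]. exists (Z.abs k). split.
  - assert (k <> 0) by (intros ->; lia). lia.
  - rewrite Hk. destruct (Z.abs_spec k) as [[_ ->]|[_ ->]]; ring.
Qed.

(** If [d] were the smaller root of its quadratic equation, [f_upper] would give [d < c]. Hence
    [2 d - S] is positive and equals [r s t], the square root in [d_plus]. *)
Lemma regular_d_plus a b c d r s t : 0 < a < b -> a + b < c -> c < d ->
  0 < r -> 0 < s -> 0 < t -> r ^ 2 = a * b + 4 -> s ^ 2 = a * c + 4 -> t ^ 2 = b * c + 4 ->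
  regular a b c d -> IZR d = d_plus a b c.
Proof.
  intros Hab Hc Hd Hr0 Hs0 Ht0 Hr Hs Ht Hreg. unfold regular in Hreg.
  set (S := a * c * b + 2 * (a + c + b)).
  assert (Q : d * (S - d) = (c - a - b) ^ 2 - 4 * (a * b + 4)) by (unfold S; clear - Hreg; lia).
  assert (G : S < 2 * d).
  { destruct (Z_lt_le_dec S (2 * d)) as [G|G]; [exact G|exfalso].
    pose proof (f_upper a c b d ltac:(lia) ltac:(lia) Hc Q G) as U.
    assert (0 < d * (a * b)) by (apply Z.mul_pos_pos; [lia|apply Z.mul_pos_pos; lia]). lia. }
  assert (rst : 0 < r * s * t) by (repeat apply Z.mul_pos_pos; assumption).
  assert (E : (2 * d - S - r * s * t) * (2 * d - S + r * s * t) = 0).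
  { transitivity ((2 * d - S) ^ 2 - r ^ 2 * s ^ 2 * t ^ 2); [ring|]. rewrite Hr, Hs, Ht.
    transitivity (S ^ 2 - 4 * (d * (S - d)) - (a * b + 4) * (a * c + 4) * (b * c + 4)); [ring|].
    rewrite Q. unfold S. ring. }
  assert (D : 2 * d = S + r * s * t) by (apply Z.mul_eq_0 in E; lia).
  unfold d_plus.
  replace ((IZR a * IZR b + 4) * (IZR a * IZR c + 4) * (IZR b * IZR c + 4))%R with (IZR (r * s * t) * IZR (r * s * t))%R.
  - rewrite sqrt_square by (apply IZR_le; lia).
    apply (f_equal IZR) in D. unfold S in D. rewrite !plus_IZR, !mult_IZR, !plus_IZR in D. rewrite !mult_IZR. lra.
  - rewrite <- !mult_IZR, <- !plus_IZR, <- !mult_IZR. f_equal.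
    rewrite <- Hr, <- Hs, <- Ht. ring.
Qed.

Theorem theorem1p4 :
  forall a b c d : Z,
    D4_quadruple [a; b; c; d] ->
    a < b < c /\ c < d ->
    (b < 2 * a /\ c >= 890 * b ^ 4) \/
    (2 * a <= b <= 12 * a /\ c >= 1613 * b ^ 4) \/
    (b > 12 * a /\ c >= 39247 * b ^ 4) ->
    IZR d = d_plus a b c.
Proof.
  intros a b c d (_ & _ & Hpos & Hsq) [[Hab Hbc] Hcd] Hcase.
  assert (Ha : 0 < a) by (apply Hpos; simpl; tauto).
  assert (root : forall u v, In u [a; b; c; d] -> In v [a; b; c; d] -> u <> v -> exists k, 0 < k /\ k ^ 2 = u * v + 4).
  { intros u v Iu Iv N. apply positive_root; [|now apply Hsq].
    assert (0 < u * v) by (apply Z.mul_pos_pos; now apply Hpos). lia. }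
  destruct (root a b) as (r & Hr0 & Hr); [simpl; tauto|simpl; tauto|lia|].
  destruct (root a c) as (s & Hs0 & Hs); [simpl; tauto|simpl; tauto|lia|].
  destruct (root b c) as (t & Ht0 & Ht); [simpl; tauto|simpl; tauto|lia|].
  destruct (root a d) as (x & Hx0 & Hx); [simpl; tauto|simpl; tauto|lia|].
  destruct (root b d) as (y & Hy0 & Hy); [simpl; tauto|simpl; tauto|lia|].
  destruct (root c d) as (z & Hz0 & Hz); [simpl; tauto|simpl; tauto|lia|].
  assert (b4 : b * 1 <= b ^ 4).
  { replace (b ^ 4) with (b * b ^ 3) by ring. apply Z.mul_le_mono_nonneg_l; [lia|].
    assert (0 < b ^ 3) by (apply Z.pow_pos_nonneg; lia). lia. }
  assert (Hc : 890 * b ^ 4 <= c) by lia.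
  apply (regular_d_plus a b c d r s t); auto; [lia|].
  destruct (Z.eq_dec ((a + b - c - d) ^ 2) ((a * b + 4) * (c * d + 4))) as [R|R]; [exact R|exfalso].
  destruct Hcase as [[H1 H2]|[[H1 H2]|[H1 H2]]].
  - destruct (Z_lt_le_dec b 24) as [L|L].
    + eapply (case_near_small a b c d r s t x y z); eauto; lia.
    + eapply (case_near_large a b c d r s t x y z); eauto; lia.
  - destruct (Z_lt_le_dec b 17) as [L|L].
    + eapply (case_mid_small a b c d r s t x y z); eauto; lia.
    + eapply (case_mid_large a b c d r s t x y z); eauto; lia.
  - eapply (case_far a b c d r s t x y z); eauto; lia.
Qed.
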